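(* For every $c\in(1,8/7)$ there exist $\chi=\chi(c)\in(0,\infty)$ and $C=C(c)\in(0,\infty)$ such that for every $N\in\mathbb{Z}_+$ and every $\xi\in\mathbb{T}$ we have $$\Big|\sum_{n=1}^N e(\lfloor h(n)\rfloor\xi)-\sum_{2\le m\le h(N)}\varphi'(m)\,e(m\xi)\Big|\le C N e^{-(\log N)^{\chi}},$$ where $h(x)=\exp((\log x)^c)$ and $\varphi=h^{-1}$ is its compositional inverse.
   Context: $\mathbb{Z}_+=\{1,2,3,\dots\}$, $\mathbb{T}=\mathbb{R}/\mathbb{Z}$, $e(x)=e^{2\pi i x}$, $\log$ is the natural logarithm, and $\lfloor x\rfloor=\max\{n\in\mathbb{Z}:n\le x\}$. The function $h$ is considered on $[1,\infty)$, so that $\varphi:[1,\infty)\to(0,\infty)$ is given by $\varphi(x)=\exp((\log x)^{1/c})$, and $\varphi'$ is its derivative (defined on $(1,\infty)$). The second sum runs over integers $m$ with $2\le m\le h(N)$ and is zero if there are none. *)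

(* Defs.v *)
From mathcomp Require Import all_boot all_order all_algebra.
From mathcomp Require Import complex.
From mathcomp Require Import all_classical all_reals all_analysis.
Set Implicit Arguments.
Unset Strict Implicit.
Unset Printing Implicit Defensive.
Import Order.TTheory GRing.Theory Num.Theory.
Import numFieldNormedType.Exports.
Local Open Scope complex_scope.
Local Open Scope ring_scope.

(* e(x) = exp(2 pi i x) *)
Definition e (R : realType) (x : R) : R[i] :=
  cos (2 * pi * x) +i* sin (2 * pi * x).

(* e is 1-periodic, so that e(k xi), for k an integer, depends only on the
   class of xi in R/Z; elements of R/Z are represented by real numbers. *)
Lemma e_periodic (R : realType) (x : R) (k : int) : e (x + k%:~R) = e x.
Proof.
have eN (y : R) (n : nat) : e (y + n%:R) = e y.
  rewrite /e mulrDr; have -> : 2 * pi * n%:R = (pi *+ 2) *+ n :> R.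
    by rewrite mulr_natl mulr_natr.
  by rewrite (periodicn (@cosD2pi R)) (periodicn (@sinD2pi R)).
case: k => n; first by rewrite -pmulrn eN.
by rewrite NegzE mulrNz -pmulrn -[in LHS](eN (x - n.+1%:R) n.+1) subrK.
Qed.

(* Both h and phi are meant on [1, +oo[; there ln x >= 0, and powR satisfies
   0 `^ a = 0 for a > 0, so that h c 1 = phi c 1 = 1. *)
Definition h (R : realType) (c x : R) : R := expR (ln x `^ c).

Definition phi (R : realType) (c x : R) : R := expR (ln x `^ c^-1).

Lemma hK (R : realType) (c x : R) : 0 < c -> 1 <= x -> phi c (h c x) = x.
Proof.
move=> c0 x1; rewrite /phi /h expRK -powRrM mulfV ?gt_eqF//.
by rewrite powRr1 ?ln_ge0// lnK// posrE (lt_le_trans ltr01).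
Qed.

Lemma phiK (R : realType) (c x : R) : 0 < c -> 1 <= x -> h c (phi c x) = x.
Proof.
move=> c0 x1; rewrite /phi /h expRK -powRrM mulVf ?gt_eqF//.
by rewrite powRr1 ?ln_ge0// lnK// posrE (lt_le_trans ltr01).
Qed.

(* Main.v *)
Require Import Defs.
From mathcomp Require Import all_boot all_order all_algebra.
From mathcomp Require Import complex polyrcf.
From mathcomp Require Import all_classical all_reals all_analysis.
From mathcomp Require Import ring lra zify.
Import Order.TTheory GRing.Theory Num.Theory.
Import numFieldNormedType.Exports.
Set Implicit Arguments.
Unset Strict Implicit.
Unset Printing Implicit Defensive.
Local Open Scope complex_scope.
Local Open Scope ring_scope.

(** The sum over n counts each integer m as often as h(n) falls in [m, m + 1),
    and the local density of these n is phi'(m). For frequencies that are small,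
    |xi| h(N) <= N^(3/4), this is decisive: the counting functions of the two
    sums differ by O(1) ([floor_count_near]), and summation by parts bounds the
    difference by O(1 + h(N) |xi|) ([floor_sum_near_smooth]).

    For larger frequencies both sums are small. The second one is handled by
    summation by parts, since phi' decreases and the sums of e(m xi) are
    geometric ([smooth_sum_small]). In the first one the integer part is removed
    by expanding e(-{y} xi) with Fejér kernels ([floor_sum_bound]); this reduces
    it to the sums of e(th h(n)), n <= N, with N^(1/2) <= |th| h(N) and
    ln |th| <= (ln N)^(1/8), and these need Vinogradov's method ([h_exp_sum]).

    Put lam = ln N. If N^(J - 5/2) <= |th| h(N) <= N^(J - 3/2), then J is at most
    about lam^(c - 1), and th h is approximated, on shifts n + x y with
    x, y < Q and Q^J about N^(11/8), by a polynomial of degree k = 12 (J + 1)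
    whose J-th coefficient lies between N^(-5/2) and N^(-3/2) up to small factors
    ([block_taylor], [coef_bounds]). That it does not degenerate follows from the
    identity x^j h^(j)(x) = h(x) P_j(ln x), where P_j is of the order of the
    product of the L - i, i < j, for the logarithmic derivative
    L = c (ln x)^(c - 1), as long as j stays below L ([jet_lower]). Hölder's
    inequality, applied twice to the bilinear sum in x and y, leads to the square
    of Vinogradov's mean value and to a product of sums over pairs, of which only
    the J-th is estimated non-trivially ([bilinear_bound], [vino_block]). The
    result is a power saving N^(-1/20) for the power of order (2s)^2, s about k^3,
    of the bilinear sum. As k is at most about lam^(c - 1) and c - 1 < 1/7, this
    leaves a saving exp(-lam^(1/8)), which is where the condition c < 8/7 enters.

    The mean value theorem ([Jmv_vinogradov]) must be uniform in k, with constant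
    2^(O(k^5)). It is proved by induction, passing from k + s to s pairs of
    variables ([Jmv_recursion]): either the exponential sum is dominated by few
    short intervals, or k variables can be taken in well separated intervals. In
    the latter case the other variables are confined to an interval of length
    Q^(1 - 1/k) and their power sums, after translation, to short ranges; then k
    spaced variables with nearly prescribed power sums are determined up to
    bounded error. This rigidity ([spaced_rigid]) comes from a polynomial whose
    derivative has a prescribed sign near each of the variables, so that no
    congruences and no prime numbers are needed. *)

(** * Complex exponentials *)

(** The modulus as an element of R; the norm of R[i] takes its values in R[i]. *)
Definition cnorm {R : realType} (z : R[i]) : R := Normc.normc z.

Lemma cnormE (R : realType) (z : R[i]) : `|z| = (cnorm z)%:C.
Proof. by rewrite normc_def /cnorm /=; case: z. Qed.

Lemma cnorm_ge0 (R : realType) (z : R[i]) : 0 <= cnorm z.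
Proof. by rewrite -lecR -cnormE normr_ge0. Qed.

Lemma cnorm0 (R : realType) : cnorm (0 : R[i]) = 0.
Proof. exact: Normc.normc0. Qed.

Lemma cnormM (R : realType) (z w : R[i]) : cnorm (z * w) = cnorm z * cnorm w.
Proof. exact: Normc.normcM. Qed.

Lemma cnorm1 (R : realType) : cnorm (1 : R[i]) = 1.
Proof. exact: Normc.normc1. Qed.

Lemma cnormX (R : realType) (z : R[i]) n : cnorm (z ^+ n) = cnorm z ^+ n.
Proof. by elim: n => [|n IH]; rewrite ?cnorm1 // !exprS cnormM IH. Qed.

Lemma cnormD (R : realType) (z w : R[i]) : cnorm (z + w) <= cnorm z + cnorm w.
Proof. exact: le_normcD. Qed.

Lemma cnormN (R : realType) (z : R[i]) : cnorm (- z) = cnorm z.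
Proof. exact: normcN. Qed.

Lemma cnormB (R : realType) (z w : R[i]) : cnorm (z - w) <= cnorm z + cnorm w.
Proof. by rewrite -(cnormN w) cnormD. Qed.

Lemma cnorm_real (R : realType) (x : R) : cnorm x%:C = `|x|.
Proof. by rewrite /cnorm /= expr0n addr0 sqrtr_sqr. Qed.

Lemma cnorm_nat (R : realType) n : cnorm (n%:R : R[i]) = n%:R.
Proof.
have -> : (n%:R : R[i]) = (n%:R)%:C by rewrite rmorph_nat.
by rewrite cnorm_real ger0_norm.
Qed.

Lemma cnorm_sum (R : realType) (I : Type) (r : seq I) (P : pred I) (F : I -> R[i]) :
  cnorm (\sum_(i <- r | P i) F i) <= \sum_(i <- r | P i) cnorm (F i).
Proof.
elim/big_ind2: _ => [|x1 x2 y1 y2 h1 h2|//]; first by rewrite cnorm0.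
by rewrite (le_trans (cnormD _ _)) // lerD.
Qed.

Lemma cnorm_sqr (R : realType) (z : R[i]) : (cnorm z ^+ 2)%:C = z * z^*.
Proof. by rewrite -sqr_normc cnormE rmorphXn. Qed.

Lemma cnorm_le_ReIm (R : realType) (a b : R) : cnorm (a +i* b) <= `|a| + `|b|.
Proof.
rewrite /cnorm /= -(@ler_pXn2r _ 2) ?nnegrE ?sqrtr_ge0 ?addr_ge0 //.
rewrite sqr_sqrtr ?addr_ge0 ?sqr_ge0 // sqrrD !real_normK ?num_real //.
by have := normr_ge0 a; have := normr_ge0 b; nra.
Qed.

Lemma cnorm_e (R : realType) (x : R) : cnorm (e x) = 1.
Proof. by rewrite /cnorm /= cos2Dsin2 sqrtr1. Qed.

Lemma e0 (R : realType) : e (0 : R) = 1.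
Proof. by rewrite /e mulr0 cos0 sin0. Qed.

Lemma eD (R : realType) (x y : R) : e (x + y) = e x * e y.
Proof.
by rewrite /e mulrDr cosD sinD; simpc; congr (_ +i* _); rewrite addrC.
Qed.

Lemma e_conj (R : realType) (x : R) : (e x)^* = e (- x).
Proof. by rewrite /e /= mulrN cosN sinN. Qed.

Lemma e_int (R : realType) (k : int) : e (k%:~R : R) = 1.
Proof. by rewrite -(add0r k%:~R) e_periodic e0. Qed.

Lemma e_sum (R : realType) (I : Type) (r : seq I) (P : pred I) (F : I -> R) :
  e (\sum_(i <- r | P i) F i) = \prod_(i <- r | P i) e (F i).
Proof. by apply: (big_morph (@e R)); [exact: eD | exact: e0]. Qed.

Lemma eX (R : realType) (x : R) n : e x ^+ n = e (x *+ n).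
Proof.
by elim: n => [|n IH]; rewrite ?mulr0n ?e0 // exprS IH mulrS eD.
Qed.

Lemma sin_le_id (R : realType) (x y : R) : `|sin x - sin y| <= `|x - y|.
Proof.
wlog yx : x y / y <= x.
  by move=> H; case: (leP y x) => [|/ltW] h; [exact: H | rewrite distrC (distrC x) H].
have H : {within `[y, x], continuous (@sin R)}%classic.
  by apply/continuous_subspaceT => z; exact: continuous_sin.
have [t _ ->] := MVT_segment yx (fun z _ => is_derive_sin z) H.
by rewrite normrM ler_piMl // cos_max.
Qed.

Lemma cos_le_id (R : realType) (x y : R) : `|cos x - cos y| <= `|x - y|.
Proof.
wlog yx : x y / y <= x.
  by move=> H; case: (leP y x) => [|/ltW] h; [exact: H | rewrite distrC (distrC x) H].
have H : {within `[y, x], continuous (@cos R)}%classic.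
  by apply/continuous_subspaceT => z; exact: continuous_cos.
have [t _ ->] := MVT_segment yx (fun z _ => is_derive_cos z) H.
by rewrite normrM normrN ler_piMl // sin_max.
Qed.

Lemma pi_le4 (R : realType) : pi <= 4 :> R.
Proof. by have := @pihalf_lt2 R; lra. Qed.

Lemma cnorm_eB_le (R : realType) (x y : R) : cnorm (e x - e y) <= 16 * `|x - y|.
Proof.
have -> : e x - e y = (cos (2 * pi * x) - cos (2 * pi * y)) +i*
                      (sin (2 * pi * x) - sin (2 * pi * y)) by [].
apply: le_trans (cnorm_le_ReIm _ _) _.
apply: le_trans (lerD (cos_le_id _ _) (sin_le_id _ _)) _.
rewrite -mulrBr !normrM (ger0_norm (pi_ge0 R)) (@ger0_norm _ 2) //.
by have := @pi_le4 R; have := normr_ge0 (x - y); nra.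
Qed.

Lemma sin_ge_third (R : realType) (u : R) : 0 <= u <= pi / 2 -> u / 3 <= sin u.
Proof.
move=> /andP[u0 u2]; have p4 := @pi_le4 R; have p2 := @pi_ge2 R.
have c14 : 7 / 10 <= sin (pi / 4 : R) /\ 7 / 10 <= cos (pi / 4 : R).
  have cp : 0 < cos (pi / 4 : R) by apply: cos_gt0_pihalf; apply/andP; split; lra.
  have := @tan_piquarter R; rewrite /tan => /(canRL (divfK (lt0r_neq0 cp))).
  rewrite mul1r => sc; have := cos2Dsin2 (pi / 4 : R); rewrite sc => h.
  by split; nra.
have [c1 c2] := c14.
have [u4|u4] := leP u (pi / 4).
  have H : {within `[0, u], continuous (@sin R)}%classic.
    by apply/continuous_subspaceT => z; exact: continuous_sin.
  have [t /itvP tu] := MVT_segment u0 (fun z _ => is_derive_sin z) H.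
  rewrite sin0 !subr0 => ->.
  have ct : cos (pi / 4) <= cos t.
    have t0 : 0 <= t by rewrite tu.
    have tpi : t <= pi / 4 by rewrite (le_trans _ u4) // tu.
    have i1 : (t \in `[0, pi]) by rewrite in_itv /=; apply/andP; split; lra.
    have i2 : (pi / 4 \in `[0, pi :> R]) by rewrite in_itv /=; apply/andP; split; lra.
    by rewrite leNgt (ltr_cos i2 i1) -leNgt.
  have : 1 / 2 <= cos t by lra.
  by move: (cos t) => y hy; nra.
have : sin (pi / 4) <= sin u.
  by apply/ltW; rewrite (@ltr_sin R) // in_itv /=; apply/andP; split; lra.
by nra.
Qed.

(** Here |1 - e(x)| = 2 |sin (pi x)|, and pi |x| is at most pi / 2. *)
Lemma cnorm_1e_ge (R : realType) (x : R) : `|x| <= 2^-1 -> `|x| <= cnorm (1 - e x).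
Proof.
move=> x2; have p4 := @pi_le4 R; have p2 := @pi_ge2 R.
have E : cnorm (1 - e x) = 2 * `|sin (pi * `|x|)|.
  have -> : 1 - e x = (1 - cos (2 * pi * x)) +i* (0 - sin (2 * pi * x)) by [].
  have -> : `|sin (pi * `|x|)| = `|sin (pi * x)|.
    case: (ger0P x) => // _; by rewrite mulrN sinN normrN.
  apply/eqP; rewrite -(@eqrXn2 _ 2) ?mulr_ge0 ?cnorm_ge0 //; apply/eqP.
  rewrite /cnorm /= sqr_sqrtr ?addr_ge0 ?sqr_ge0 // exprMn real_normK ?num_real //.
  have -> : 2 * pi * x = pi * x + pi * x by ring.
  rewrite cosD sinD; have := cos2Dsin2 (pi * x).
  set s := sin _; set c := cos _ => h.
  have -> : c * c = 1 - s * s by rewrite -h; ring.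
  have -> : (0 - (s * c + c * s)) ^+ 2 = 4 * (c ^+ 2) * s ^+ 2 by ring.
  have -> : c ^+ 2 = 1 - s ^+ 2 by rewrite -h; ring.
  by ring.
have := @sin_ge_third R (pi * `|x|); have := normr_ge0 x.
set y := `|x| in x2 E * => y0 H.
have /H h : 0 <= pi * y <= pi / 2 by apply/andP; split; nra.
rewrite E (le_trans _ (ler_wpM2l _ (ler_norm _))) //.
by nra.
Qed.

Lemma e_neq1 (R : realType) (x : R) : 0 < `|x| < 1 -> e x != 1.
Proof.
move=> /andP[x0 x1]; apply/eqP => ex.
have key (y : R) : e y = 1 -> `|y| <= 2^-1 -> y = 0.
  move=> ey y2; have := cnorm_1e_ge y2; rewrite ey subrr cnorm0.
  by rewrite normr_le0 => /eqP.
have [h|h] := leP `|x| 2^-1; first by move: x0; rewrite (key x) // normr0 ltxx.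
have [x_ge0|x_lt0] := leP 0 x.
- have := key (x + (-1)%:~R); rewrite e_periodic => /(_ ex).
  rewrite ger0_norm // in x1 h; rewrite ler_norml rmorphN1 => H.
  suff : x - 1 = 0 by move=> ?; lra.
  by apply: H; apply/andP; split; lra.
- have := key (x + 1%:~R); rewrite e_periodic => /(_ ex).
  rewrite ltr0_norm // in x1 h; rewrite ler_norml rmorph1 => H.
  suff : x + 1 = 0 by move=> ?; lra.
  by apply: H; apply/andP; split; lra.
Qed.

Lemma geom_e (R : realType) (a b : R) n :
  (1 - e b) * \sum_(i < n) e (a + b *+ i) = e a * (1 - e (b *+ n)).
Proof.
have -> : \sum_(i < n) e (a + b *+ i) = e a * \sum_(i < n) e b ^+ i.
  by rewrite mulr_sumr; apply: eq_bigr => i _; rewrite eD eX.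
rewrite mulrCA; congr (_ * _); rewrite -eX.
by apply: oppr_inj; rewrite -mulNr opprB -subrX1 opprB.
Qed.

(** Multiplication by 1 - e(b), which is at least |b| in modulus, makes the sum telescope. *)
Lemma geom_e_le (R : realType) (a b : R) n : b != 0 -> `|b| <= 2^-1 ->
  cnorm (\sum_(i < n) e (a + b *+ i)) <= 2 / `|b|.
Proof.
move=> b0 b2; have bp : 0 < `|b| by rewrite normr_gt0.
rewrite ler_pdivlMr //; apply: le_trans (ler_wpM2l (cnorm_ge0 _) (cnorm_1e_ge b2)) _.
rewrite mulrC -cnormM geom_e cnormM cnorm_e mul1r.
by rewrite (le_trans (cnormB _ _)) // cnorm1 cnorm_e; lra.
Qed.

(** Orthogonality of additive characters of Z/M, on a window free of nonzero
    multiples of M. *)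
Lemma char_orth (R : realType) (M : nat) (m : int) : (0 < M)%N -> (`|m| < M)%N ->
  \sum_(a < M) e (a%:R / M%:R * m%:~R : R) = if m == 0 then M%:R else 0.
Proof.
move=> M0 mM; have [->|m0] := eqVneq m 0.
  under eq_bigr do rewrite mulr0 e0.
  by rewrite sumr_const card_ord.
have MR : (0 : R) < M%:R by rewrite ltr0n.
set b : R := m%:~R / M%:R.
have b1 : e b != 1.
  apply: e_neq1; rewrite normrM normfV (ger0_norm (ltW MR)) -intr_norm.
  by rewrite divr_gt0 ?ltr0z ?normr_gt0 // ltr_pdivrMr // mul1r -pmulrn ltr_nat.
have := @geom_e R 0 b M; rewrite e0 mul1r.
have -> : b *+ M = m%:~R by rewrite /b -[_ *+ M]mulr_natr divfK // gt_eqF.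
rewrite e_int subrr => /eqP; rewrite mulf_eq0 subr_eq0 eq_sym (negbTE b1) /= => /eqP h.
rewrite -[RHS]h; apply: eq_bigr => i _; congr e.
by rewrite add0r /b -[_ *+ i]mulr_natr; ring.
Qed.

(** Summation by parts; the differences of the decreasing weights add up to at
    most the first weight. *)
Lemma abel_bound (R : realType) (a : nat -> R) (z : nat -> R[i]) (B : R) (p n : nat) :
  (forall i, (p <= i < n)%N -> 0 <= a i) ->
  (forall i, (p <= i)%N -> (i.+1 < n)%N -> a i.+1 <= a i) ->
  (forall i, (p <= i <= n)%N -> cnorm (\sum_(p <= j < i) z j) <= B) ->
  (p < n)%N -> cnorm (\sum_(p <= i < n) (a i)%:C * z i) <= a p * B.
Proof.
move=> a0 amono zB pn.
set S := fun i => \sum_(p <= j < i) z j.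
have B0 : 0 <= B by apply: le_trans (cnorm_ge0 _) (zB p _); lia.
have key t : (p <= t < n)%N -> \sum_(p <= i < t.+1) (a i)%:C * z i =
    (a t)%:C * S t.+1 + \sum_(p <= i < t) (a i - a i.+1)%:C * S i.+1.
  elim: t => [|t IH] ht.
    have -> : p = 0%N by lia.
    by rewrite /S (_ : p = 0%N) ?big_nat1 ?big_geq ?addr0 //; lia.
  rewrite big_nat_recr /=; last by lia.
  have [pt|tp] := leqP p t.
    rewrite IH; last by lia.
    rewrite [in RHS]big_nat_recr //=.
    have -> : S t.+2 = S t.+1 + z t.+1 by rewrite /S [LHS]big_nat_recr //=; lia.
    by rewrite rmorphB /=; ring.
  have -> : p = t.+1 by lia.
  by rewrite /S (_ : p = t.+1) ?big_nat1 ?big_geq ?addr0 ?add0r //; lia.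
have [m hn] : exists m, n = m.+1 by exists n.-1; lia.
rewrite {1}hn key; last by lia.
apply: le_trans (cnormD _ _) _.
apply: (@le_trans _ _ (a m * B + \sum_(p <= i < m) (a i - a i.+1) * B)).
  apply: lerD.
    rewrite cnormM cnorm_real ger0_norm; last by apply: a0; lia.
    by apply: ler_wpM2l; [apply: a0; lia | apply: zB; lia].
  apply: le_trans (cnorm_sum _ _ _) _; rewrite big_nat [leRHS]big_nat.
  apply: ler_sum => i hi; rewrite cnormM cnorm_real ger0_norm; last first.
    by rewrite subr_ge0; apply: amono; lia.
  by apply: ler_wpM2l; [rewrite subr_ge0; apply: amono; lia | apply: zB; lia].
rewrite -mulr_suml -mulrDl; apply: ler_wpM2r => //.
have -> : \sum_(p <= i < m) (a i - a i.+1) = a p - a m.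
  under eq_bigr do rewrite -opprB.
  by rewrite sumrN telescope_sumr ?opprB //; lia.
by rewrite addrC subrK.
Qed.

(** * Power means *)

(** Induction on the exponent; each step is Chebyshev's inequality for the
    similarly ordered families a and a^p. *)
Lemma weighted_power_mean (R : realType) (I : finType) (P : pred I) (w a : I -> R) p :
  (forall i, P i -> 0 <= w i) -> (forall i, P i -> 0 <= a i) ->
  (\sum_(i | P i) w i * a i) ^+ p.+1 <=
  (\sum_(i | P i) w i) ^+ p * \sum_(i | P i) w i * a i ^+ p.+1.
Proof.
move=> w0 a0; elim: p => [|p IH].
  by rewrite expr0 mul1r expr1.
rewrite exprSr; set W := \sum_(i | P i) w i in IH *.
have W0 : 0 <= W by apply: sumr_ge0.
have wa0 : 0 <= \sum_(i | P i) w i * a i by apply: sumr_ge0 => i Pi; rewrite mulr_ge0 ?w0 ?a0.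
apply: le_trans (ler_wpM2r wa0 IH) _.
rewrite exprSr -!mulrA; apply: ler_wpM2l; first exact: exprn_ge0.
rewrite /W !big_distrlr /=.
have sym : \sum_(i | P i) \sum_(j | P j) w i * (w j * a j ^+ p.+2) =
           \sum_(i | P i) \sum_(j | P j) w i * w j * (a i ^+ p.+2).
  rewrite exchange_big /=; apply: eq_bigr => i _; apply: eq_bigr => j _; ring.
rewrite -(ler_pM2l (ltr0Sn R 1)) -[2%:R]/(1 + 1 : R) !mulrDl !mul1r.
rewrite {2}sym.
rewrite [X in _ + X]exchange_big /= -big_split /= -big_split /=.
apply: ler_sum => i Pi; rewrite -big_split /= -big_split /=.
apply: ler_sum => j Pj.
have -> : w i * a i ^+ p.+1 * (w j * a j) + w j * a j ^+ p.+1 * (w i * a i) =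
  w i * w j * (a i ^+ p.+1 * a j + a j ^+ p.+1 * a i) by ring.
have -> : w i * (w j * a j ^+ p.+2) + w i * w j * a i ^+ p.+2 =
  w i * w j * (a i ^+ p.+1 * a i + a j ^+ p.+1 * a j) by rewrite (exprSr (a j)) (exprSr (a i)); ring.
apply: ler_wpM2l; first by rewrite mulr_ge0 ?w0.
rewrite -subr_ge0.
have -> : a i ^+ p.+1 * a i + a j ^+ p.+1 * a j - (a i ^+ p.+1 * a j + a j ^+ p.+1 * a i) =
  (a i ^+ p.+1 - a j ^+ p.+1) * (a i - a j) by ring.
have ai := a0 _ Pi; have aj := a0 _ Pj.
case: (leP (a i) (a j)) => h.
  rewrite -mulrNN; apply: mulr_ge0; rewrite oppr_ge0 subr_le0 // lerXn2r //.
by apply: mulr_ge0; rewrite subr_ge0 ?lerXn2r // ltW.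
Qed.

Lemma power_mean (R : realType) (I : finType) (P : pred I) (a : I -> R) p :
  (forall i, P i -> 0 <= a i) ->
  (\sum_(i | P i) a i) ^+ p.+1 <= #|P|%:R ^+ p * \sum_(i | P i) a i ^+ p.+1.
Proof.
move=> a0; have := @weighted_power_mean R I P (fun=> 1) a p (fun _ _ => ler01) a0.
under eq_bigr do rewrite mul1r; rewrite sumr_const.
by under [X in _ * X]eq_bigr do rewrite mul1r.
Qed.

(** * Rigidity of spaced tuples with nearly equal power sums *)

(** The size of a polynomial when the l-th power sum has size Q^l. *)
Definition coef_norm {R : realType} (Q : R) (n : nat) (p : {poly R}) :=
  \sum_(l < n) `|p`_l| * Q ^+ l.

Lemma coef_norm_widen (R : realType) (Q : R) n (p : {poly R}) :
  (size p <= n)%N -> coef_norm Q n.+1 p = coef_norm Q n p.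
Proof.
by move=> sp; rewrite /coef_norm big_ord_recr /= nth_default // normr0 mul0r addr0.
Qed.

Lemma coef_norm_mul (R : realType) (Q c : R) n (p : {poly R}) :
  (size p <= n)%N -> 0 <= Q -> `|c| <= Q ->
  coef_norm Q n.+1 ((c%:P - 'X) * p) <= 2 * Q * coef_norm Q n p.
Proof.
move=> sp Q0 cQ; have N0 : 0 <= coef_norm Q n p.
  by apply: sumr_ge0 => i _; rewrite mulr_ge0 // exprn_ge0.
apply: (@le_trans _ _ (`|c| * coef_norm Q n p + Q * coef_norm Q n p)); last by nra.
rewrite -{1}(coef_norm_widen Q sp) /coef_norm.
apply: (@le_trans _ _ (\sum_(l < n.+1) (`|c| * (`|p`_l| * Q ^+ l) +
   `|if l == 0%N :> nat then 0 else p`_l.-1| * Q ^+ l))).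
  apply: ler_sum => l _; rewrite mulrA -mulrDl; apply: ler_wpM2r; first exact: exprn_ge0.
  rewrite mulrBl coefB coefCM coefXM -normrM; exact: ler_normB.
rewrite big_split /= -mulr_sumr lerD2l big_ord_recl /= normr0 mul0r add0r mulr_sumr.
by apply: ler_sum => l _; rewrite exprS mulrCA.
Qed.

(** A product of factors vanishing in chosen gaps between the hulls of
    [{v i, w i}] takes a prescribed sign on each hull; it stays away from zero
    because the gaps are at least L wide. *)
Lemma sign_pattern_poly (R : realType) (Q L : R) (lo hi : nat -> R) (sg : nat -> bool) n :
  0 < L -> (forall i, (i <= n)%N -> - Q <= lo i /\ lo i <= hi i /\ hi i <= Q) ->
  (forall i, (i < n)%N -> hi i + L <= lo i.+1) ->
  exists (p : {poly R}) (m : nat),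
    [/\ (m <= n)%N, (size p <= n.+1)%N, coef_norm Q n.+1 p <= (2 * Q) ^+ m,
     (forall t, lo n <= t -> (L / 2) ^+ m <= (-1) ^+ sg n * p.[t]) &
     (forall i t, (i <= n)%N -> lo i <= t <= hi i -> (L / 2) ^+ m <= (-1) ^+ sg i * p.[t])].
Proof.
move=> L0; elim: n => [|n IH] bd gap.
  exists ((-1) ^+ sg 0%N)%:P, 0%N; have [H _] := bd 0%N isT.
  have E (t : R) : 1 <= (-1) ^+ sg 0%N * ((-1) ^+ sg 0%N)%:P.[t].
    by rewrite hornerC -expr2 sqrr_sign.
  split=> //.
  - by rewrite size_polyC_leq1.
  - by rewrite /coef_norm big_ord1 coefC /= normr_sign mul1r !expr0.
  - by move=> [|i] t.
have [||p [m [mn sp Np right hull]]] := IH.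
- by move=> i ni; apply: bd; lia.
- by move=> i ni; apply: gap; lia.
have [b1 [b2 b3]] := bd n (leqnSn n); have [b4 [b5 b6]] := bd n.+1 (leqnn _).
have gp := gap n (ltnSn n).
have himono i : (i <= n)%N -> hi i <= hi n.
  move=> ni; have H d : (i + d <= n)%N -> hi i <= hi (i + d)%N.
    elim: d => [|d IHd] hd; first by rewrite addn0.
    rewrite addnS in hd *; apply: le_trans (IHd (ltnW hd)) _.
    have [_ [h2 _]] := bd (i + d).+1 (leqW hd).
    have := gap (i + d)%N (leqW hd).
    by lra.
  by rewrite -(subnKC ni); apply: H; rewrite subnKC.
have [same|diff] := eqVneq (sg n) (sg n.+1).
  exists p, m; split.
  - exact: leqW.
  - exact: leqW.
  - by rewrite coef_norm_widen.
  - by move=> t ht; rewrite -same; apply: right; lra.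
  - move=> i t; rewrite leq_eqVlt => /orP[/eqP ->|ni] ht; last exact: hull.
    by rewrite -same; apply: right; lra.
pose c := (hi n + lo n.+1) / 2.
exists ((c%:P - 'X) * p), m.+1.
have sgE : (-1) ^+ sg n.+1 = - (-1) ^+ sg n :> R.
  by case: (sg n) (sg n.+1) diff => [] [] // _; rewrite ?expr1 ?expr0 ?opprK.
have L2 : 0 < (L / 2) ^+ m by rewrite exprn_gt0 // divr_gt0.
have R1 t : lo n.+1 <= t -> (L / 2) ^+ m.+1 <= (-1) ^+ sg n.+1 * ((c%:P - 'X) * p).[t].
  move=> ht; rewrite hornerM hornerD hornerN hornerC hornerX sgE.
  have -> : - (-1) ^+ sg n * ((c - t) * p.[t]) = (t - c) * ((-1) ^+ sg n * p.[t]) by ring.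
  rewrite exprS; apply: ler_pM; [exact/ltW/divr_gt0 | exact/ltW | rewrite /c; lra | apply: right; lra].
split=> //.
- apply: leq_trans (size_polyMleq _ _) _.
  have -> : c%:P - 'X = - ('X - c%:P) by rewrite opprB.
  by rewrite size_polyN size_XsubC.
- apply: le_trans (coef_norm_mul sp _ _) _; first by lra.
    by rewrite /c ler_norml; apply/andP; split; lra.
  by rewrite exprS; apply: ler_wpM2l => //; lra.
move=> i t; rewrite leq_eqVlt => /orP[/eqP -> /andP[ht _]|ni ht]; first exact: R1.
rewrite hornerM hornerD hornerN hornerC hornerX.
have -> : (-1) ^+ sg i * ((c - t) * p.[t]) = (c - t) * ((-1) ^+ sg i * p.[t]) by ring.
have hm := himono i ni.
rewrite exprS; apply: ler_pM; [exact/ltW/divr_gt0 | exact/ltW | rewrite /c; lra | exact: hull].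
Qed.

Definition antideriv {R : realType} n (p : {poly R}) : {poly R} :=
  \sum_(l < n) (p`_l / l.+1%:R) *: 'X^(l.+1).

Lemma deriv_antideriv (R : realType) n (p : {poly R}) :
  (size p <= n)%N -> (antideriv n p)^`() = p.
Proof.
move=> sp; rewrite /antideriv raddf_sum /=.
rewrite [RHS](_ : p = \sum_(l < n) p`_l *: 'X^l); last first.
  rewrite -poly_def; apply/polyP => i; rewrite coef_poly; case: ltnP => // ni.
  by rewrite nth_default // (leq_trans sp).
apply: eq_bigr => l _; by rewrite derivZ derivXn /= -scalerMnr scalerMnl -mulr_natr divfK.
Qed.

(** Let P have as derivative a polynomial given by [sign_pattern_poly], its sign
    on the hull of v_i and w_i being that of v_i - w_i. By the mean value theorem
    P(v_i) - P(w_i) is at least (L/2)^m |v_i - w_i|, without cancellation between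
    different i; and the sum over i is a combination of differences of power sums. *)
Lemma spaced_rigid (R : realType) (Q L : R) (v w : nat -> R) n :
  0 < L -> 0 <= Q -> (forall i, (i <= n)%N -> `|v i| <= Q /\ `|w i| <= Q) ->
  (forall i, (i < n)%N -> Num.max (v i) (w i) + L <= Num.min (v i.+1) (w i.+1)) ->
  (forall j, (j <= n)%N -> `|\sum_(i < n.+1) (v i ^+ j.+1 - w i ^+ j.+1)| <= Q ^+ j) ->
  L <= 4 * Q -> \sum_(i < n.+1) `|v i - w i| <= (4 * Q / L) ^+ n.
Proof.
move=> L0 Q0 bd gap psum LQ.
pose lo i := Num.min (v i) (w i); pose hi i := Num.max (v i) (w i).
pose sg i := v i < w i.
have [||p [m [mn sp Np _ hull]]] := @sign_pattern_poly R Q L lo hi sg n L0.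
- move=> i /bd [/ler_normlP[a1 a2] /ler_normlP[b1 b2]].
  rewrite /lo /hi; split; first by rewrite le_min; apply/andP; split; lra.
  by split; [rewrite ge_min le_max lexx | rewrite ge_max a2 b2].
- by move=> i ni; rewrite /hi /lo; exact: gap.
have L20 : 0 < L / 2 by rewrite divr_gt0.
have step i : (i <= n)%N ->
    `|v i - w i| * (L / 2) ^+ m <= (antideriv n.+1 p).[v i] - (antideriv n.+1 p).[w i].
  move=> ni; have h := hull i _ ni.
  case: (ltgtP (v i) (w i)) => [vw|wv|->]; last by rewrite !subrr normr0 mul0r.
  - have [t /itvP ti E] := poly_mvt (antideriv n.+1 p) vw.
    rewrite deriv_antideriv // in E.
    have := h t; rewrite /lo /hi /sg vw min_l ?max_r ?(ltW vw) // expr1.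
    have t1 : v i <= t by rewrite ti.
    have t2 : t <= w i by rewrite ti.
    rewrite t1 t2 => /(_ isT) ht.
    rewrite -[leRHS]opprB E distrC gtr0_norm ?subr_gt0 // mulrC -mulNr.
    by apply: ler_wpM2r; [rewrite subr_ge0 ltW | lra].
  - have [t /itvP ti E] := poly_mvt (antideriv n.+1 p) wv.
    rewrite deriv_antideriv // in E.
    have := h t; rewrite /lo /hi /sg ltNge (ltW wv) /= min_r ?max_l ?(ltW wv) // expr0 mul1r.
    have t1 : w i <= t by rewrite ti.
    have t2 : t <= v i by rewrite ti.
    rewrite t1 t2 => /(_ isT) ht.
    rewrite E gtr0_norm ?subr_gt0 // mulrC.
    by apply: ler_wpM2r; [rewrite subr_ge0 ltW | lra].
have key : (\sum_(i < n.+1) `|v i - w i|) * (L / 2) ^+ m <= (2 * Q) ^+ m.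
  apply: le_trans Np; rewrite mulr_suml.
  apply: (@le_trans _ _ (\sum_(i < n.+1) ((antideriv n.+1 p).[v i] - (antideriv n.+1 p).[w i]))).
    by apply: ler_sum => i _; apply: step; rewrite -ltnS.
  have -> : \sum_(i < n.+1) ((antideriv n.+1 p).[v i] - (antideriv n.+1 p).[w i]) =
     \sum_(l < n.+1) (p`_l / l.+1%:R) * \sum_(i < n.+1) (v i ^+ l.+1 - w i ^+ l.+1).
    under [RHS]eq_bigr do rewrite mulr_sumr.
    rewrite [RHS]exchange_big /=; apply: eq_bigr => i _.
    rewrite /antideriv !horner_sum -sumrB; apply: eq_bigr => l _.
    by rewrite !hornerE mulrBr.
  apply: ler_sum => l _; apply: le_trans (ler_norm _) _; rewrite normrM.
  apply: ler_pM => //; last by apply: psum; rewrite -ltnS.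
  rewrite normrM ler_piMr // ger0_norm ?invr_ge0 //.
  by rewrite invf_le1 ?ltr0n // ler1n.
apply: (@le_trans _ _ ((4 * Q / L) ^+ m)).
  have -> : 4 * Q / L = (2 * Q) / (L / 2) by field; lra.
  by rewrite expr_div_n ler_pdivlMr // exprn_gt0.
by apply: ler_weXn2l => //; rewrite ler_pdivlMr // mul1r.
Qed.

(** * Solutions of systems of power-sum equations *)

(** These numbers are the Fourier coefficients of the square modulus of [fsum]. *)
Definition rep k (T : finType) (p : T -> 'I_k -> int) (lam : 'I_k -> int) : nat :=
  #|[pred uv : T * T | [forall j, p uv.1 j - p uv.2 j == lam j]]|.

(** Frequencies run over the finite grid of multiples of 1/M in place of the
    torus; for large M discrete orthogonality counts solutions exactly. *)
Definition phase (R : realType) k M (al : {ffun 'I_k -> 'I_M}) (m : 'I_k -> int) : R :=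
  \sum_j (al j)%:R / M%:R * (m j)%:~R.

Definition fsum (R : realType) k (T : finType) (p : T -> 'I_k -> int) M
    (al : {ffun 'I_k -> 'I_M}) : R[i] :=
  \sum_(u : T) e (phase R al (p u)).

(** Any bound for the differences of values would serve: discrete Fourier
    inversion is exact once M exceeds it. *)
Definition spread k (T : finType) (p : T -> 'I_k -> int) : nat :=
  (\sum_u \sum_v \sum_j `|p u j - p v j|)%N.

Lemma le_spread k (T : finType) (p : T -> 'I_k -> int) u v j :
  (`|p u j - p v j| <= spread p)%N.
Proof.
rewrite /spread (bigD1 u) //= (bigD1 v) //= (bigD1 j) //=.
by rewrite -!addnA leq_addr.
Qed.

Lemma repE k (T : finType) (p : T -> 'I_k -> int) lam :
  rep p lam = (\sum_u \sum_v [forall j, (p u j - p v j)%R == lam j])%N.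
Proof.
rewrite /rep -sum1_card pair_bigA big_mkcond /=; apply: eq_bigr => -[u v] _ /=.
by rewrite inE /=; case: [forall j, _].
Qed.

Lemma phaseB (R : realType) k M (al : {ffun 'I_k -> 'I_M}) m m' :
  phase R al (fun j => m j - m' j) = phase R al m - phase R al m'.
Proof.
by rewrite /phase -sumrB; apply: eq_bigr => j _; rewrite rmorphB /= mulrBr.
Qed.

Lemma phaseD (R : realType) k M (al : {ffun 'I_k -> 'I_M}) m m' :
  phase R al (fun j => m j + m' j) = phase R al m + phase R al m'.
Proof.
by rewrite /phase -big_split; apply: eq_bigr => j _; rewrite rmorphD /= mulrDr.
Qed.

Lemma char_orth_vec (R : realType) k M (m : 'I_k -> int) : (0 < M)%N ->
  (forall j, `|m j| < M)%N ->
  \sum_(al : {ffun 'I_k -> 'I_M}) e (phase R al m) =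
  if [forall j, m j == 0] then (M ^ k)%:R else 0.
Proof.
move=> M0 mM; rewrite /phase; under eq_bigr do rewrite e_sum.
rewrite -(bigA_distr_bigA (fun j (a : 'I_M) => e (a%:R / M%:R * (m j)%:~R : R))).
under eq_bigr => j _ do rewrite char_orth //.
case: ifP => [/forallP H|/negbT].
  under eq_bigr => j _ do rewrite (H j).
  by rewrite prodr_const card_ord natrX.
rewrite negb_forall => /existsP[j mj].
by rewrite (bigD1 j) //= (negbTE mj) mul0r.
Qed.

Lemma rep_fourier (R : realType) k (T : finType) (p : T -> 'I_k -> int) lam M :
  (spread p + \sum_j `|lam j| < M)%N ->
  \sum_(al : {ffun 'I_k -> 'I_M}) (cnorm (fsum R p al) ^+ 2)%:C * e (- phase R al lam)
  = (M ^ k * rep p lam)%:R.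
Proof.
move=> hM; have M0 : (0 < M)%N by lia.
pose d (u v : T) j := p u j - p v j - lam j.
transitivity (\sum_u \sum_v \sum_(al : {ffun 'I_k -> 'I_M}) e (phase R al (d u v))).
  under [RHS]eq_bigr => u _ do rewrite exchange_big /=.
  rewrite [RHS]exchange_big /=; apply: eq_bigr => al _.
  rewrite cnorm_sqr /fsum rmorph_sum /= big_distrlr /= mulr_suml.
  apply: eq_bigr => u _; rewrite mulr_suml; apply: eq_bigr => v _.
  by rewrite e_conj -!eD /d !phaseB.
rewrite repE natrM natr_sum mulr_sumr; apply: eq_bigr => u _.
rewrite natr_sum mulr_sumr; apply: eq_bigr => v _.
rewrite char_orth_vec //; last first.
  move=> j; have h1 := le_spread p u v j.
  have h2 : (`|lam j| <= \sum_j `|lam j|)%N by rewrite (bigD1 j) //= leq_addr.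
  by rewrite /d; lia.
have -> : [forall j, d u v j == 0] = [forall j, p u j - p v j == lam j].
  by apply: eq_forallb => j; rewrite /d subr_eq0.
by case: [forall j, _]; rewrite ?mulr1 ?mulr0.
Qed.

Lemma rep_moment (R : realType) k (T : finType) (p : T -> 'I_k -> int) M :
  (spread p < M)%N ->
  \sum_(al : {ffun 'I_k -> 'I_M}) cnorm (fsum R p al) ^+ 2 = (M ^ k * rep p (fun=> 0))%:R.
Proof.
move=> hM; apply: (@complexI R); rewrite rmorph_sum rmorph_nat /=.
rewrite -(@rep_fourier R); last first.
  by rewrite big1 ?addn0 // => j _; rewrite absz0.
apply: eq_bigr => al _; rewrite /phase big1 ?oppr0 ?e0 ?mulr1 // => j _.
by rewrite mulr0.
Qed.

(** Fourier coefficients of a nonnegative function are largest at 0. *)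
Lemma rep_le0 (R : realType) k (T : finType) (p : T -> 'I_k -> int) lam :
  (rep p lam <= rep p (fun=> 0%R))%N.
Proof.
pose M := (spread p + \sum_j `|lam j|).+1%N.
have M0 : (0 < M ^ k)%N by rewrite expn_gt0.
suff : ((M ^ k * rep p lam)%:R <= (M ^ k * rep p (fun=> 0%R))%:R :> R).
  by rewrite ler_nat leq_pmul2l.
rewrite -[leLHS]cnorm_nat -(@rep_fourier R _ _ p lam M (leqnn _)).
rewrite -(@rep_moment R _ _ p M); last by rewrite ltnS leq_addr.
apply: le_trans (cnorm_sum _ _ _) _; apply: ler_sum => al _.
by rewrite cnormM cnorm_real cnorm_e mulr1 ger0_norm // exprn_ge0 ?cnorm_ge0.
Qed.

Definition psum (I : finType) (z : I -> int) (j : nat) : int := \sum_i z i ^+ j.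

Definition tuple_psum k s H (a : int) (x : {ffun 'I_s -> 'I_H}) (j : 'I_k) : int :=
  psum (fun i => a + (x i)%:Z) j.+1.

(** Vinogradov's mean value J_{s,k}(H), as a number of solutions. *)
Definition Jmv k s H : nat := rep (@tuple_psum k s H 0) (fun=> 0).

(** By the binomial theorem, power sums of a translate are combinations, with
    coefficients depending on the translation only, of power sums of lower degree. *)
Lemma psum_shift (I : finType) k (z z' : I -> int) (a : int) :
  (forall j, (j <= k)%N -> psum z j = psum z' j) ->
  forall j, (j <= k)%N -> psum (fun i => a + z i) j = psum (fun i => a + z' i) j.
Proof.
move=> H j jk; rewrite /psum.
have E (y : I -> int) : \sum_i (a + y i) ^+ j =
    \sum_(l < j.+1) (a ^+ (j - l) *+ 'C(j, l)) * psum y l.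
  under eq_bigr do rewrite exprDn.
  rewrite exchange_big /=; apply: eq_bigr => l _; rewrite /psum mulr_sumr.
  by apply: eq_bigr => i _; rewrite mulrnAl.
by rewrite !E; apply: eq_bigr => l _; rewrite H // (leq_trans _ jk) // -ltnS.
Qed.

Lemma psum_shift_ord (I : finType) k (z z' : I -> int) (a : int) :
  (forall j : 'I_k, psum z j.+1 = psum z' j.+1) ->
  forall j : 'I_k, psum (fun i => a + z i) j.+1 = psum (fun i => a + z' i) j.+1.
Proof.
move=> H j; apply: (@psum_shift _ k) => // -[_|l lk].
  by rewrite /psum; apply: eq_bigr => i _; rewrite !expr0.
exact: (H (Ordinal lk)).
Qed.

Lemma eq_psum (I : finType) (z z' : I -> int) j : z =1 z' -> psum z j = psum z' j.
Proof. by move=> E; apply: eq_bigr => i _; rewrite E. Qed.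

Lemma psum_shift_iff (I : finType) k (z z' : I -> int) (a : int) :
  [forall j : 'I_k, psum (fun i => a + z i) j.+1 - psum (fun i => a + z' i) j.+1 == 0] =
  [forall j : 'I_k, psum z j.+1 - psum z' j.+1 == 0].
Proof.
apply/idP/idP => /forallP H; apply/forallP => j; rewrite subr_eq0; apply/eqP.
  have {H}H j' : psum (fun i => a + z i) (j' : 'I_k).+1 = psum (fun i => a + z' i) j'.+1.
    by apply/eqP; rewrite -subr_eq0.
  have := @psum_shift_ord _ _ _ _ (- a) H j.
  have K (y : I -> int) : psum (fun i => - a + (a + y i)) j.+1 = psum y j.+1.
    by apply: eq_psum => i; rewrite addKr.
  by rewrite !K.
by apply: psum_shift_ord => j'; apply/eqP; rewrite -subr_eq0.
Qed.

Lemma rep_shift k s H (a : int) : rep (@tuple_psum k s H a) (fun=> 0) = Jmv k s H.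
Proof.
rewrite /Jmv !repE; apply: eq_bigr => u _; apply: eq_bigr => v _; congr nat_of_bool.
pose U (x : {ffun 'I_s -> 'I_H}) i : int := (x i)%:Z.
have E (c : int) : [forall j, @tuple_psum k s H c u j - tuple_psum c v j == 0] =
    [forall j : 'I_k, psum (U u) j.+1 - psum (U v) j.+1 == 0].
  exact: psum_shift_iff.
by rewrite !E.
Qed.

Lemma psum_bound s H (x : {ffun 'I_s -> 'I_H}) j :
  0 <= psum (fun i => (x i)%:Z) j <= (s * H ^ j)%:Z.
Proof.
apply/andP; split; first by apply: sumr_ge0 => i _; rewrite exprn_ge0.
rewrite /psum PoszM (_ : s%:Z = \sum_(i < s) 1); last first.
  by rewrite sumr_const card_ord natz.
rewrite mulr_suml; apply: ler_sum => i _; rewrite mul1r.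
by rewrite -rmorphXn lez_nat; case: j => [|j]; rewrite ?expn0 // leq_exp2r // ltnW.
Qed.

Definition mixed_psum k s L H (b : 'I_k -> nat) (a : nat)
    (vx : {ffun 'I_k -> 'I_L} * {ffun 'I_s -> 'I_H}) (j : 'I_k) : int :=
  psum (fun i => (b i + vx.1 i)%N%:Z) j.+1 + tuple_psum a%:Z vx.2 j.

(** The condition left on k spaced variables when the 2s other variables lie in
    [a, a + H): their j-th power sums about a are at most s H^j. *)
Definition near_solutions k s L H (b : 'I_k -> nat) (a : nat) : nat :=
  #|[pred vw : {ffun 'I_k -> 'I_L} * {ffun 'I_k -> 'I_L} | [forall j : 'I_k,
     (absz (psum (fun i => ((b i + vw.1 i)%N%:Z - a%:Z)%R) j.+1 -
        psum (fun i => ((b i + vw.2 i)%N%:Z - a%:Z)%R) j.+1)%R <= s * H ^ j.+1)%N]]|.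

Lemma sum_over_pair (A B : finType) (F : A * B -> nat) :
  (\sum_u F u = \sum_a \sum_b F (a, b))%N.
Proof. by rewrite pair_bigA; apply: eq_bigr => -[]. Qed.

(** By translation invariance the short interval may be moved to the origin,
    where its power sums are small. *)
Lemma mixed_rep_le (R : realType) k s L H (b : 'I_k -> nat) (a : nat) :
  (rep (@mixed_psum k s L H b a) (fun=> 0%R) <= near_solutions s L H b a * Jmv k s H)%N.
Proof.
rewrite repE.
pose P (v : {ffun 'I_k -> 'I_L}) (j : 'I_k) := psum (fun i => ((b i + v i)%N%:Z - a%:Z)%R) j.+1.
pose good v w := [forall j : 'I_k, (absz (P v j - P w j)%R <= s * H ^ j.+1)%N].
pose sol v w (x y : {ffun 'I_s -> 'I_H}) := [forall j : 'I_k,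
  (@tuple_psum k s H 0 x j - tuple_psum 0 y j == P w j - P v j)%R].
have pt v x w y :
  ([forall j, (@mixed_psum k s L H b a (v, x) j - mixed_psum b a (w, y) j)%R == 0%R] <=
   good v w * sol v w x y)%N.
  case: (boolP [forall j, _]) => // /forallP h.
  pose z (v : {ffun 'I_k -> 'I_L}) (x : {ffun 'I_s -> 'I_H}) (i : 'I_k + 'I_s) : int :=
    match i with inl i => (b i + v i)%N%:Z | inr i => a%:Z + (x i)%:Z end.
  have zE v' x' (j : 'I_k) : psum (z v' x') j.+1 = mixed_psum b a (v', x') j.
    by rewrite /psum big_sumType.
  have h' (j : 'I_k) : psum (fun i => - a%:Z + z v x i) j.+1 = psum (fun i => - a%:Z + z w y i) j.+1.
    by apply: psum_shift_ord => j'; rewrite !zE; apply/eqP; rewrite -subr_eq0.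
  have E v' x' (j : 'I_k) : psum (fun i => - a%:Z + z v' x' i) j.+1 =
      P v' j + tuple_psum 0 x' j.
    rewrite /psum big_sumType /=; congr (_ + _); apply: eq_bigr => i _.
      by rewrite addrC.
    by rewrite addKr add0r.
  have hs : sol v w x y.
    apply/forallP => j; have := h' j; rewrite !E => hj; apply/eqP; lia.
  rewrite hs muln1; suff -> : good v w by [].
  apply/forallP => j; have /forallP/(_ j)/eqP := hs.
  have := psum_bound x j.+1; have := psum_bound y j.+1.
  have K (y' : {ffun 'I_s -> 'I_H}) : tuple_psum 0 y' j = psum (fun i => (y' i)%:Z) j.+1.
    by apply: eq_psum => i; rewrite add0r.
  rewrite !K; move: (psum _ _) (psum _ _) (s * H ^ j.+1)%N (P v j) (P w j).
  by move=> ? ? ? ? ?; lia.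
apply: (@leq_trans (\sum_v \sum_w good v w * \sum_x \sum_y sol v w x y)%N).
  rewrite sum_over_pair.
  apply: leq_sum => v _.
  under [leqRHS]eq_bigr do rewrite big_distrr /=.
  rewrite [leqRHS]exchange_big /=; apply: leq_sum => x _.
  rewrite sum_over_pair.
  apply: leq_sum => w _; rewrite big_distrr /=; apply: leq_sum => y _.
  exact: pt.
apply: (@leq_trans (\sum_v \sum_w good v w * Jmv k s H)%N).
  apply: leq_sum => v _; apply: leq_sum => w _; rewrite leq_mul2l.
  by apply/orP; right; rewrite -repE (rep_le0 R).
under eq_bigr do rewrite -big_distrl /=.
rewrite -big_distrl /= leq_mul2r; apply/orP; right.
rewrite /near_solutions -sum1_card pair_bigA [leqRHS]big_mkcond /=.
apply: leq_sum => -[v w] _; rewrite inE /= -/(good v w).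
by case: (good v w).
Qed.

(** * Counting near solutions *)

Lemma card_window L (c d : nat) :
  (#|[pred x : 'I_L | (x <= c + d) && (c <= x + d)]| <= d.*2.+1)%N.
Proof.
have -> : #|[pred x : 'I_L | (x <= c + d) && (c <= x + d)]%N| =
    size (map val (enum [pred x : 'I_L | (x <= c + d) && (c <= x + d)]%N)).
  by rewrite size_map -cardE.
rewrite -(size_iota (c - d) d.*2.+1); apply: uniq_leq_size.
  by rewrite (map_inj_uniq val_inj) enum_uniq.
move=> y /mapP[x + ->]; rewrite mem_enum inE => /andP[h1 h2].
by rewrite mem_iota /=; lia.
Qed.

Lemma card_le_ord Big n : (#|[pred c : 'I_Big | c <= n]| <= n.+1)%N.
Proof.
have -> : #|[pred c : 'I_Big | (c <= n)%N]| =
    size (map val (enum [pred c : 'I_Big | (c <= n)%N])).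
  by rewrite size_map -cardE.
rewrite -(size_iota 0 n.+1); apply: uniq_leq_size.
  by rewrite (map_inj_uniq val_inj) enum_uniq.
move=> y /mapP[x + ->]; rewrite mem_enum inE => h1.
by rewrite mem_iota /=; lia.
Qed.

(** Leaving out the next cell keeps points of different cells at least one cell
    length apart. *)
Definition spaced k G (ga : {ffun 'I_k -> 'I_G}) : bool :=
  [forall i : 'I_k, forall i' : 'I_k, (i < i')%N ==> (ga i + 2 <= ga i')%N].

Section Box.
Variables (R : realType) (n q g : nat) (ga : {ffun 'I_n.+1 -> 'I_(2 ^ g)}) (a : nat).
Hypotheses (gq : (g <= q)%N) (aq : (a < 2 ^ q)%N) (sp : spaced ga).

Let L := (2 ^ (q - g))%N.
Let pos (v : {ffun 'I_n.+1 -> 'I_L}) (i : 'I_n.+1) : int := (ga i * L + v i)%N%:Z - a%:Z.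

(** Rigidity, for points of size 2^q at distances at least 2^(q - g), so that
    4 Q / L is 2^(g + 2) in [spaced_rigid]. *)
Lemma same_cell_close (v w : {ffun 'I_n.+1 -> 'I_L}) :
  (forall j : 'I_n.+1, `|psum (pos v) j.+1 - psum (pos w) j.+1| <= (2 ^ (q * j))%N%:Z) ->
  forall i, (v i <= w i + 2 ^ ((g + 2) * n))%N.
Proof.
move=> cell i.
have L0 : (0 < L)%N by rewrite expn_gt0.
have LG : (2 ^ g * L = 2 ^ q)%N by rewrite -expnD subnKC.
pose x (u : {ffun 'I_n.+1 -> 'I_L}) (i : nat) : R := (pos u (inord i))%:~R.
have posQ u i' : `|pos u i'| <= (2 ^ q)%N%:Z.
  have h1 := ltn_ord (ga i'); have h2 := ltn_ord (u i').
  have : (ga i' * L + u i' < 2 ^ q)%N.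
    by rewrite -LG (leq_trans (_ : _ < (ga i').+1 * L)%N) ?leq_mul2r ?h1 ?orbT // mulSn; lia.
  by rewrite /pos; lia.
have H := @spaced_rigid R (2 ^ q)%:R L%:R (x v) (x w) n.
have LR : (0 : R) < L%:R by rewrite ltr0n.
have bnd u j : `|x u j| <= (2 ^ q)%:R.
  by rewrite /x -intr_norm [leRHS]pmulrn ler_int.
have {H}H : \sum_(i < n.+1) `|x v i - x w i| <= (4 * (2 ^ q)%:R / L%:R) ^+ n.
  apply: H => //.
  - move=> j jn; have /forallP/(_ (inord j))/forallP/(_ (inord j.+1)) := sp.
    rewrite !inordK; try lia.
    rewrite ltnSn /= => hga.
    have step (u1 u2 : {ffun 'I_n.+1 -> 'I_L}) : x u1 j + L%:R <= x u2 j.+1.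
      rewrite /x [L%:R]pmulrn -rmorphD /= ler_int /pos.
      have h2 := ltn_ord (u1 (inord j)).
      have : ((ga (inord j) + 2) * L <= ga (inord j.+1) * L)%N by rewrite leq_mul2r hga orbT.
      rewrite mulnDl; move: (ga _ * L)%N (ga _ * L)%N => A B; lia.
    by rewrite maxEge le_min; case: ifP => _; rewrite !step.
  - move=> j jn; rewrite -natrX -expnM.
    have := cell (inord j); rewrite inordK ?ltnS // => hc.
    have -> : \sum_(i0 < n.+1) (x v i0 ^+ j.+1 - x w i0 ^+ j.+1) =
        (psum (pos v) j.+1 - psum (pos w) j.+1)%:~R.
      rewrite rmorphB /= /psum !rmorph_sum -sumrB; apply: eq_bigr => i0 _.
      by rewrite /x inord_val !rmorphXn.
    by rewrite -intr_norm [leRHS]pmulrn ler_int.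
  - by rewrite -natrM ler_nat -LG; nia.
have E : 4 * (2 ^ q)%:R / L%:R = (2 ^ (g + 2))%:R :> R.
  rewrite -LG expnD !natrM; move: LR; move: (L%:R : R) ((2 ^ g)%:R : R) => l d l0.
  by rewrite mulrA mulfK ?gt_eqF // mulrC; congr (_ * _); rewrite -natrM.
rewrite E -natrX -expnM in H.
have : `|x v i - x w i| <= (2 ^ ((g + 2) * n))%:R.
  apply: le_trans H; rewrite (bigD1 i) //= lerDl; exact: sumr_ge0.
rewrite /x -rmorphB /= inord_val -intr_norm [leRHS]pmulrn ler_int /pos.
by move: (2 ^ ((g + 2) * n))%N (ga i * L)%N => X Y; lia.
Qed.

(** The admissible values of the power sums are covered by boxes with sides
    2^(q j), and two points in one box are close by [same_cell_close]. *)
Lemma box_count (A : 'I_n.+1 -> nat) (c : 'I_n.+1 -> int) :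
  (#|[pred v : {ffun 'I_n.+1 -> 'I_L} |
      [forall j : 'I_n.+1, (`|psum (pos v) j.+1 - c j| <= (A j * 2 ^ (q * j))%N%:Z)%R]]| <=
   \prod_j (A j).*2.+1 * (2 ^ ((g + 2) * n)).*2.+1 ^ n.+1)%N.
Proof.
set S := [pred v | _].
pose Big := (\sum_j (A j).*2).+1.
pose cellv v (j : 'I_n.+1) : nat :=
  absz ((psum (pos v) j.+1 - c j + (A j * 2 ^ (q * j))%N%:Z) %/ (2 ^ (q * j))%N%:Z)%Z.
have P0 (j : nat) : (0 < 2 ^ (q * j))%N by rewrite expn_gt0.
have cellE v (j : 'I_n.+1) : v \in S ->
    (psum (pos v) j.+1 - c j + (A j * 2 ^ (q * j))%N%:Z) =
    (cellv v j * 2 ^ (q * j))%N%:Z +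
    ((psum (pos v) j.+1 - c j + (A j * 2 ^ (q * j))%N%:Z) %% (2 ^ (q * j))%N%:Z)%Z.
  rewrite inE => /forallP/(_ j) h.
  rewrite {1}(divz_eq (psum (pos v) j.+1 - c j + _) (2 ^ (q * j))%N%:Z).
  rewrite (PoszM (cellv v j)) /cellv gez0_abs // divz_ge0 ?ltz_nat //.
  by move: h; move: (psum _ _ - _) (A j * _)%N => X Y; lia.
have cell_le v (j : 'I_n.+1) : v \in S -> (cellv v j <= (A j).*2)%N.
  move=> vS; have := cellE v j vS; move: vS; rewrite inE => /forallP/(_ j) h.
  have := modz_ge0 (psum (pos v) j.+1 - c j + (A j * 2 ^ (q * j))%N%:Z)
     (lt0r_neq0 (P0 j : 0 < (2 ^ (q * j))%N%:Z)).
  move=> r0 E.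
  have : (cellv v j * 2 ^ (q * j))%N%:Z <= ((A j).*2 * 2 ^ (q * j))%N%:Z.
    rewrite (canRL (addrK _) (esym E)).
    rewrite -addnn mulnDl PoszD.
    by move: h; rewrite ler_norml => /andP[_ h]; rewrite lerBlDr (le_trans (lerD h (lexx _))) // lerDl.
  by rewrite lez_nat leq_pmul2r.
pose f v : {ffun 'I_n.+1 -> 'I_Big} := [ffun j => inord (cellv v j)].
have ABig j : ((A j).*2 < Big)%N by rewrite ltnS (bigD1 j) //= leq_addr.
pose fam : pred {ffun 'I_n.+1 -> 'I_Big} :=
  family (fun j : 'I_n.+1 => [pred x : 'I_Big | (x <= (A j).*2)%N]).
have fS v : v \in S -> f v \in fam.
  move=> vS; apply/familyP => j; rewrite inE ffunE inordK ?cell_le //.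
  by rewrite (leq_ltn_trans _ (ABig j)) // cell_le.
rewrite -sum1_card (partition_big f (mem fam)) /=; last by move=> v; exact: fS.
apply: (@leq_trans (\sum_(d in fam) (2 ^ ((g + 2) * n)).*2.+1 ^ n.+1)%N).
  apply: leq_sum => d _; rewrite sum1_card.
  case: (pickP [pred v | (v \in S) && (f v == d)]) => [v0 /andP[v0S /eqP v0d]|none]; last first.
    by rewrite eq_card0 // => v; have := none v; rewrite !inE.
  pose W : pred {ffun 'I_n.+1 -> 'I_L} := family (fun i : 'I_n.+1 =>
     [pred x : 'I_L | (x <= v0 i + 2 ^ ((g + 2) * n)) && (v0 i <= x + 2 ^ ((g + 2) * n))]%N).
  apply: (@leq_trans #|W|).
    apply: subset_leq_card; apply/fintype.subsetP => v; rewrite unfold_in => /andP[vS /eqP vd].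
    have cl (j : 'I_n.+1) : `|psum (pos v) j.+1 - psum (pos v0) j.+1| <= (2 ^ (q * j))%N%:Z.
      have E1 := cellE _ j vS; have E2 := cellE _ j v0S.
      have E3 : cellv v j = cellv v0 j.
        have : f v j = f v0 j by rewrite vd v0d.
        rewrite !ffunE => /(congr1 val); rewrite /= !inordK //;
          by rewrite (leq_ltn_trans _ (ABig j)) // cell_le.
      rewrite E3 in E1.
      have X0 : 0 < (2 ^ (q * j))%N%:Z by rewrite ltz_nat P0.
      have r1 := modz_ge0 (psum (pos v) j.+1 - c j + (A j * 2 ^ (q * j))%N%:Z) (lt0r_neq0 X0).
      have r2 := modz_ge0 (psum (pos v0) j.+1 - c j + (A j * 2 ^ (q * j))%N%:Z) (lt0r_neq0 X0).
      have r3 := ltz_pmod (psum (pos v) j.+1 - c j + (A j * 2 ^ (q * j))%N%:Z) X0.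
      have r4 := ltz_pmod (psum (pos v0) j.+1 - c j + (A j * 2 ^ (q * j))%N%:Z) X0.
      move: E1 E2 r1 r2 r3 r4.
      set t1 := modz (psum (pos v) _ - _ + _) _; set t2 := modz _ _; move: t1 t2 => t1 t2.
      move: (psum (pos v) _) (psum (pos v0) _) (2 ^ (q * j))%N%:Z (cellv v0 j * _)%N (A j * _)%N (c j) => z1 z2 X Y1 Y2 c0.
      by move=> *; rewrite ler_norml; apply/andP; split; lia.
    apply/familyP => i; rewrite inE same_cell_close //=.
    by apply: same_cell_close => j; rewrite distrC cl.
  rewrite card_family; apply: (@leq_trans (\prod_(i < n.+1) (2 ^ ((g + 2) * n)).*2.+1)%N).
    rewrite foldrE big_map big_enum /=.
    by apply: leq_prod => i _; exact: card_window.
  by rewrite prod_nat_const card_ord.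
rewrite sum_nat_const leq_mul2r; apply/orP; right.
rewrite card_family foldrE big_map big_enum /=.
by apply: leq_prod => i _; exact: card_le_ord.
Qed.

(** The tuple w is counted trivially, and then v is confined to a box. *)
Lemma near_solutions_le s b : (b * n.+1 <= q)%N ->
  (near_solutions s L (2 ^ (q - b)) (fun i => (ga i * L)%N) a <=
   2 ^ (q * n.+1) * (\prod_(j < n.+1) (s * 2 ^ (q - b * j.+1)).*2.+1 *
     (2 ^ ((g + 2) * n)).*2.+1 ^ n.+1))%N.
Proof.
move=> bq; rewrite /near_solutions.
set P := [pred vw | _].
have -> : #|P| = (\sum_w #|[pred v | P (v, w)]|)%N.
  rewrite -sum1_card big_mkcond sum_over_pair exchange_big /=.
  apply: eq_bigr => w _; rewrite -sum1_card [RHS]big_mkcond /=.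
  by apply: eq_bigr.
apply: (@leq_trans (\sum_(w : {ffun 'I_n.+1 -> 'I_L})
   (\prod_(j < n.+1) (s * 2 ^ (q - b * j.+1)).*2.+1 *
     (2 ^ ((g + 2) * n)).*2.+1 ^ n.+1))%N); last first.
  rewrite sum_nat_const leq_mul2r card_ffun !card_ord /L -expnM.
  by rewrite leq_exp2l // leq_mul2r leq_subr !orbT.
apply: leq_sum => w _.
have := box_count (fun j => s * 2 ^ (q - b * j.+1))%N (fun j => psum (pos w) j.+1).
apply: leq_trans; apply: subset_leq_card; apply/fintype.subsetP => v.
rewrite !inE => /forallP h; apply/forallP => j; have := h j.
have -> : (s * (2 ^ (q - b)) ^ j.+1 = s * 2 ^ (q - b * j.+1) * 2 ^ (q * j))%N.
  rewrite -mulnA -expnM -expnD; congr (s * 2 ^ _)%N.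
  have : (b * j.+1 <= b * n.+1)%N by rewrite leq_mul2l ltn_ord orbT.
  rewrite mulnBl (mulnSr q j); move: (b * j.+1)%N (b * n.+1)%N bq (q * j)%N => *; lia.
by rewrite /= /pos; move: (_ * _)%N (psum _ _) (psum _ _) => *; lia.
Qed.

End Box.

(** * The recursion for the mean value *)

Lemma spread_subset_enum G k (B : {set 'I_G}) : (k.*2 <= #|B|)%N -> (0 < k)%N ->
  exists2 ga : {ffun 'I_k -> 'I_G}, spaced ga & forall i, ga i \in B.
Proof.
move=> kB k0; have [x0 x0B] : exists x0, x0 \in B by apply/card_gt0P; lia.
pose t i := nth x0 (enum B) i.
have tB i : (i < k.*2)%N -> t i \in B.
  by move=> ik; rewrite -mem_enum mem_nth // -cardE (leq_trans ik).
have tlt i j : (i < j)%N -> (j < k.*2)%N -> (t i < t j)%N.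
  move=> ij jk; have srt : sorted ltn (map val (enum B)).
    apply: (subseq_sorted ltn_trans _ (iota_ltn_sorted 0 G)).
    by rewrite -val_enum_ord enumT; apply: map_subseq; rewrite /enum_mem filter_subseq.
  have sz : size (enum B) = #|B| by rewrite cardE.
  have := sorted_ltn_nth ltn_trans (val x0) srt.
  move=> /(_ i j); rewrite !inE size_map sz => /(_ _ _ ij).
  by rewrite !(nth_map x0) ?sz; [apply; lia | lia | lia].
exists [ffun i : 'I_k => t (i.*2)].
  apply/forallP => i; apply/forallP => i'; apply/implyP => ii; rewrite !ffunE.
  have h := ltn_ord i'.
  have h1 := @tlt i.*2 i.*2.+1 (leqnn _); have h2 := @tlt i.*2.+1 i'.*2.
  by have := h1 _; have := h2 _ _; lia.
by move=> i; rewrite ffunE tB // ltn_double.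
Qed.

(** Either few pieces carry the sum, or many pieces are comparable with it and
    well separated ones can be chosen among them. *)
Lemma narrow_or_broad (R : realType) G k s (z : 'I_G -> R[i]) : (0 < G)%N -> (0 < k)%N ->
  cnorm (\sum_ga z ga) ^+ (k + s).*2 <=
  (4 * k)%:R ^+ (k + s).*2 * (\sum_ga cnorm (z ga) ^+ (k + s).*2) +
  (2 * G)%:R ^+ k.*2 *
   (\sum_(ga : {ffun 'I_k -> 'I_G} | spaced ga)
      (\prod_i cnorm (z (ga i)) ^+ 2) * cnorm (\sum_ga z ga) ^+ s.*2).
Proof.
move=> G0 k0; set S := cnorm (\sum_ga z ga).
have S0 : 0 <= S by apply: cnorm_ge0.
have GR : (0 : R) < G%:R by rewrite ltr0n.
have pr0 (ga : {ffun 'I_k -> 'I_G}) : 0 <= (\prod_i cnorm (z (ga i)) ^+ 2) * S ^+ s.*2.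
  by apply: mulr_ge0; [apply: prodr_ge0 => i _ |]; rewrite exprn_ge0 // cnorm_ge0.
have n0 : 0 <= (4 * k)%:R ^+ (k + s).*2 * (\sum_ga cnorm (z ga) ^+ (k + s).*2).
  by apply: mulr_ge0; [|apply: sumr_ge0 => ga _]; rewrite exprn_ge0 // cnorm_ge0.
have b0 : 0 <= (2 * G)%:R ^+ k.*2 *
   (\sum_(ga : {ffun 'I_k -> 'I_G} | spaced ga) (\prod_i cnorm (z (ga i)) ^+ 2) * S ^+ s.*2).
  by apply: mulr_ge0; [rewrite exprn_ge0 | apply: sumr_ge0].
pose B := [set ga | S <= (2 * G)%:R * cnorm (z ga)].
have [kB|Bk] := leqP k.*2 #|B|.
  have [ga gasp gaB] := spread_subset_enum kB k0.
  rewrite -[leLHS]add0r; apply: lerD => //.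
  rewrite (bigD1 ga) //= mulrDr; apply: ler_wpDr.
    by apply: mulr_ge0; [rewrite exprn_ge0 | apply: sumr_ge0].
  rewrite doubleD exprD mulrA; apply: ler_wpM2r; first exact: exprn_ge0.
  have -> : (2 * G)%:R ^+ k.*2 = \prod_(i < k) ((2 * G)%:R ^+ 2) :> R.
    by rewrite prodr_const card_ord -exprM (mul2n k).
  have -> : S ^+ k.*2 = \prod_(i < k) (S ^+ 2).
    by rewrite prodr_const card_ord -exprM (mul2n k).
  rewrite -big_split /=; apply: ler_prod => i _; rewrite exprn_ge0 //=.
  by rewrite -exprMn lerXn2r ?nnegrE ?mulr_ge0 ?cnorm_ge0 //; have := gaB i; rewrite inE.
rewrite -[leLHS]addr0; apply: lerD => //.
have H1 : S <= 2 * \sum_(ga in B) cnorm (z ga).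
  have h1 : S <= \sum_ga cnorm (z ga) by apply: cnorm_sum.
  rewrite (bigID (mem B)) /= in h1.
  have h2 : \sum_(ga | ga \notin B) cnorm (z ga) <= S / 2.
    apply: (@le_trans _ _ (\sum_(ga : 'I_G) S / (2 * G)%:R)).
      rewrite big_mkcond /=; apply: ler_sum => ga _; case: ifP => [|_].
        rewrite inE -ltNge => /ltW h; rewrite ler_pdivlMr ?ltr0n ?muln_gt0 //.
        by rewrite mulrC.
      by rewrite divr_ge0.
    rewrite sumr_const card_ord -mulr_natr natrM.
    by rewrite le_eqVlt; apply/orP; left; apply/eqP; field; rewrite gt_eqF.
  by lra.
have [p hp] : exists p, (k + s).*2 = p.+1 by exists (k + s).*2.-1; lia.
have H2 := power_mean p (fun ga (_ : ga \in B) => cnorm_ge0 (z ga)).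
rewrite hp; apply: (@le_trans _ _ ((2 * \sum_(ga in B) cnorm (z ga)) ^+ p.+1)).
  by rewrite lerXn2r ?nnegrE ?mulr_ge0 //; apply: sumr_ge0 => *; apply: cnorm_ge0.
rewrite exprMn; apply: (@le_trans _ _ (2 ^+ p.+1 * (k.*2%:R ^+ p.+1 *
   \sum_ga cnorm (z ga) ^+ p.+1))); last first.
  rewrite mulrA -exprMn -natrM; apply: ler_wpM2r.
    by apply: sumr_ge0 => *; rewrite exprn_ge0 // cnorm_ge0.
  by rewrite lerXn2r ?nnegrE // ler_nat; lia.
apply: ler_wpM2l; first exact: exprn_ge0.
apply: le_trans H2 _; apply: ler_pM.
- exact: exprn_ge0.
- by apply: sumr_ge0 => *; rewrite exprn_ge0 // cnorm_ge0.
- apply: (@le_trans _ _ (k.*2%:R ^+ p)).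
    by rewrite lerXn2r ?nnegrE // ler_nat ltnW.
  by rewrite ler_weXn2l // ler1n; lia.
- rewrite [leLHS]big_mkcond /=; apply: ler_sum => ga _; case: ifP => // _.
  by rewrite exprn_ge0 // cnorm_ge0.
Qed.

Definition wave (R : realType) k M (al : {ffun 'I_k -> 'I_M}) (a H : nat) : R[i] :=
  \sum_(x < H) e (phase R al (fun j => (a%:Z + x%:Z) ^+ j.+1)).

Lemma phase_sum (R : realType) k M (al : {ffun 'I_k -> 'I_M}) (I : finType)
    (F : I -> 'I_k -> int) :
  phase R al (fun j => \sum_i F i j) = \sum_i phase R al (F i).
Proof.
rewrite /phase [RHS]exchange_big /=; apply: eq_bigr => j _.
by rewrite rmorph_sum mulr_sumr.
Qed.

Lemma wave_prod (R : realType) k M (al : {ffun 'I_k -> 'I_M}) s (b : 'I_s -> nat) H :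
  \prod_(i < s) wave R al (b i) H =
  \sum_(x : {ffun 'I_s -> 'I_H})
     e (phase R al (fun j => psum (fun i => (b i)%:Z + (x i)%:Z) j.+1)).
Proof.
rewrite /wave bigA_distr_bigA /=; apply: eq_bigr => x _.
by rewrite -e_sum -phase_sum.
Qed.

Lemma wave_exp (R : realType) k M (al : {ffun 'I_k -> 'I_M}) s a H :
  wave R al a H ^+ s = fsum R (@tuple_psum k s H a%:Z) al.
Proof. by rewrite -[s in LHS]card_ord -prodr_const (wave_prod _ _ (fun=> a)). Qed.

Lemma wave_mixed (R : realType) k M (al : {ffun 'I_k -> 'I_M}) s L H (b : 'I_k -> nat) a :
  (\prod_(i < k) wave R al (b i) L) * wave R al a H ^+ s =
  fsum R (@mixed_psum k s L H b a) al.
Proof.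
rewrite wave_prod wave_exp /fsum big_distrlr /= pair_bigA /=.
by apply: eq_bigr => -[v x] _ /=; rewrite -eD -phaseD.
Qed.

Lemma wave_split (R : realType) k M (al : {ffun 'I_k -> 'I_M}) G L a :
  wave R al a (G * L) = \sum_(ga < G) wave R al (a + ga * L) L.
Proof.
elim: G => [|G IH]; first by rewrite mul0n /wave !big_ord0.
rewrite big_ord_recr /= -IH mulSnr /wave big_split_ord /=; congr (_ + _).
apply: eq_bigr => x _; congr e; rewrite /phase; apply: eq_bigr => j _.
by rewrite !PoszD addrA.
Qed.

Lemma Jmv_wave (R : realType) k s H a M : (spread (@tuple_psum k s H a%:Z) < M)%N ->
  \sum_(al : {ffun 'I_k -> 'I_M}) cnorm (wave R al a H) ^+ s.*2 =
  (M ^ k * Jmv k s H)%:R.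
Proof.
move=> hM; rewrite -(rep_shift k s H a%:Z) -(rep_moment R hM); apply: eq_bigr => al _.
by rewrite -wave_exp cnormX -exprM muln2.
Qed.

(** In the narrow case of [narrow_or_broad] the sum is that over an interval of
    length 2^(q - g). In the broad one, Hölder's inequality moves the other
    variables to a single interval of length 2^(q - b), and [mixed_rep_le] and
    [near_solutions_le] count the solutions. *)
Lemma Jmv_recursion (R : realType) n s q g b :
  let k := n.+1 in (0 < s)%N -> (g <= q)%N -> (b * k <= q)%N ->
  (Jmv k (k + s) (2 ^ q) <=
   (4 * k) ^ (k + s).*2 * 2 ^ g * Jmv k (k + s) (2 ^ (q - g)) +
   (2 * 2 ^ g) ^ k.*2 * (2 ^ g) ^ k * (2 ^ b) ^ s.*2 *
   (2 ^ (q * k) * (\prod_(j < k) (s * 2 ^ (q - b * j.+1)).*2.+1 *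
     (2 ^ ((g + 2) * n)).*2.+1 ^ k)) * Jmv k s (2 ^ (q - b)))%N.
Proof.
move=> k s0 gq bq; set NS := (2 ^ (q * k) * _)%N.
pose L := (2 ^ (q - g))%N; pose H := (2 ^ (q - b))%N; pose G := (2 ^ g)%N; pose B := (2 ^ b)%N.
have bq' : (b <= q)%N by apply: leq_trans bq; rewrite leq_pmulr.
have QG : (2 ^ q = G * L)%N by rewrite -expnD subnKC.
have QB : (2 ^ q = B * H)%N by rewrite -expnD subnKC.
pose mix (ga : {ffun 'I_k -> 'I_G}) (be : 'I_B) :=
  @mixed_psum k s L H (fun i => ga i * L)%N (be * H)%N.
pose M := (spread (@tuple_psum k (k + s) (2 ^ q) 0) +
  \sum_(ga < G) spread (@tuple_psum k (k + s) L (ga * L)%N%:Z) +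
  \sum_(ga : {ffun 'I_k -> 'I_G}) \sum_(be < B) spread (mix ga be)).+1%N.
have M1 : (spread (@tuple_psum k (k + s) (2 ^ q) 0%N%:Z) < M)%N.
  by rewrite ltnS -!addnA leq_addr.
have M2 (ga : 'I_G) : (spread (@tuple_psum k (k + s) L (ga * L)%N%:Z) < M)%N.
  rewrite ltnS (leq_trans _ (leq_addr _ _)) // (leq_trans _ (leq_addl _ _)) //.
  by rewrite (bigD1 ga) //= leq_addr.
have M3 ga be : (spread (mix ga be) < M)%N.
  rewrite ltnS (leq_trans _ (leq_addl _ _)) // (bigD1 ga) //=.
  by rewrite (leq_trans _ (leq_addr _ _)) // (bigD1 be) //= leq_addr.
have Mk : (0 < M ^ k)%N by rewrite expn_gt0.
rewrite -(leq_pmul2l Mk) -(ler_nat R) -(Jmv_wave R M1).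
pose z (al : {ffun 'I_k -> 'I_M}) (ga : 'I_G) := wave R al (ga * L) L.
have wz al : wave R al 0 (2 ^ q) = \sum_ga z al ga by rewrite QG wave_split.
have G0 : (0 < G)%N by rewrite expn_gt0.
apply: le_trans (ler_sum _ _) _ => [al _|].
  by rewrite wz; apply: (@narrow_or_broad R G k s (z al) G0 isT).
rewrite big_split /= mulnDr natrD; apply: lerD.
  rewrite -mulr_sumr exchange_big /=.
  under eq_bigr => ga _ do rewrite (Jmv_wave R (M2 ga)).
  rewrite sumr_const card_ord -natrX -[_ *+ G]mulr_natr -!natrM ler_nat.
  by rewrite leq_eqVlt; apply/orP; left; apply/eqP; rewrite -/L -/G; ring.
rewrite -mulr_sumr exchange_big /=.
have holder al : cnorm (\sum_ga z al ga) ^+ s.*2 <=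
    B%:R ^+ s.*2.-1 * \sum_(be < B) cnorm (wave R al (be * H) H) ^+ s.*2.
  rewrite -wz QB wave_split.
  have [p hp] : exists p, s.*2 = p.+1 by exists s.*2.-1; lia.
  rewrite hp /=; apply: (@le_trans _ _ ((\sum_(be < B) cnorm (wave R al (be * H) H)) ^+ p.+1)).
    rewrite lerXn2r ?nnegrE ?cnorm_ge0 //; first by apply: sumr_ge0 => *; apply: cnorm_ge0.
    exact: cnorm_sum.
  apply: le_trans (power_mean p (fun be _ => cnorm_ge0 _)) _.
  by rewrite cardT size_enum_ord.
have each (ga : {ffun 'I_k -> 'I_G}) : spaced ga ->
  \sum_al (\prod_i cnorm (z al (ga i)) ^+ 2 * cnorm (\sum_ga z al ga) ^+ s.*2) <=
  (B ^ s.*2 * (M ^ k * (NS * Jmv k s H)))%:R.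
  move=> gasp.
  apply: (@le_trans _ _ (\sum_al B%:R ^+ s.*2.-1 *
     \sum_(be < B) cnorm (fsum R (mix ga be) al) ^+ 2)).
    apply: ler_sum => al _.
    have P0 : 0 <= \prod_i cnorm (z al (ga i)) ^+ 2.
      by apply: prodr_ge0 => i _; rewrite exprn_ge0 // cnorm_ge0.
    apply: le_trans (ler_wpM2l P0 (holder al)) _.
    rewrite mulrCA; apply: ler_wpM2l; first exact: exprn_ge0.
    rewrite mulr_sumr; apply: ler_sum => be _; rewrite -wave_mixed cnormM cnormX exprMn.
    rewrite -exprM muln2 [leRHS]mulrC [leLHS]mulrC; apply: ler_wpM2l.
      by rewrite exprn_ge0 // cnorm_ge0.
    rewrite (big_morph _ (@cnormM R) (@cnorm1 R)) prodrXl.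
    by [].
  rewrite -mulr_sumr exchange_big /=.
  apply: (@le_trans _ _ (B%:R ^+ s.*2.-1 * \sum_(be < B) (M ^ k * (NS * Jmv k s H))%:R)).
    apply: ler_wpM2l; first exact: exprn_ge0.
    apply: ler_sum => be _; rewrite (rep_moment R (M3 ga be)) ler_nat leq_mul2l.
    apply/orP; right; apply: leq_trans (mixed_rep_le R s L H _ _) _.
    rewrite leq_mul2r; apply/orP; right.
    apply: (near_solutions_le R) => //.
    by rewrite QB ltn_mul2r expn_gt0 ltn_ord.
  rewrite sumr_const card_ord -natrX -[_ *+ B]mulr_natr -!natrM ler_nat.
  have -> : (B ^ s.*2 = B ^ s.*2.-1 * B)%N by rewrite -expnSr prednK // double_gt0.
  by rewrite leq_eqVlt; apply/orP; left; apply/eqP; ring.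
apply: (@le_trans _ _ ((2 * G)%:R ^+ k.*2 * \sum_(ga : {ffun 'I_k -> 'I_G})
   (B ^ s.*2 * (M ^ k * (NS * Jmv k s H)))%:R)).
  apply: ler_wpM2l; first exact: exprn_ge0.
  rewrite big_mkcond /=; apply: ler_sum => ga _; case: ifP => // gasp.
  exact: each.
rewrite sumr_const card_ffun !card_ord -natrX -[_ *+ (G ^ k)]mulr_natr -!natrM ler_nat.
by rewrite leq_eqVlt; apply/orP; left; apply/eqP; rewrite -/G -/B -/H; ring.
Qed.

(** * Vinogradov's mean value theorem *)

(** The sum of the degrees, which is the exponent gained over the trivial bound. *)
Definition tri (k : nat) : nat := (\sum_(j < k) j.+1)%N.

Lemma tri2 k : ((tri k).*2 = k * k.+1)%N.
Proof.
elim: k => [|k IH]; first by rewrite /tri big_ord0.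
by rewrite /tri big_ord_recr /= doubleD -/(tri k) IH; lia.
Qed.

Lemma tri_le k : (tri k <= k ^ 2)%N.
Proof. by have := tri2 k; rewrite -mulnn; case: k => [|k]; nia. Qed.

Lemma Jmv_trivial k s H : (Jmv k s H <= H ^ s.*2)%N.
Proof.
rewrite /Jmv /rep (leq_trans (max_card _)) // card_prod card_ffun !card_ord.
by rewrite -addnn expnD.
Qed.

(** The choice g = 2 k + 5 makes the narrow part at most half of the bound to be
    proved, at scale q - g. *)
Lemma separation_scale k : (2 * (4 * k) ^ 2 <= 2 ^ (k.*2 + 5))%N.
Proof.
have /leq_mul/(_ (ltnW (ltn_expl k (ltnSn 1)))) := ltnW (ltn_expl k (ltnSn 1)).
rewrite expnD -addnn expnD !expnS expn0 !muln1; move: (2 ^ k)%N => Y; nia.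
Qed.

Lemma narrow_exponent (k T s E p : nat) : T.*2 = (k + p)%N -> (T + E = (k + s).*2)%N ->
  (p <= s)%N -> (0 < p)%N -> (0 < k)%N -> ((k + s).+1 <= E)%N.
Proof. lia. Qed.

Lemma narrow_scale a g m : (2 * a ^ 2 <= 2 ^ g)%N -> (0 < m)%N ->
  (a ^ m.*2 * 2 ^ g * 2 <= 2 ^ (g * m.+1))%N.
Proof.
move=> ag m0; rewrite (mulnS g m) expnD expnM mulnAC mulnC leq_mul2l; apply/orP; right.
apply: (@leq_trans ((2 * a ^ 2) ^ m)); last by rewrite leq_exp2r.
by rewrite expnMn -expnM mul2n mulnC leq_mul2r -[X in (X <= _)%N]expn1 leq_exp2l // m0 orbT.
Qed.

Lemma broad_exponent b q k T E : (b <= q)%N ->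
  (b * (T + E) + q * k + (q - b) * E = q * (k + E) + b * T)%N.
Proof.
move=> bq; have : (b * E <= q * E)%N by rewrite leq_mul2r bq orbT.
by rewrite mulnBl !mulnDr; move: (b * E)%N (q * E)%N (q * k)%N (b * T)%N => *; lia.
Qed.

Definition rec_const (n g S : nat) : nat :=
  ((2 * 2 ^ g) ^ n.+1.*2 * (2 ^ g) ^ n.+1 * (4 * S) ^ n.+1 *
   2 ^ (((g + 2) * n + 2) * n.+1))%N.

Lemma rec_const_gt0 n g S : (0 < S)%N -> (0 < rec_const n g S)%N.
Proof. by move=> S0; rewrite /rec_const !(muln_gt0, expn_gt0) S0. Qed.

Lemma Jmv_recursion_simple (R : realType) n s S q g b :
  let k := n.+1 in (0 < s <= S)%N -> (g <= q)%N -> (b * k <= q)%N ->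
  (Jmv k (k + s) (2 ^ q) * 2 ^ (b * tri k) <=
   (4 * k) ^ (k + s).*2 * 2 ^ g * Jmv k (k + s) (2 ^ (q - g)) * 2 ^ (b * tri k) +
   rec_const n g S * 2 ^ (b * s.*2 + q * k.*2) * Jmv k s (2 ^ (q - b)))%N.
Proof.
move=> k /andP[s0 sS] gq bq.
have := Jmv_recursion R s0 gq bq; rewrite -/k => H.
apply: leq_trans (leq_mul H (leqnn _)) _; rewrite mulnDl leq_add2l.
rewrite -[leqLHS]mulnA [(Jmv _ _ _ * _)%N]mulnC mulnA leq_mul2r; apply/orP; right.
have P1 : (\prod_(j < k) (s * 2 ^ (q - b * j.+1)).*2.+1 * 2 ^ (b * tri k) <=
    (4 * S) ^ k * 2 ^ (q * k))%N.
  have -> : ((4 * S) ^ k = \prod_(j < k) (4 * S))%N by rewrite prod_nat_const card_ord.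
  have -> : (2 ^ (q * k) = \prod_(j < k) 2 ^ q)%N by rewrite prod_nat_const card_ord expnM.
  have -> : (2 ^ (b * tri k) = \prod_(j < k) 2 ^ (b * j.+1))%N.
    by rewrite /tri big_distrr /= expn_sum.
  rewrite -!big_split /=; apply: leq_prod => j _.
  have bj : (b * j.+1 <= q)%N by rewrite (leq_trans _ bq) // leq_mul2l ltn_ord orbT.
  have -> : (2 ^ q = 2 ^ (q - b * j.+1) * 2 ^ (b * j.+1))%N by rewrite -expnD subnK.
  rewrite mulnA leq_mul2r; apply/orP; right.
  have X0 : (0 < 2 ^ (q - b * j.+1))%N by rewrite expn_gt0.
  by move: (2 ^ _)%N X0 => X X0; nia.
have P2 : ((2 ^ ((g + 2) * n)).*2.+1 ^ k <= 2 ^ (((g + 2) * n + 2) * k))%N.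
  rewrite [leqRHS]expnM leq_exp2r // expnD.
  have X0 : (0 < 2 ^ ((g + 2) * n))%N by rewrite expn_gt0.
  by move: (2 ^ ((g + 2) * n))%N X0 => X X0; lia.
rewrite /rec_const -/k.
set A := ((2 * 2 ^ g) ^ k.*2 * (2 ^ g) ^ k)%N in P1 P2 *.
have -> : (2 ^ (b * s.*2 + q * k.*2) = (2 ^ b) ^ s.*2 * 2 ^ (q * k) * 2 ^ (q * k))%N.
  by rewrite -expnM -!expnD; congr (_ ^ _)%N; lia.
have -> : (A * (2 ^ b) ^ s.*2 * (2 ^ (q * k) * (\prod_(j < k) (s * 2 ^ (q - b * j.+1)).*2.+1 *
   (2 ^ ((g + 2) * n)).*2.+1 ^ k)) * 2 ^ (b * tri k) =
   A * (2 ^ b) ^ s.*2 * 2 ^ (q * k) * ((\prod_(j < k) (s * 2 ^ (q - b * j.+1)).*2.+1 * 2 ^ (b * tri k)) *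
   (2 ^ ((g + 2) * n)).*2.+1 ^ k))%N by ring.
have -> : (A * (4 * S) ^ k * 2 ^ (((g + 2) * n + 2) * k) *
   ((2 ^ b) ^ s.*2 * 2 ^ (q * k) * 2 ^ (q * k)) =
   A * (2 ^ b) ^ s.*2 * 2 ^ (q * k) * ((4 * S) ^ k * 2 ^ (q * k) * 2 ^ (((g + 2) * n + 2) * k)))%N by ring.
by rewrite leq_mul2l leq_mul ?orbT.
Qed.

(** Exponents lose a factor 1 - 1/k at each step, because the variables pass
    from an interval of length Q to one of length Q^(1-1/k). *)
Lemma Jmv_bound (R : realType) n S r :
  let k := n.+1 in let g := (k.*2 + 5)%N in (k * (k + r) <= S)%N ->
  forall q, (Jmv k (k * (k + r)) (2 ^ q))%:R <=
    (2 ^ (g * tri k) * (2 ^ (tri k).+1 * rec_const n g S) ^ r)%:R *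
    2 ^+ (q * ((k * (k + r)).*2 - tri k)) *
    2 `^ (q%:R * ((tri k)%:R * (1 - k%:R^-1) ^+ r)) :> R.
Proof.
move=> k g; have kR : (0 : R) < k%:R by rewrite ltr0n.
have om0 : 0 <= 1 - k%:R^-1 :> R.
  by rewrite subr_ge0 invf_le1 // ler1n.
have om1 : 1 - k%:R^-1 <= 1 :> R by rewrite gerBl invr_ge0 ltW.
have triS r' : (tri k <= (k * (k + r')).*2)%N by have := tri_le k; rewrite -mulnn; nia.
elim: r => [|r IH] hS q.
  rewrite addn0 expn0 muln1 expr0 mulr1.
  apply: (@le_trans _ _ ((2 ^ q) ^ (k * k).*2)%:R); first by rewrite ler_nat Jmv_trivial.
  rewrite -natrM powR_mulrn // -!natrX -!natrM ler_nat -expnM.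
  rewrite -mulnA -expnD -mulnDr subnK; last by have := triS 0%N; rewrite addn0.
  by rewrite leq_pmull // expn_gt0.
have sE : (k * (k + r.+1) = k + k * (k + r))%N by lia.
set s := (k * (k + r))%N in IH hS sE *.
have s0 : (0 < s)%N by rewrite /s muln_gt0.
rewrite sE in hS *.
have sS : (0 < s <= S)%N by lia.
have {}IH := IH (ltac:(lia) : (s <= S)%N).
set T := tri k in triS IH *; set C := rec_const n g S in IH *.
set D := (2 ^ (g * T) * _ ^ r)%N in IH.
set D' := (2 ^ (g * T) * _ ^ r.+1)%N.
have DD' : D' = (2 ^ T.+1 * C * D)%N by rewrite /D' /D expnS; ring.
have C0 : (0 < C)%N by apply: rec_const_gt0; lia.
have gD' : (2 ^ (g * T) <= D')%N.
  by rewrite /D' leq_pmulr // expn_gt0 muln_gt0 expn_gt0 C0.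
set de : R := T%:R * (1 - k%:R^-1) ^+ r in IH *.
set de' : R := T%:R * (1 - k%:R^-1) ^+ r.+1.
have de0 : 0 <= de by rewrite mulr_ge0 // exprn_ge0.
have de'0 : 0 <= de' by rewrite mulr_ge0 // exprn_ge0.
have de'E : de' = de * (1 - k%:R^-1) by rewrite /de' /de exprSr mulrA.
have deT : de <= T%:R by rewrite ler_piMr // exprn_ile1.
set E := ((k + s).*2 - T)%N.
have TE : (T + E = (k + s).*2)%N by rewrite /E subnKC //; have := triS r.+1; rewrite sE.
elim: q {-2}q (leqnn q) => [|Q IHQ] q qQ.
all: have [qg|gq] := ltnP q g.
1,3: apply: (@le_trans _ _ ((2 ^ q) ^ (k + s).*2)%:R); first by rewrite ler_nat Jmv_trivial.
1,2: have h1 : 1 <= 2 `^ (q%:R * de') :> R by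
       rewrite -[leLHS](powRr0 2) ler_powR ?ler1n // mulr_ge0.
1,2: apply: le_trans (ler_peMr _ h1); rewrite ?mulr_ge0 ?exprn_ge0 //.
1,2: rewrite -natrX -natrM ler_nat -expnM -TE mulnDr expnD leq_mul2r.
1,2: apply/orP; right; apply: leq_trans gD'; rewrite leq_exp2l // leq_mul2r ltnW ?orbT //.
  by move: gq; rewrite /g; lia.
pose b := (q %/ k)%N.
have bq : (b * k <= q)%N by rewrite leq_divM.
have bq' : (b <= q)%N by apply: leq_trans bq; rewrite leq_pmulr.
have := Jmv_recursion_simple R sS gq bq; rewrite -/k -/T -/C => rec.
have e2b : (0 : R) < 2 ^+ (b * T) by rewrite exprn_gt0.
rewrite -(ler_pM2r e2b).
have {rec} : (Jmv k (k + s) (2 ^ q))%:R * 2 ^+ (b * T) <=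
   ((4 * k) ^ (k + s).*2 * 2 ^ g)%:R * (Jmv k (k + s) (2 ^ (q - g)))%:R * 2 ^+ (b * T) +
   C%:R * 2 ^+ (b * s.*2 + q * k.*2) * (Jmv k s (2 ^ (q - b)))%:R :> R.
  by rewrite -!natrX -!natrM -natrD ler_nat.
move/le_trans; apply.
set X := D'%:R * _ * _.
have -> : X * 2 ^+ (b * T) = X * 2 ^+ (b * T) / 2 + X * 2 ^+ (b * T) / 2 by field.
have pw0 (x : R) : 0 <= 2 `^ x by apply: powR_ge0.
apply: lerD.
  (* narrow part: the induction hypothesis at scale q - g *)
  have -> : X * 2 ^+ (b * T) / 2 = X / 2 * 2 ^+ (b * T) by ring.
  rewrite ler_pM2r //.
  have h := IHQ (q - g)%N (ltac:(rewrite /g; lia) : (q - g <= Q)%N).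
  apply: le_trans (ler_wpM2l _ h) _ => //.
  rewrite /X; have -> : 2 ^+ (q * E) = 2 ^+ (g * E) * 2 ^+ ((q - g) * E) :> R.
    by rewrite -exprD -mulnDl subnKC.
  have hpow : 2 `^ ((q - g)%:R * de') <= 2 `^ (q%:R * de').
    by rewrite ler_powR ?ler1n // ler_wpM2r // ler_nat leq_subr.
  have hc : ((4 * k) ^ (k + s).*2 * 2 ^ g)%:R * 2 <= 2 ^+ (g * E) :> R.
    rewrite -natrX -natrM ler_nat.
    have kg : (2 * (4 * k) ^ 2 <= 2 ^ g)%N.
      exact: separation_scale.
    have ES : ((k + s).+1 <= E)%N.
      have := tri2 k; rewrite -/T => hT.
      have ks : (k * k <= s)%N by rewrite /s leq_mul2l leq_addr orbT.
      have p1 : (0 < k * k)%N by rewrite muln_gt0.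
      have k1 : (0 < k)%N by [].
      rewrite mulnS in hT; exact: narrow_exponent hT TE ks p1 k1.
    apply: (@leq_trans (2 ^ (g * (k + s).+1))); last by rewrite leq_exp2l // leq_mul2l ES orbT.
    exact: narrow_scale.
  set a1 := (_ * 2 ^ g)%:R in hc *.
  apply: (@le_trans _ _ (a1 * (D'%:R * 2 ^+ ((q - g) * E) * 2 `^ (q%:R * de')))).
    by apply: ler_wpM2l; [exact: ler0n | apply: ler_wpM2l => //; rewrite mulr_ge0 // exprn_ge0].
  have -> : D'%:R * (2 ^+ (g * E) * 2 ^+ ((q - g) * E)) * 2 `^ (q%:R * de') / 2 =
    2 ^+ (g * E) / 2 * (D'%:R * 2 ^+ ((q - g) * E) * 2 `^ (q%:R * de')) by ring.
  apply: ler_wpM2r; first by rewrite !mulr_ge0 // exprn_ge0.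
  by rewrite ler_pdivlMr.
(* the broad part has k variables less, and the scale q - b, b = q / k *)
apply: le_trans (ler_wpM2l _ (IH _)) _; first by rewrite mulr_ge0 // exprn_ge0.
set E1 := (s.*2 - T)%N.
have TE1 : (T + E1 = s.*2)%N by rewrite /E1 subnKC //; exact: triS.
have pE : 2 ^+ (b * s.*2 + q * k.*2) * 2 ^+ ((q - b) * E1) = 2 ^+ (q * E) * 2 ^+ (b * T) :> R.
  rewrite -!exprD; congr (_ ^+ _).
  have -> : (E = k.*2 + E1)%N by rewrite /E doubleD -TE1 addnCA addKn.
  by rewrite -TE1 broad_exponent.
have hpow : 2 `^ ((q - b)%:R * de) <= 2 `^ T%:R * 2 `^ (q%:R * de').
  rewrite -powRD ?pnatr_eq0 ?implybT // ler_powR ?ler1n // de'E.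
  have qb : q%:R <= (b%:R + 1) * k%:R :> R.
    by rewrite natr1 -natrM ler_nat ltnW // /b ltn_ceil.
  rewrite natrB // mulrDr mulr1 mulrN mulrDr mulrN.
  have : q%:R * (de * k%:R^-1) <= (b%:R + 1) * de.
    rewrite mulrCA mulrC; apply: ler_wpM2r => //.
    by rewrite ler_pdivrMr.
  by nra.
rewrite powR_mulrn // in hpow.
have -> : X * 2 ^+ (b * T) / 2 = C%:R * D%:R * (2 ^+ (q * E) * 2 ^+ (b * T)) *
    (2 ^+ T * 2 `^ (q%:R * de')).
  have D'E : D'%:R = 2 * 2 ^+ T * C%:R * D%:R :> R by rewrite DD' !natrM natrX exprS.
  rewrite /X D'E; move: (2 ^+ T) (2 ^+ (b * T)) (2 ^+ (q * E)) => x1 x2 x3; by field.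
rewrite -pE.
have -> : C%:R * 2 ^+ (b * s.*2 + q * k.*2) * (D%:R * 2 ^+ ((q - b) * E1) * 2 `^ ((q - b)%:R * de)) =
  C%:R * D%:R * (2 ^+ (b * s.*2 + q * k.*2) * 2 ^+ ((q - b) * E1)) * 2 `^ ((q - b)%:R * de) :> R by ring.
by apply: ler_wpM2l; rewrite // !mulr_ge0 // exprn_ge0.
Qed.

Lemma rec_const_le n S : let k := n.+1 in (S <= k ^ 3 * 2)%N ->
  (rec_const n (k.*2 + 5) S <= 2 ^ (38 * k ^ 3))%N.
Proof.
move=> k hS; rewrite /rec_const -/k.
have S2 : (4 * S <= 2 ^ (3 * k + 3))%N.
  have k2 : (k <= 2 ^ k)%N by apply/ltnW/ltn_expl.
  have : (k ^ 3 <= (2 ^ k) ^ 3)%N by rewrite leq_exp2r.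
  rewrite -expnM [(k * 3)%N]mulnC expnD; move: (2 ^ (3 * k))%N (k ^ 3)%N hS => A B; lia.
apply: (@leq_trans ((2 * 2 ^ (k.*2 + 5)) ^ k.*2 * (2 ^ (k.*2 + 5)) ^ k * (2 ^ (3 * k + 3)) ^ k *
   2 ^ (((k.*2 + 5 + 2) * n + 2) * k))).
  by rewrite leq_mul2r leq_mul2l leq_exp2r // S2 !orbT.
rewrite -expnS -!expnM -!expnD leq_exp2l // !expnS expn0 muln1.
by rewrite /k; move: (n) => m; nia.
Qed.

(** After k^2 steps the defect (1 - 1/k)^(k^2) k (k + 1) / 2 is of the order of
    k^2 exp(-k). *)
Theorem Jmv_vinogradov (R : realType) k s q :
  (0 < k)%N -> s = (k * (k + k ^ 2))%N ->
  (Jmv k s (2 ^ q))%:R <= 2 ^+ (60 * k ^ 5) * 2 ^+ (q * (s.*2 - tri k)) *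
    2 `^ (q%:R * ((tri k)%:R * (1 - k%:R^-1) ^+ (k ^ 2))) :> R.
Proof.
case: k => // n _ sE; set k := n.+1 in sE *; have kk : (1 <= k)%N by [].
have sle : (s <= k ^ 3 * 2)%N.
  by rewrite sE !expnS expn0 !muln1; move: (k) kk => j; nia.
have H := @Jmv_bound R n (k ^ 3 * 2) (k ^ 2); cbv zeta in H.
rewrite -/k -sE in H; apply: le_trans (H sle q) _; apply: ler_wpM2r; first exact: powR_ge0.
apply: ler_wpM2r; first exact: exprn_ge0.
rewrite -natrX ler_nat.
apply: (@leq_trans (2 ^ ((k.*2 + 5) * tri k) * (2 ^ (tri k).+1 * 2 ^ (38 * k ^ 3)) ^ (k ^ 2))).
  by rewrite leq_mul2l leq_exp2r ?expn_gt0 // leq_mul2l rec_const_le ?orbT.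
rewrite -expnD -expnM -expnD leq_exp2l //.
have t := tri_le k.
have t1 : ((k.*2 + 5) * tri k <= 7 * k ^ 5)%N.
  apply: (@leq_trans ((k.*2 + 5) * k ^ 2)); first by rewrite leq_mul2l t orbT.
  by rewrite !expnS expn0 muln1; move: (k) kk => j; nia.
have t2 : (((tri k).+1 + 38 * k ^ 3) * k ^ 2 <= 40 * k ^ 5)%N.
  have -> : (40 * k ^ 5 = (40 * k ^ 3) * k ^ 2)%N by rewrite -mulnA -expnD.
  rewrite leq_mul2r; apply/orP; right; apply: (@leq_trans ((k ^ 2).+1 + 38 * k ^ 3)); first lia.
  by rewrite !expnS expn0 muln1; move: (k) kk => j; nia.
by move: t1 t2; move: (_ * tri k)%N (_ * k ^ 2)%N (k ^ 5)%N => *; lia.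
Qed.

(** * Bilinear sums with polynomial phases *)

Definition lin (R : realType) k (be : 'I_k -> R) (m : 'I_k -> int) : R :=
  \sum_j be j * (m j)%:~R.

(** The index f j stands for the integer f j - A j, which [centered] recovers. *)
Definition box k Big (A : 'I_k -> nat) : pred {ffun 'I_k -> 'I_Big} :=
  family (fun j : 'I_k => [pred x : 'I_Big | (x <= (A j).*2)%N]).

Definition centered k Big (A : 'I_k -> nat) (f : {ffun 'I_k -> 'I_Big}) (j : 'I_k) : int :=
  (f j)%:Z - (A j)%:Z.

Section Grouping.
Variables (R : realType) (k s H Big : nat).
Let A (j : 'I_k) : nat := (s * H ^ j.+1)%N.
Hypothesis ABig : forall j, ((A j).*2 < Big.+1)%N.
Let p := @tuple_psum k s H 0.
Let Lam := @box k Big.+1 A.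

(** The terms of the expanded power are grouped by the differences of power sums. *)
Lemma moment_grouping (be : 'I_k -> R) :
  (cnorm (\sum_(x < H) e (lin be (fun j => x%:Z ^+ j.+1))) ^+ s.*2)%:C =
  \sum_(f in Lam) (rep p (centered A f))%:R * e (lin be (centered A f)).
Proof.
have pw : (\sum_(x < H) e (lin be (fun j => x%:Z ^+ j.+1))) ^+ s =
    \sum_(u : {ffun 'I_s -> 'I_H}) e (lin be (p u)).
  rewrite -[s in LHS]card_ord -prodr_const bigA_distr_bigA /=.
  apply: eq_bigr => u _; rewrite -e_sum; congr e.
  rewrite /lin exchange_big /=; apply: eq_bigr => j _.
  by rewrite -mulr_sumr /p /tuple_psum /psum rmorph_sum /=; congr (_ * _).
rewrite -muln2 exprM -cnormX pw cnorm_sqr rmorph_sum big_distrlr /= pair_bigA /=.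
pose d (uv : {ffun 'I_s -> 'I_H} * {ffun 'I_s -> 'I_H}) : {ffun 'I_k -> 'I_Big.+1} :=
  [ffun j => inord (absz (p uv.1 j - p uv.2 j + (A j)%:Z))].
have pb (u : {ffun 'I_s -> 'I_H}) j : 0 <= p u j <= (A j)%:Z.
  have := psum_bound u j.+1; rewrite /p /tuple_psum.
  by rewrite (eq_psum (z' := fun i => (u i)%:Z)) // => i; rewrite add0r.
have dE uv j : (d uv j)%:Z = p uv.1 j - p uv.2 j + (A j)%:Z.
  have := pb uv.1 j; have := pb uv.2 j; have := ABig j.
  move=> h1 /andP[h2 h3] /andP[h4 h5].
  rewrite ffunE inordK; first by rewrite gez0_abs //; lia.
  by move: h1 h2 h3 h4 h5; move: (A j) (p _ j) (p _ j) => a z1 z2; lia.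
have dLam uv : d uv \in Lam.
  apply/familyP => j; rewrite inE -lez_nat dE.
  have := pb uv.1 j; have := pb uv.2 j.
  by move: (A j) (p _ j) (p _ j) => a z1 z2; lia.
rewrite (partition_big d (mem Lam)) /=; last by move=> uv _; exact: dLam.
apply: eq_bigr => f fL; rewrite /rep -sum1_card natr_sum mulr_suml.
apply: eq_big => [uv|uv /eqP <-].
  rewrite inE; apply/eqP/forallP => [<- j|h].
    by rewrite /centered dE addrK.
  apply/ffunP => j; apply/val_inj/eqP; rewrite -eqz_nat dE (eqP (h j)).
  by rewrite /centered subrK.
rewrite mul1r e_conj -eD; congr e; rewrite /lin -sumrB; apply: eq_bigr => j _.
by rewrite -mulrBr -rmorphB /centered dE addrK.
Qed.

Lemma sum_rep_box : \sum_(f in Lam) (rep p (centered A f))%:R = H%:R ^+ s.*2 :> R.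
Proof.
have := moment_grouping (fun=> 0).
have z m : lin (fun=> 0 : R) m = 0 :> R.
  by rewrite /lin big1 // => j _; rewrite mul0r.
under eq_bigr do rewrite z e0.
rewrite sumr_const card_ord cnorm_nat => E; apply: (@complexI R).
rewrite E rmorph_sum; apply: eq_bigr => f _.
by rewrite z e0 mulr1 /= rmorph_nat.
Qed.

(** The sum over |m| <= B of the modulus of the sum of e(al l m) over |l| <= B,
    with both indices shifted by B. *)
Definition dual_sum (al : R) (B : nat) : R :=
  \sum_(y < Big.+1 | (y <= B.*2)%N)
    cnorm (\sum_(x < Big.+1 | (x <= B.*2)%N) e (al * (x%:Z - B%:Z)%:~R * (y%:Z - B%:Z)%:~R)).

(** Hölder twice: first in y, then in the difference of power sums of x. *)
Lemma bilinear_bound (al : 'I_k -> R) : (0 < s)%N ->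
  cnorm (\sum_(y < H) \sum_(x < H) e (\sum_j al j * (x%:R ^+ j.+1 * y%:R ^+ j.+1)))
    ^+ (s.*2 * s.*2) <=
  H%:R ^+ (s.*2.-1 * s.*2) * H%:R ^+ (s.*2 * s.*2.-1) * (Jmv k s H)%:R ^+ 2 *
  \prod_j dual_sum (al j) (A j).
Proof.
move=> s0; have [m hm] : exists m, s.*2 = m.+1 by exists s.*2.-1; lia.
have J0 : (0 : R) <= (Jmv k s H)%:R by [].
pose W y := \sum_(x < H) e (\sum_j al j * (x%:R ^+ j.+1 * y%:R ^+ j.+1)).
pose T (f : {ffun 'I_k -> 'I_Big.+1}) := \sum_(y < H) e (lin (fun j => al j * (centered A f j)%:~R) (fun j => y%:Z ^+ j.+1)).
pose r (f : {ffun 'I_k -> 'I_Big.+1}) : R := (rep p (centered A f))%:R.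
have rJ f : r f <= (Jmv k s H)%:R by rewrite ler_nat (rep_le0 R).
have stepA : cnorm (\sum_(y < H) W y) ^+ s.*2 <=
    H%:R ^+ s.*2.-1 * \sum_(y < H) cnorm (W y) ^+ s.*2.
  rewrite hm /=; apply: (@le_trans _ _ ((\sum_(y < H) cnorm (W y)) ^+ m.+1)).
    rewrite lerXn2r ?nnegrE ?cnorm_ge0 //; first by apply: sumr_ge0 => *; exact: cnorm_ge0.
    exact: cnorm_sum.
  apply: le_trans (power_mean m (fun y _ => cnorm_ge0 _)) _.
  by rewrite cardT size_enum_ord.
have stepB : \sum_(y < H) cnorm (W y) ^+ s.*2 <= \sum_(f in Lam) r f * cnorm (T f).
  have -> : \sum_(y < H) cnorm (W y) ^+ s.*2 = cnorm (\sum_(f in Lam) (r f)%:C * T f).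
    transitivity (cnorm (\sum_(y < H) (cnorm (W y) ^+ s.*2))%:C).
      rewrite cnorm_real ger0_norm //; apply: sumr_ge0 => y _.
      by rewrite exprn_ge0 // cnorm_ge0.
    congr cnorm; rewrite rmorph_sum /=.
    transitivity (\sum_(y < H) \sum_(f in Lam) (r f)%:C *
        e (lin (fun j => al j * (centered A f j)%:~R) (fun j => y%:Z ^+ j.+1))).
      apply: eq_bigr => y _.
      have -> : W y = \sum_(x < H) e (lin (fun j => al j * y%:R ^+ j.+1) (fun j => x%:Z ^+ j.+1)).
        apply: eq_bigr => x _; congr e; apply: eq_bigr => j _.
        by rewrite rmorphXn /= -pmulrn; ring.
      rewrite moment_grouping; apply: eq_bigr => f _; rewrite /r rmorph_nat; congr (_ * e _).
      by apply: eq_bigr => j _; rewrite rmorphXn /= -pmulrn; ring.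
    by rewrite exchange_big /=; apply: eq_bigr => f _; rewrite mulr_sumr.
  apply: le_trans (cnorm_sum _ _ _) _; apply: ler_sum => f _.
  by rewrite cnormM cnorm_real ger0_norm.
have stepC : (\sum_(f in Lam) r f * cnorm (T f)) ^+ s.*2 <=
    H%:R ^+ (s.*2 * s.*2.-1) * ((Jmv k s H)%:R * \sum_(f in Lam) cnorm (T f) ^+ s.*2).
  have := @weighted_power_mean R _ (mem Lam) r (fun f => cnorm (T f)) m
     (fun _ _ => ler0n _ _) (fun _ _ => cnorm_ge0 _).
  rewrite -hm => /le_trans; apply; rewrite sum_rep_box -exprM hm /=.
  apply: ler_wpM2l; first exact: exprn_ge0.
  rewrite mulr_sumr; apply: ler_sum => f _; apply: ler_wpM2r; last exact: rJ.
  by rewrite exprn_ge0 // cnorm_ge0.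
have stepD : \sum_(f in Lam) cnorm (T f) ^+ s.*2 <=
    (Jmv k s H)%:R * \prod_j dual_sum (al j) (A j).
  have -> : \sum_(f in Lam) cnorm (T f) ^+ s.*2 = cnorm (\sum_(f' in Lam) (r f')%:C *
      \sum_(f in Lam) \prod_j e (al j * (centered A f j)%:~R * (centered A f' j)%:~R)).
    transitivity (cnorm (\sum_(f in Lam) (cnorm (T f) ^+ s.*2))%:C).
      rewrite cnorm_real ger0_norm //; apply: sumr_ge0 => y _.
      by rewrite exprn_ge0 // cnorm_ge0.
    congr cnorm; rewrite rmorph_sum /=.
    under [RHS]eq_bigr do rewrite mulr_sumr.
    rewrite [RHS]exchange_big /=; apply: eq_bigr => f _.
    rewrite moment_grouping; apply: eq_bigr => f' _; rewrite /r rmorph_nat; congr (_ * _).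
    by rewrite -e_sum.
  apply: le_trans (cnorm_sum _ _ _) _.
  apply: (@le_trans _ _ (\sum_(f' in Lam) (Jmv k s H)%:R * \prod_j
     cnorm (\sum_(x < Big.+1 | (x <= (A j).*2)%N) e (al j * (x%:Z - (A j)%:Z)%:~R * (centered A f' j)%:~R)))).
    apply: ler_sum => f' _; rewrite cnormM cnorm_real ger0_norm //.
    apply: ler_pM => //; first exact: cnorm_ge0.
    rewrite -(big_morph _ (@cnormM R) (@cnorm1 R)).
    rewrite (bigA_distr_big_dep (fun j (x : 'I_Big.+1) => (x <= (A j).*2)%N)
       (fun j (x : 'I_Big.+1) => e (al j * (x%:Z - (A j)%:Z)%:~R * (centered A f' j)%:~R))).
    exact: lexx.
  rewrite -mulr_sumr; apply: ler_wpM2l => //.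
  rewrite /dual_sum (bigA_distr_big_dep (fun j (x : 'I_Big.+1) => (x <= (A j).*2)%N)
    (fun j (y : 'I_Big.+1) => cnorm (\sum_(x < Big.+1 | (x <= (A j).*2)%N)
       e (al j * (x%:Z - (A j)%:Z)%:~R * (y%:Z - (A j)%:Z)%:~R)))).
  by [].
rewrite -/(W _) exprM.
apply: (@le_trans _ _ ((H%:R ^+ s.*2.-1 * \sum_(f in Lam) r f * cnorm (T f)) ^+ s.*2)).
  rewrite lerXn2r ?nnegrE ?exprn_ge0 ?cnorm_ge0 //.
    by rewrite mulr_ge0 ?exprn_ge0 //; apply: sumr_ge0 => f _; rewrite mulr_ge0 // cnorm_ge0.
  by apply: le_trans stepA _; apply: ler_wpM2l => //; exact: exprn_ge0.
rewrite exprMn -exprM -!mulrA; apply: ler_wpM2l; first exact: exprn_ge0.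
apply: le_trans stepC _; apply: ler_wpM2l; first exact: exprn_ge0.
by apply: ler_wpM2l.
Qed.

Lemma dual_sum_le (al : R) (B : nat) : dual_sum al B <= B.*2.+1%:R ^+ 2.
Proof.
have cB : #|[pred x : 'I_Big.+1 | (x <= B.*2)%N]|%:R <= B.*2.+1%:R :> R.
  by rewrite ler_nat; exact: card_le_ord.
apply: (@le_trans _ _ (\sum_(y < Big.+1 | (y <= B.*2)%N) B.*2.+1%:R)).
  apply: ler_sum => y _; apply: le_trans (cnorm_sum _ _ _) _.
  by under eq_bigr do rewrite cnorm_e; rewrite sumr_const.
by rewrite sumr_const -[leLHS]mulr_natl expr2 ler_wpM2r.
Qed.

(** The inner sum is geometric; its ratio is far from 1 unless y is one of the
    2 m + 1 indices closest to the centre. *)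
Lemma dual_sum_gain (al : R) (B m : nat) : (B.*2 <= Big)%N -> al != 0 ->
  `|al| * B%:R <= 2^-1 -> (0 < m)%N ->
  dual_sum al B <= B.*2.+1%:R * (m.*2.+1%:R + 2 / (`|al| * m%:R)).
Proof.
move=> BB al0 alB m0.
have mR : (0 : R) < m%:R by rewrite ltr0n.
have alp : 0 < `|al| by rewrite normr_gt0.
have bnd (y : 'I_Big.+1) : (y <= B.*2)%N ->
   cnorm (\sum_(x < Big.+1 | (x <= B.*2)%N) e (al * (x%:Z - B%:Z)%:~R * (y%:Z - B%:Z)%:~R)) <=
   (if (y <= B + m)%N && (B <= y + m)%N then B.*2.+1%:R else 0) + 2 / (`|al| * m%:R).
  move=> yB; have d0 : 0 <= 2 / (`|al| * m%:R) by rewrite divr_ge0 // mulr_ge0.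
  case: ifP => near.
    apply: ler_wpDr => //; apply: le_trans (cnorm_sum _ _ _) _.
    under eq_bigr do rewrite cnorm_e; rewrite sumr_const ler_nat; exact: card_le_ord.
  rewrite add0r; set b := al * (y%:Z - B%:Z)%:~R.
  have my : m%:R <= `|(y%:Z - B%:Z)%:~R : R|.
    rewrite -intr_norm pmulrn ler_int; move/negbT: near; rewrite negb_and -!ltnNge.
    by move: (nat_of_ord y) => y' /orP[] h; lia.
  have yB' : `|(y%:Z - B%:Z)%:~R : R| <= B%:R.
    by rewrite -intr_norm [leRHS]pmulrn ler_int; lia.
  have bE : `|b| = `|al| * `|(y%:Z - B%:Z)%:~R : R| by rewrite normrM.
  have b0 : b != 0 by rewrite -normr_gt0 bE mulr_gt0 // (lt_le_trans mR).
  have b2 : `|b| <= 2^-1 by rewrite bE (le_trans _ alB) // ler_wpM2l // ltW.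
  have -> : \sum_(x < Big.+1 | (x <= B.*2)%N) e (al * (x%:Z - B%:Z)%:~R * (y%:Z - B%:Z)%:~R) =
      \sum_(x < B.*2.+1) e (- (b * B%:R) + b *+ x).
    rewrite (big_ord_widen Big.+1 (fun x => e (- (b * B%:R) + b *+ x))) //.
    apply: eq_big => [x|x _]; first by rewrite ltnS.
    congr e; rewrite rmorphB /= -!pmulrn /b -[_ *+ x]mulr_natr; ring.
  apply: le_trans (geom_e_le _ _ b0 b2) _.
  rewrite ler_pdivlMr; last by rewrite mulr_gt0.
  rewrite mulrAC ler_pdivrMr ?normr_gt0 // ler_wpM2l // bE ler_wpM2l // ltW //.
rewrite /dual_sum; apply: le_trans (ler_sum _ bnd) _.
rewrite big_split /= mulrDr; apply: lerD.
  rewrite -big_mkcondr /= sumr_const -[leLHS]mulr_natl mulrC ler_wpM2l //.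
  rewrite ler_nat; apply: leq_trans (card_window Big.+1 B m).
  by apply: subset_leq_card; apply/fintype.subsetP => x; rewrite !inE => /andP[].
rewrite sumr_const -[leLHS]mulr_natl ler_wpM2r ?divr_ge0 ?mulr_ge0 //.
by rewrite ler_nat; exact: card_le_ord.
Qed.

End Grouping.

(** * Derivatives of h *)

Section Jets.
Variables (R : realType) (c : R).

(** [jet_ell i] is the i-th derivative of L(t) = c t^(c-1), the logarithmic
    derivative of h in the variable t = ln x. *)
Definition jet_ell (i : nat) (t : R) : R :=
  c * (\prod_(l < i) (c - 1 - l%:R)) * t `^ (c - 1 - i%:R).

(** [jet j m] is the m-th derivative in t of the function P_j for which
    x^j h^(j)(x) = h(x) P_j(ln x). *)
Fixpoint jet (j m : nat) (t : R) : R :=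
  match j with
  | 0%N => (m == 0%N)%:R
  | j'.+1 => (\sum_(i < m.+1) 'C(m, i)%:R * jet_ell i t * jet j' (m - i) t)
             - j'%:R * jet j' m t + jet j' m.+1 t
  end.

Lemma is_derive_jet_ell i (t : R) : 0 < t -> is_derive t 1 (jet_ell i) (jet_ell i.+1 t).
Proof.
move=> t0; rewrite /jet_ell big_ord_recr /=.
have H := @is_derive1_powR R (c - 1 - i%:R) t t0.
have -> : c * (\prod_(i0 < i) (c - 1 - i0%:R) * (c - 1 - i%:R)) * t `^ (c - 1 - i.+1%:R) =
   (c * \prod_(l < i) (c - 1 - l%:R)) *: ((c - 1 - i%:R) * t `^ (c - 1 - i%:R - 1)).
  have -> : c - 1 - i.+1%:R = c - 1 - i%:R - 1 by rewrite -natr1; ring.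
  by rewrite /GRing.scale /=; ring.
exact: is_deriveZ.
Qed.

Lemma leibniz_step (l a : nat -> R) m :
  \sum_(i < m.+1) 'C(m, i)%:R * (l i.+1 * a (m - i)%N + l i * a (m - i).+1) =
  \sum_(i < m.+2) 'C(m.+1, i)%:R * l i * a (m.+1 - i)%N.
Proof.
rewrite [RHS]big_ord_recl /= bin0 subn0.
have -> : \sum_(i < m.+1) 'C(m, i)%:R * (l i.+1 * a (m - i)%N + l i * a (m - i).+1) =
   \sum_(i < m.+1) 'C(m, i)%:R * l i.+1 * a (m - i)%N +
   \sum_(i < m.+1) 'C(m, i)%:R * l i * a (m - i).+1.
  by rewrite -big_split /=; apply: eq_bigr => i _; ring.
rewrite [X in _ + X]big_ord_recl /= bin0 subn0.
have -> : \sum_(i < m.+1) 'C(m.+1, bump 0 i)%:R * l (bump 0 i) * a (m.+1 - bump 0 i)%N =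
   \sum_(i < m.+1) 'C(m, i)%:R * l i.+1 * a (m - i)%N +
   \sum_(i < m.+1) 'C(m, i.+1)%:R * l i.+1 * a (m - i)%N.
  rewrite -big_split /=; apply: eq_bigr => i _.
  by rewrite /bump /= add1n binS natrD subSS; ring.
rewrite [X in _ = _ + (_ + X)]big_ord_recr /= bin_small // !mul0r addr0.
rewrite addrCA; congr (_ + (_ + _)); apply: eq_bigr => i _.
by rewrite /bump /= add1n; congr (_ * a _); have := ltn_ord i; lia.
Qed.

Lemma is_derive_jet j m (t : R) : 0 < t -> is_derive t 1 (jet j m) (jet j m.+1 t).
Proof.
move=> t0; elim: j m => [|j IH] m; first exact: is_derive_cst.
rewrite /=.
have S : is_derive t 1 (fun t => \sum_(i < m.+1) 'C(m, i)%:R * jet_ell i t * jet j (m - i) t)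
   (\sum_(i < m.+2) 'C(m.+1, i)%:R * jet_ell i t * jet j (m.+1 - i) t).
  rewrite -(leibniz_step (fun i => jet_ell i t) (fun i => jet j i t)).
  have -> : (fun t => \sum_(i < m.+1) 'C(m, i)%:R * jet_ell i t * jet j (m - i) t) =
    \sum_(i < m.+1) (fun t => 'C(m, i)%:R * jet_ell i t * jet j (m - i) t).
    by apply/funext => x; rewrite fct_sumE.
  apply: is_derive_sum => i.
  have H1 := is_derive_jet_ell i t0; have H2 := IH (m - i)%N.
  have H3 : is_derive t 1 (fun t => 'C(m, i)%:R * jet_ell i t) ('C(m, i)%:R * jet_ell i.+1 t).
    exact: is_deriveZ.
  apply: (is_derive_eq (is_deriveM H3 H2)).
  by rewrite /GRing.scale /=; ring.
have H1 := IH m; have H2 := IH m.+1.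
have H3 : is_derive t 1 (fun t => j%:R * jet j m t) (j%:R * jet j m.+1 t).
  exact: is_deriveZ.
exact: is_deriveD.
Qed.

(** The j-th derivative of h, by [is_derive_h_deriv]. *)
Definition h_deriv (j : nat) (x : R) : R := h c x * x ^- j * jet j 0 (ln x).

Lemma h_deriv0 (x : R) : h_deriv 0 x = h c x.
Proof. by rewrite /h_deriv expr0 invr1 !mulr1. Qed.

Lemma is_derive_ln1 (x : R) : 0 < x -> is_derive x 1 (@ln R) x^-1.
Proof. exact: is_derive1_ln. Qed.

Lemma is_derive_h (x : R) : 1 < x -> is_derive x 1 (h c) (h c x * x^-1 * jet_ell 0 (ln x)).
Proof.
move=> x1; have x0 : 0 < x by apply: lt_trans x1.
have l0 : 0 < ln x by apply: ln_gt0.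
have H1 := is_derive_ln1 x0.
have H2 := @is_derive1_powR R c (ln x) l0.
have H3 := is_derive1_comp H2 H1.
have H4 := is_derive1_comp (is_derive_expR _) H3.
apply: (is_derive_eq H4).
by rewrite /jet_ell big_ord0 subr0 /h; ring.
Qed.

Lemma is_derive_h_deriv j (x : R) : 1 < x -> is_derive x 1 (h_deriv j) (h_deriv j.+1 x).
Proof.
move=> x1; have x0 : 0 < x by apply: lt_trans x1.
have l0 : 0 < ln x by apply: ln_gt0.
have H1 := is_derive_h x1.
have H2 : is_derive x 1 (fun x : R => x ^- j) (- j%:R * x ^- j.+1).
  have H := @is_derive1_powR R (- j%:R) x x0.
  have E : - j%:R * x `^ (- j%:R - 1) = - j%:R * x ^- j.+1.
    have -> : - j%:R - 1 = - j.+1%:R :> R by rewrite -natr1; ring.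
    by rewrite powR_invn // ltW.
  rewrite E in H; apply: (near_eq_is_derive _ H).
  by near=> y; rewrite powR_invn // ltW //; near: y; exact: lt_nbhsr.
have H3 := is_derive1_comp (is_derive_jet j 0 l0) (is_derive_ln1 x0).
have H4 := is_deriveM (is_deriveM H1 H2) H3.
apply: (is_derive_eq H4).
rewrite /h_deriv /= big_ord1 /= bin0 subn0 /GRing.scale /= exprS invfM.
rewrite (_ : (h c * (fun y : R => y ^- j)) x = h c x * x ^- j) //.
ring.
Unshelve. all: by end_near.
Qed.

(** In the norm summing the entries of a jet, differentiation costs a factor 1,
    and the derivatives of L contribute through z only, as L is nearly constant. *)
Lemma jet_step (u u' ell : nat -> R) (L z : R) (j k : nat) :
  0 <= L -> 0 <= z <= 2^-1 -> ell 0%N = L ->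
  (forall m i, (0 < i <= m)%N -> (m <= k)%N -> 'C(m, i)%:R * `|ell i| <= L * z ^+ i) ->
  (forall m, u' m = (\sum_(i < m.+1) 'C(m, i)%:R * ell i * u (m - i)%N) - j%:R * u m + u m.+1) ->
  forall J, (J <= k)%N ->
  \sum_(m < J) `|u' m.+1| <=
    (`|L - j%:R| + 1 + 2 * L * z) * (\sum_(m < J.+1) `|u m.+1|) + 2 * L * z * `|u 0%N|.
Proof.
move=> L0 /andP[z0 z2] ell0 ellb u'E J Jk.
have split m : u' m.+1 = (L - j%:R) * u m.+1 + u m.+2 +
    \sum_(i < m.+1) 'C(m.+1, i.+1)%:R * ell i.+1 * u (m - i)%N.
  rewrite u'E big_ord_recl /= bin0 subn0 ell0 mul1r.
  under eq_bigr do rewrite /bump /= add1n subSS.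
  by ring.
set S := \sum_(m < J.+1) `|u m.+1|.
have S1 : \sum_(m < J) `|u m.+1| <= S.
  by rewrite /S big_ord_recr /= lerDl.
have S2 : \sum_(m < J) `|u m.+2| <= S.
  by rewrite /S big_ord_recl /= lerDr.
have S3 : \sum_(m < J) `|u m| <= `|u 0%N| + S.
  case: J Jk @S S1 S2 => [|J] Jk S S1 S2; first by rewrite big_ord0 addr_ge0 // sumr_ge0.
  rewrite big_ord_recl /= lerD2l; apply: le_trans S1.
  by rewrite [leRHS]big_ord_recr /= lerDl.
have S4 : \sum_(m < J) `|\sum_(i < m.+1) 'C(m.+1, i.+1)%:R * ell i.+1 * u (m - i)%N| <=
    2 * L * z * (`|u 0%N| + S).
  apply: (@le_trans _ _ (\sum_(m < J) \sum_(i < m.+1) L * z ^+ i.+1 * `|u (m - i)%N|)).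
    apply: ler_sum => m _; apply: le_trans (ler_norm_sum _ _ _) _; apply: ler_sum => i _.
    rewrite normrM; apply: ler_wpM2r => //; rewrite normrM ger0_norm //.
    have := ltn_ord i; have := ltn_ord m => mJ iJ.
    by apply: ellb; lia.
  have conv : forall J', \sum_(m < J') \sum_(i < m.+1) L * z ^+ i.+1 * `|u (m - i)%N| <=
     L * z * (\sum_(i < J') z ^+ i) * \sum_(m < J') `|u m|.
    move=> J'; rewrite -mulrA big_distrlr /= mulr_sumr.
    apply: (@le_trans _ _ (\sum_(m < J') \sum_(i < J') if (i <= m)%N then L * z ^+ i.+1 * `|u (m - i)%N| else 0)).
      apply: ler_sum => m _; rewrite (big_ord_widen J' (fun i => L * z ^+ i.+1 * `|u (m - i)%N|)) //.
      by rewrite big_mkcond /=; apply: ler_sum => i _; rewrite ltnS.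
    rewrite exchange_big /=; apply: ler_sum => i _; rewrite mulr_sumr.
    have i_le : (i <= J')%N by apply/ltnW/ltn_ord.
    rewrite -big_mkcond /=.
    have -> : \sum_(m < J' | (i <= m)%N) L * z ^+ i.+1 * `|u (m - i)%N| =
        \sum_(m < J' - i) L * z ^+ i.+1 * `|u m|.
      rewrite -(big_mkord (fun m => i <= m)%N (fun m => L * z ^+ i.+1 * `|u (m - i)%N|)).
      rewrite -(big_mkord xpredT (fun m => L * z ^+ i.+1 * `|u m|)).
      rewrite (@big_cat_nat _ _ _ i) //= big_nat_cond big1 ?add0r; last by move=> m; lia.
      have := big_addn 0 J' i (fun m => i <= m)%N (fun m => L * z ^+ i.+1 * `|u (m - i)%N|).
      rewrite add0n => ->; apply: eq_big => m; first by rewrite leq_addl.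
      by rewrite addnK.
    apply: (@le_trans _ _ (\sum_(m < J') L * z ^+ i.+1 * `|u m|)).
      rewrite (big_ord_widen J' (fun m => L * z ^+ i.+1 * `|u m|)) ?leq_subr //.
      rewrite big_mkcond /=; apply: ler_sum => m _; case: ifP => // _.
      by rewrite !mulr_ge0 // exprn_ge0.
    by apply: ler_sum => m _; rewrite exprS !mulrA.
  apply: le_trans (conv J) _.
  have geo : \sum_(i < J) z ^+ i <= 2.
    have : (1 - z) * \sum_(i < J) z ^+ i <= 1.
      have -> : (1 - z) * \sum_(i < J) z ^+ i = 1 - z ^+ J.
        by have := subrX1 z J; move: (\sum_(i < J) _) => G E; rewrite -[1 - z ^+ J]opprB E; ring.
      by rewrite gerBl exprn_ge0.
    have : 0 <= \sum_(i < J) z ^+ i by apply: sumr_ge0 => i _; rewrite exprn_ge0.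
    by move: (\sum_(i < J) _) => G; nra.
  have g0 : 0 <= \sum_(i < J) z ^+ i by apply: sumr_ge0 => i _; rewrite exprn_ge0.
  apply: ler_pM => //; first by rewrite !mulr_ge0.
    by apply: sumr_ge0.
  rewrite [leRHS](_ : _ = L * z * 2); last by ring.
  by apply: ler_wpM2l => //; rewrite mulr_ge0.
apply: (@le_trans _ _ (\sum_(m < J) (`|L - j%:R| * `|u m.+1| + `|u m.+2| +
   `|\sum_(i < m.+1) 'C(m.+1, i.+1)%:R * ell i.+1 * u (m - i)%N|))).
  apply: ler_sum => m _; rewrite split; apply: le_trans (ler_normD _ _) _; rewrite lerD2r.
  by apply: le_trans (ler_normD _ _) _; rewrite normrM.
rewrite !big_split /= -mulr_sumr.
have := ler_wpM2l (normr_ge0 (L - j%:R)) S1.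
move: S2 S4; move: (2 * L * z) (`|L - j%:R|) => y x.
by nra.
Qed.

Hypotheses (c1 : 1 < c) (c2 : c < 2).

Let c0 : 0 <= c. Proof. exact: le_trans (ltW c1). Qed.

Lemma jet_ell_bound (t : R) (k m i : nat) : 0 < t -> (m <= k)%N ->
  'C(m, i)%:R * `|jet_ell i t| <= jet_ell 0 t * (k%:R / t) ^+ i.
Proof.
move=> t0 mk; rewrite /jet_ell big_ord0 mulr1 subr0.
have pw : t `^ (c - 1 - i%:R) = t `^ (c - 1) * t ^- i.
  by rewrite powRD ?(gt_eqF t0) ?implybT // powR_invn // ltW.
have fact : `|\prod_(l < i) (c - 1 - l%:R)| <= i`!%:R.
  elim: i {pw} => [|i IH]; first by rewrite big_ord0 normr1 fact0.
  rewrite big_ord_recr /= normrM factS natrM mulrC; apply: ler_pM => //.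
  have i0 : (0 : R) <= i%:R by [].
  by have := c1; have := c2; rewrite ler_norml -natr1 => h1 h2; apply/andP; split; lra.
have ff : 'C(m, i)%:R * i`!%:R <= k%:R ^+ i :> R.
  rewrite -natrM bin_ffact -natrX ler_nat; apply: (@leq_trans (m ^ i)); last first.
    by case: i {pw fact} => // i; rewrite leq_exp2r.
  rewrite ffact_prod -[X in (_ <= _ ^ X)%N]card_ord -prod_nat_const.
  by apply: leq_prod => l _; exact: leq_subr.
rewrite pw !normrM (ger0_norm (powR_ge0 _ _)) (ger0_norm c0).
rewrite (ger0_norm (_ : 0 <= t ^- i)); last by rewrite invr_ge0 exprn_ge0 // ltW.
rewrite exprMn exprVn.
have -> : 'C(m, i)%:R * (c * `|\prod_(l < i) (c - 1 - l%:R)| * (t `^ (c - 1) / t ^+ i)) =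
   c * t `^ (c - 1) * (('C(m, i)%:R * `|\prod_(l < i) (c - 1 - l%:R)|) / t ^+ i) by ring.
apply: ler_wpM2l; first by rewrite mulr_ge0 ?powR_ge0.
apply: ler_wpM2r; first by rewrite invr_ge0 exprn_ge0 // ltW.
by apply: le_trans ff; apply: ler_wpM2l.
Qed.

Section Bounds.
Variables (t : R) (k : nat).
Hypotheses (t0 : 0 < t) (zt : k%:R / t <= 2^-1).
Let L := jet_ell 0 t.
Let tau := 2 * L * (k%:R / t).
Hypothesis tau1 : tau <= 1.

Let jd j := \sum_(m < (k - j)%N) `|jet j m.+1 t|.

Let L0 : 0 <= L.
Proof. by rewrite /L /jet_ell big_ord0 mulr1 mulr_ge0 ?powR_ge0. Qed.

Let tau0 : 0 <= tau.
Proof. by apply: mulr_ge0; [apply: mulr_ge0 | apply: divr_ge0 => //; exact/ltW]. Qed.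

Let jd0 j : 0 <= jd j. Proof. exact: sumr_ge0. Qed.

Let jd_step j : (j < k)%N ->
  jd j.+1 <= (`|L - j%:R| + 1 + tau) * jd j + tau * `|jet j 0 t|.
Proof.
move=> jk; rewrite /jd.
have -> : (k - j = (k - j.+1).+1)%N by lia.
apply: (@jet_step (fun m => jet j m t) (fun m => jet j.+1 m t) (fun i => jet_ell i t) L
  (k%:R / t) j k L0 _ (erefl _) _ _ (k - j.+1) (leq_subr _ _)).
- by rewrite zt divr_ge0 // ltW.
- by move=> m i _ mk; exact: jet_ell_bound.
- by [].
Qed.

Let jet0_step j : (j < k)%N -> `|jet j.+1 0 t - (L - j%:R) * jet j 0 t| <= jd j.
Proof.
move=> jk; rewrite /= big_ord1 /= bin0 subn0 mul1r.
have -> : jet_ell 0 t * jet j 0 t - j%:R * jet j 0 t + jet j 1 t - (L - j%:R) * jet j 0 t = jet j 1 t.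
  by rewrite /L; ring.
rewrite /jd; have -> : (k - j = (k - j.+1).+1)%N by lia.
by rewrite big_ord_recl lerDl sumr_ge0.
Qed.

Lemma jet_upper j : (j <= k)%N -> `|jet j 0 t| <= (L + k%:R + 3) ^+ j.
Proof.
have L0' := L0; have tau0' := tau0; have tau1' := tau1.
move=> jk; suff : `|jet j 0 t| + jd j <= (L + k%:R + 3) ^+ j.
  by apply: le_trans; rewrite lerDl.
elim: j jk => [|j IH] jk.
  rewrite /jd /= normr1 big1 ?addr0 ?expr0 // => i _; exact: normr0.
have {}IH := IH (ltnW jk); have S1 := jd_step jk; have S2 := jet0_step jk.
have LJ : `|L - j%:R| <= L + k%:R.
  by rewrite (le_trans (ler_normB _ _)) // (ger0_norm L0) ger0_norm // lerD2l ler_nat ltnW.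
have S3 : `|jet j.+1 0 t| <= `|L - j%:R| * `|jet j 0 t| + jd j.
  rewrite -normrM -[jet j.+1 0 t](subrK ((L - j%:R) * jet j 0 t)) addrC.
  by apply: le_trans (ler_normD _ _) _; rewrite lerD2l.
have k0 : (0 : R) <= k%:R by [].
rewrite exprS; apply: (@le_trans _ _ ((L + k%:R + 3) * (`|jet j 0 t| + jd j))); last first.
  by apply: ler_wpM2l => //; lra.
have := jd0 j; have := normr_ge0 (jet j 0 t); have := normr_ge0 (L - j%:R).
move: S1 S3 LJ; move: (`|L - j%:R|) (`|jet j 0 t|) (jd j) (`|jet j.+1 0 t|) (jd j.+1) => x a d a' d'.
move=> S1 S3 LJ x0 a0 d0.
have h1 : tau * d <= d by rewrite ler_piMl.
have h2 : tau * a <= a by rewrite ler_piMl.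
have h3 : x * (a + d) <= (L + k%:R) * (a + d) by rewrite ler_wpM2r // addr_ge0.
by nra.
Qed.

(** The lower bound survives as long as j stays below L by a margin: each step
    multiplies P_j by L - j up to an error controlled by its derivatives. *)
Lemma jet_lower J (D0 : R) : (J <= k)%N -> 2 <= D0 -> D0 <= L - J%:R ->
  tau * (1 + 8 / D0) ^+ J <= 1 -> 1 <= jet J 0 t.
Proof.
have L0' := L0; have tau0' := tau0; have tau1' := tau1.
move=> Jk D2 DL gr.
have Dp : 0 < D0 by lra.
have B1 : 1 <= 1 + 8 / D0 by rewrite lerDl divr_ge0 // ltW.
suff H j : (j <= J)%N -> 1 <= jet j 0 t /\ jd j <= tau * ((1 + 8 / D0) ^+ j - 1) * jet j 0 t.
  by case: (H J).
elim: j => [|j IH] jJ.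
  rewrite /= /jd subn0 expr0 subrr mulr0 mul0r; split=> //.
  by rewrite big1 // => i _; exact: normr0.
have [a1 d1] := IH (ltnW jJ); have jk : (j < k)%N by apply: leq_trans Jk.
have S1 := jd_step jk; have /ler_normlP[S2 _] := jet0_step jk.
have jR : j%:R + 1 <= J%:R :> R by rewrite natr1 ler_nat.
have LD : D0 <= L - j%:R by lra.
have rho1 : tau * ((1 + 8 / D0) ^+ j - 1) <= 1.
  apply: le_trans gr; apply: ler_wpM2l => //.
  apply: (@le_trans _ _ ((1 + 8 / D0) ^+ j)); first by rewrite gerBl.
  by rewrite ler_weXn2l // ltnW.
have rho0 : 0 <= tau * ((1 + 8 / D0) ^+ j - 1).
  by rewrite mulr_ge0 // subr_ge0 exprn_ege1.
rewrite exprS.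
have BE : tau * ((1 + 8 / D0) * (1 + 8 / D0) ^+ j - 1) =
  (1 + 8 / D0) * (tau * ((1 + 8 / D0) ^+ j - 1)) + tau * (8 / D0) by ring.
rewrite BE; have := jd0 j; have d2 := jd0 j.+1.
rewrite (ger0_norm (_ : 0 <= L - j%:R)) in S1; last by lra.
rewrite (ger0_norm (_ : 0 <= jet j 0 t)) in S1; last by lra.
have DD : 1 <= (L - j%:R) / D0 by rewrite ler_pdivlMr // mul1r.
move: S1 S2 d1 rho1 rho0 a1 LD DD d2; set x := 8 / D0.
have xE : x * D0 = 8 by rewrite /x divfK // gt_eqF.
move: (jet j 0 t) (jet j.+1 0 t) (jd j) (jd j.+1) (tau * (_ - 1)) (L - j%:R) => a a' d d' rho D.
move=> S1 S2 d1 rho1 rho0 a1 LD DD d2 d0.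
have dle : d <= a by apply: le_trans d1 _; rewrite ler_piMl //; lra.
have a'ge : (D - 1) * a <= a' by lra.
have x0 : 0 < x by rewrite divr_gt0.
split; first by apply: le_trans a'ge; nra.
have xD : 4 <= x * (D - 1).
  have : x * D0 / 2 <= x * (D - 1) by rewrite -mulrA; apply: ler_wpM2l; lra.
  by rewrite xE; lra.
have key : (D + 2) * rho + tau <= ((1 + x) * rho + tau * x) * (D - 1).
  have e1 : ((1 + x) * rho + tau * x) * (D - 1) = rho * (D - 1) + (rho + tau) * (x * (D - 1)) by ring.
  rewrite e1; have : (rho + tau) * 4 <= (rho + tau) * (x * (D - 1)).
    by apply: ler_wpM2l => //; rewrite addr_ge0.
  by lra.
have R0 : 0 <= (1 + x) * rho + tau * x.
  by rewrite addr_ge0 // mulr_ge0 //; lra.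
apply: (@le_trans _ _ (((1 + x) * rho + tau * x) * ((D - 1) * a))); last exact: ler_wpM2l.
rewrite mulrA; apply: (@le_trans _ _ (((D + 2) * rho + tau) * a)); last first.
  by apply: ler_wpM2r => //; lra.
have : (D + 1 + tau) * d <= (D + 2) * (rho * a).
  apply: ler_pM => //; lra.
by lra.
Qed.

End Bounds.

End Jets.

(** Induction by the mean value theorem alone, at the price of the factorial in
    the remainder. *)
Lemma taylor_bound (R : realType) k (D : nat -> R -> R) (a b M : R) : a <= b ->
  (forall j x, a <= x <= b -> is_derive x 1 (D j) (D j.+1 x)) ->
  (forall x, a <= x <= b -> `|D k.+1 x| <= M) ->
  `|D 0%N b - \sum_(j < k.+1) D j a / j`!%:R * (b - a) ^+ j| <= M * (b - a) ^+ k.+1.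
Proof.
elim: k D b => [|k IH] D b ab dD DM.
all: have cD j x y : a <= x -> y <= b -> {within `[x, y], continuous (D j)}%classic.
1,3: move=> ax yb; apply: derivable_within_continuous => z /itvP zi.
1,2: have zab : a <= z <= b by apply/andP; split; [apply: le_trans ax _ | apply: le_trans _ yb]; rewrite zi.
1,2: by have [] := dD j z zab.
  have [t /itvP ti E] := MVT_segment ab (fun x xi => dD 0%N x (subset_itv_oo_cc xi)) (cD 0%N a b (lexx _) (lexx _)).
  rewrite big_ord1 expr0 mulr1 fact0 divr1 E normrM expr1 (ger0_norm (_ : 0 <= b - a)) ?subr_ge0 //.
  by apply: ler_wpM2r; [rewrite subr_ge0 | apply: DM; rewrite !ti].
pose T x := \sum_(j < k.+2) D j a / j`!%:R * (x - a) ^+ j.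
pose T' x := \sum_(j < k.+1) D j.+1 a / j`!%:R * (x - a) ^+ j.
have dT (x : R) : is_derive x 1 T (T' x).
  have -> : T = \sum_(j < k.+2) (fun x => D j a / j`!%:R * (x - a) ^+ j).
    by apply/funext => y; rewrite fct_sumE.
  have -> : T' x = \sum_(j < k.+2) (D j a / j`!%:R * (j%:R * (x - a) ^+ j.-1)).
    rewrite big_ord_recl /= mul0r mulr0 add0r; apply: eq_bigr => j _.
    rewrite /bump /= add1n mulrA; congr (_ * _); rewrite factS natrM.
    have f1 : (j.+1)%:R != 0 :> R by rewrite pnatr_eq0.
    by rewrite invfM -!mulrA; congr (_ * _); rewrite mulrCA mulVf // mulr1.
  apply: is_derive_sum => j.
  have d1 : is_derive x 1 (fun x : R => x - a) 1.
    by apply: (is_derive_eq (is_deriveB (is_derive_id _ _) (is_derive_cst _ _ _))); rewrite subr0.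
  have d2 : is_derive x 1 (fun x : R => (x - a) ^+ j) (j%:R * (x - a) ^+ j.-1).
    have -> : (fun y : R => (y - a) ^+ j) = (fun y : R => y - a) ^+ j.
      by apply/funext => y; rewrite exprfctE.
    apply: (is_derive_eq (is_deriveX j d1)).
    by rewrite /GRing.scale /= mulr1.
  exact: is_deriveZ.
have TE : T a = D 0%N a.
  rewrite /T big_ord_recl /= subrr expr0 fact0 divr1 mulr1 big1 ?addr0 // => j _.
  by rewrite expr0n mulr0.
have cT x y : {within `[x, y], continuous T}%classic.
  by apply: derivable_within_continuous => z _; have [] := dT z.
have dG (x : R) : x \in `]a, b[ -> is_derive x 1 (D 0%N - T) (D 1%N x - T' x).
  move=> xi; have h1 := dD 0%N x (subset_itv_oo_cc xi); have h2 := dT x.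
  exact: is_deriveB.
have cG : {within `[a, b], continuous (D 0%N - T)}%classic.
  by move=> x; apply: cvgB; [exact: (cD 0%N a b (lexx _) (lexx _)) | exact: cT].
have [t /itvP ti E] := MVT_segment ab dG cG.
have -> : D 0%N b - \sum_(j < k.+2) D j a / j`!%:R * (b - a) ^+ j = (D 0%N - T) b - (D 0%N - T) a.
  have F (x : R) : (D 0%N - T) x = D 0%N x - T x by [].
  by rewrite !F TE subrr subr0.
rewrite E normrM (ger0_norm (_ : 0 <= b - a)) ?subr_ge0 // exprSr mulrA.
apply: ler_wpM2r; first by rewrite subr_ge0.
have at_ : a <= t by rewrite ti.
have tb : t <= b by rewrite ti.
have M0 : 0 <= M by apply: le_trans (normr_ge0 _) (DM a _); rewrite lexx.
have := IH (fun j => D j.+1) t at_.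
move/(_ _ _)/le_trans; apply.
- by move=> j x /andP[h1 h2]; apply: dD; rewrite h1 (le_trans h2).
- by move=> x /andP[h1 h2]; apply: DM; rewrite h1 (le_trans h2).
by apply: ler_wpM2l => //; rewrite lerXn2r ?nnegrE ?subr_ge0 // lerD2r.
Qed.

(** * Removing the integer part *)

(** The Fejér kernel with peak at l/K, normalised so that these K translates sum
    to 1. *)
Definition fejer (R : realType) (K l : nat) (y : R) : R :=
  cnorm (\sum_(a < K) e (a%:R * (y - l%:R / K%:R))) ^+ 2 / K%:R ^+ 2.

Lemma fejer_ge0 (R : realType) K l (y : R) : 0 <= fejer K l y.
Proof. by rewrite /fejer divr_ge0 // exprn_ge0 // cnorm_ge0. Qed.

Lemma fejer_expand (R : realType) K l (y : R) :
  (fejer K l y)%:C = (K%:R ^- 2)%:C *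
    \sum_(a < K) \sum_(b < K) e ((a%:R - b%:R) * (y - l%:R / K%:R)).
Proof.
rewrite /fejer rmorphM /= cnorm_sqr mulrC; congr (_ * _).
rewrite rmorph_sum big_distrlr /=; apply: eq_bigr => a _; apply: eq_bigr => b _.
by rewrite e_conj -eD; congr e; ring.
Qed.

Lemma fejer_sum1 (R : realType) K (y : R) : (0 < K)%N -> \sum_(l < K) fejer K l y = 1.
Proof.
move=> K0; have KR : (K%:R : R) != 0 by rewrite pnatr_eq0 -lt0n.
apply: (@complexI R); rewrite rmorph_sum /=.
under eq_bigr do rewrite fejer_expand.
rewrite -mulr_sumr exchange_big /=.
have -> : \sum_(a < K) \sum_(l < K) \sum_(b < K) e ((a%:R - b%:R) * (y - l%:R / K%:R)) =
    \sum_(a < K) (K%:R : R[i]).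
  apply: eq_bigr => a _; rewrite exchange_big /= (bigD1 a) //=.
  rewrite [X in _ + X]big1 ?addr0 => [|b ba].
    under eq_bigr do rewrite subrr mul0r e0.
    by rewrite sumr_const card_ord.
  have -> : \sum_(l < K) e ((a%:R - b%:R) * (y - l%:R / K%:R)) =
      e ((a%:R - b%:R) * y) * \sum_(l < K) e (l%:R / K%:R * (b%:Z - a%:Z)%:~R).
    rewrite mulr_sumr; apply: eq_bigr => l _; rewrite -eD; congr e.
    by rewrite rmorphB /= -!pmulrn; ring.
  rewrite char_orth //; last by have := ltn_ord a; have := ltn_ord b; lia.
  rewrite ifF ?mulr0 //; apply/negbTE; rewrite subr_eq0 eqz_nat.
  by apply: contra ba => /eqP h; apply/eqP/val_inj.
rewrite sumr_const card_ord -mulrnA.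
have -> : ((K * K)%:R : R[i]) = (K%:R ^+ 2 : R)%:C by rewrite rmorphXn rmorph_nat natrM.
by rewrite -rmorphM /= mulVf // expf_neq0.
Qed.

Lemma e_natmul_shift (R : realType) (a : nat) (t : R) (k : int) :
  e (a%:R * (t + k%:~R)) = e (a%:R * t).
Proof.
have -> : a%:R * (t + k%:~R) = a%:R * t + (a%:Z * k)%:~R by rewrite rmorphM /= -pmulrn; ring.
by rewrite e_periodic.
Qed.

Lemma fejer_tail (R : realType) K l (y t de : R) (k : int) : (0 < K)%N ->
  y - l%:R / K%:R = t + k%:~R -> 0 < de -> de <= `|t| -> `|t| <= 2^-1 ->
  fejer K l y <= 4 / (de ^+ 2 * K%:R ^+ 2).
Proof.
move=> K0 yt d0 dt t2; have tp : 0 < `|t| by apply: lt_le_trans dt.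
have KR : (0 : R) < K%:R by rewrite ltr0n.
have -> : 4 / (de ^+ 2 * K%:R ^+ 2) = (2 / de) ^+ 2 / K%:R ^+ 2.
  by rewrite invfM expr_div_n; ring.
rewrite /fejer; apply: ler_wpM2r; first by rewrite invr_ge0 exprn_ge0.
rewrite lerXn2r ?nnegrE ?cnorm_ge0 ?divr_ge0 // ?(ltW d0) //.
have -> : \sum_(a < K) e (a%:R * (y - l%:R / K%:R)) = \sum_(a < K) e (0 + t *+ a).
  by apply: eq_bigr => a _; rewrite yt e_natmul_shift add0r mulr_natl.
apply: le_trans (geom_e_le _ _ _ t2) _; first by rewrite -normr_gt0.
by apply: ler_wpM2l => //; rewrite lef_pV2 ?posrE.
Qed.

Lemma fejer_peak (R : realType) K (y t : R) (k : int) : (0 < K)%N ->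
  y = t + k%:~R -> `|t| * (32 * K%:R) <= 1 -> 4^-1 <= fejer K 0 y.
Proof.
move=> K0 yt tK; have KR : (0 : R) < K%:R by rewrite ltr0n.
rewrite /fejer mul0r subr0.
have -> : \sum_(a < K) e (a%:R * y) = \sum_(a < K) e (a%:R * t).
  by apply: eq_bigr => a _; rewrite yt e_natmul_shift.
have dif : cnorm (K%:R - \sum_(a < K) e (a%:R * t)) <= K%:R / 2.
  have -> : K%:R - \sum_(a < K) e (a%:R * t) = \sum_(a < K) (e 0 - e (a%:R * t)).
    by rewrite sumrB e0 sumr_const card_ord.
  apply: le_trans (cnorm_sum _ _ _) _.
  apply: (@le_trans _ _ (\sum_(a < K) 2^-1 : R)).
    apply: ler_sum => a _; apply: le_trans (cnorm_eB_le _ _) _.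
    rewrite sub0r normrN normrM ger0_norm //.
    have aK : a%:R <= K%:R :> R by rewrite ler_nat ltnW.
    have := ler_wpM2r (normr_ge0 t) aK; lra.
  by rewrite sumr_const card_ord -[_ *+ K]mulr_natr mulrC.
have big : K%:R / 2 <= cnorm (\sum_(a < K) e (a%:R * t)).
  have := cnormD (K%:R - \sum_(a < K) e (a%:R * t)) (\sum_(a < K) e (a%:R * t)).
  by rewrite subrK cnorm_nat; lra.
rewrite ler_pdivlMr ?exprn_gt0 //.
have -> : 4^-1 * K%:R ^+ 2 = (K%:R / 2) ^+ 2 :> R by field.
by rewrite lerXn2r ?nnegrE ?cnorm_ge0 ?divr_ge0.
Qed.

Section Floor.
Variables (R : realType) (N K : nat) (x : nat -> R) (xi eps : R).
Hypotheses (K0 : (0 < K)%N) (xi2 : `|xi| <= 2^-1) (eps0 : 0 <= eps).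
(* A cube, so that the tails of the kernel [fejer L], of total about 1/(de^2 L)
   outside the distance de = 1/(32 K), are of the size of de. *)
Let L := ((32 * K) ^ 3)%N.
Hypothesis twisted : forall j : int, (absz j < L)%N ->
  cnorm (\sum_(n < N) e ((j%:~R + xi) * x n)) <= eps * N%:R.
Hypothesis untwisted : forall j : int, j != 0 -> (absz j < K)%N ->
  cnorm (\sum_(n < N) e (j%:~R * x n)) <= eps * N%:R.

Let fl n : R := (Num.floor (x n))%:~R.

Let L0 : (0 < L)%N. Proof. by rewrite expn_gt0 muln_gt0 K0. Qed.

(* The values of e(-{y} xi) at the points l/L are interpolated by the kernels;
   the factor e(xi x n) turns fractional parts back into integer parts. *)
Let approx n : R[i] :=
  \sum_(l < L) e (- (xi * (l%:R / L%:R))) * (e (xi * x n) * (fejer L l (x n))%:C).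

(** Away from the integers the function e(-{y} xi) of y is smooth, and the kernel
    is concentrated; near them both sides are bounded and the peak of a coarser
    kernel pays. *)
Lemma approx_error n : cnorm (e (fl n * xi) - approx n) <=
  1 / K%:R + 8 * fejer K 0 (x n).
Proof.
have K0' := K0; have L0' := L0; have xi2' := xi2.
have KR : (0 : R) < K%:R by rewrite ltr0n.
have LR : (0 : R) < L%:R by rewrite ltr0n.
set y := x n - fl n.
have y0 : 0 <= y by rewrite subr_ge0 /fl floor_le_tmp.
have y1 : y < 1 by have := lt_succ_floor (x n); rewrite /y /fl rmorphD /= rmorph1; lra.
have E : e (fl n * xi) - approx n = \sum_(l < L) e (xi * x n) *
    (e (- (xi * y)) - e (- (xi * (l%:R / L%:R)))) * (fejer L l (x n))%:C.
  have -> : e (fl n * xi) = \sum_(l < L) e (xi * x n) * e (- (xi * y)) * (fejer L l (x n))%:C.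
    rewrite -mulr_sumr -rmorph_sum /= fejer_sum1 // rmorph1 mulr1 -eD; congr e.
    by rewrite /y; ring.
  rewrite /approx -sumrB; apply: eq_bigr => l _; ring.
have bnd l : cnorm (e (xi * x n) *
    (e (- (xi * y)) - e (- (xi * (l%:R / L%:R)))) * (fejer L l (x n))%:C) <=
    Num.min 2 (8 * `|y - l%:R / L%:R|) * fejer L l (x n).
  rewrite !cnormM cnorm_e mul1r cnorm_real (ger0_norm (fejer_ge0 _ _ _)).
  apply: ler_wpM2r; first exact: fejer_ge0.
  rewrite le_min; apply/andP; split.
    by apply: le_trans (cnormB _ _) _; rewrite !cnorm_e; lra.
  apply: le_trans (cnorm_eB_le _ _) _.
  have -> : - (xi * y) - - (xi * (l%:R / L%:R)) = - (xi * (y - l%:R / L%:R)) by ring.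
  rewrite normrN normrM; have := normr_ge0 (y - l%:R / L%:R).
  by move: (`|y - _|) => d d0; nra.
rewrite E; apply: le_trans (cnorm_sum _ _ _) _.
have triv : \sum_(l < L) cnorm (e (xi * x n) *
    (e (- (xi * y)) - e (- (xi * (l%:R / L%:R)))) * (fejer L l (x n))%:C) <= 2.
  apply: (@le_trans _ _ (\sum_(l < L) 2 * fejer L l (x n))).
    apply: ler_sum => l _; apply: le_trans (bnd l) _; apply: ler_wpM2r; first exact: fejer_ge0.
    by rewrite ge_min lexx.
  by rewrite -mulr_sumr fejer_sum1 // mulr1.
pose de : R := (32 * K%:R)^-1.
have de0 : 0 < de by rewrite invr_gt0 mulr_gt0.
have deK : de * (32 * K%:R) = 1 by rewrite mulVf // gt_eqF // mulr_gt0.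
have K1 : (1 : R) <= K%:R by rewrite ler1n.
have inv0 : 0 <= 1 / K%:R :> R by rewrite divr_ge0.
have near_case (t : R) (k : int) : x n = t + k%:~R -> `|t| <= de ->
    2 <= 1 / K%:R + 8 * fejer K 0 (x n).
  move=> xt td; have := @fejer_peak R K (x n) t k K0' xt.
  have -> : `|t| * (32 * K%:R) <= 1 by rewrite -[leRHS]deK ler_wpM2r // mulr_ge0.
  by move/(_ isT); lra.
have [yde|dey] := ltP y de.
  apply: le_trans triv _; apply: (near_case y (Num.floor (x n))); first by rewrite /y /fl subrK.
  by rewrite ger0_norm // ltW.
have [yde'|dey'] := ltP (1 - de) y.
  apply: le_trans triv _; apply: (near_case (y - 1) (Num.floor (x n) + 1)).
    by rewrite rmorphD /= rmorph1 /y /fl; ring.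
  by rewrite distrC ger0_norm; lra.
have f0 := fejer_ge0 K 0 (x n).
apply: (@le_trans _ _ (1 / K%:R)); last by lra.
apply: (@le_trans _ _ (\sum_(l < L) (8 * de * fejer L l (x n) + 2 * (4 / (de ^+ 2 * L%:R ^+ 2))))).
  apply: ler_sum => l _; apply: le_trans (bnd l) _.
  have tail0 : 0 <= 4 / (de ^+ 2 * L%:R ^+ 2) :> R by rewrite divr_ge0 // mulr_ge0 // exprn_ge0 // ltW.
  have fl0 := fejer_ge0 L l (x n).
  have [close|far] := leP `|y - l%:R / L%:R| de.
    apply: ler_wpDr; first by rewrite mulr_ge0.
    by apply: ler_wpM2r => //; rewrite ge_min ler_wpM2l ?orbT.
  apply: ler_wpDl; first by rewrite mulr_ge0 // mulr_ge0 // ltW.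
  apply: (@le_trans _ _ (2 * fejer L l (x n))).
    by apply: ler_wpM2r => //; rewrite ge_min lexx.
  apply: ler_wpM2l => //.
  have l0 : 0 <= l%:R / L%:R :> R by rewrite divr_ge0.
  have l1 : l%:R / L%:R < 1 :> R by rewrite ltr_pdivrMr // mul1r ltr_nat.
  have [h|h] := leP `|y - l%:R / L%:R| 2^-1.
    apply: (@fejer_tail R L l (x n) (y - l%:R / L%:R) de (Num.floor (x n))) => //.
      by rewrite /y /fl; ring.
    exact: ltW.
  have [yl|ly] := leP (l%:R / L%:R) y.
    rewrite ger0_norm ?subr_ge0 // in h.
    apply: (@fejer_tail R L l (x n) (y - l%:R / L%:R - 1) de (Num.floor (x n) + 1)) => //.
    - by rewrite rmorphD /= rmorph1 /y /fl; ring.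
    - by rewrite distrC ger0_norm; lra.
    - by rewrite distrC ger0_norm; lra.
  rewrite ltr0_norm ?subr_lt0 // in h.
  apply: (@fejer_tail R L l (x n) (y - l%:R / L%:R + 1) de (Num.floor (x n) - 1)) => //.
  - by rewrite rmorphB /= rmorph1 /y /fl; ring.
  - by rewrite ger0_norm; lra.
  - by rewrite ger0_norm; lra.
rewrite big_split /= -mulr_sumr fejer_sum1 // mulr1 sumr_const card_ord -[_ *+ L]mulr_natr.
have -> : L%:R = (32 * K%:R) ^+ 3 :> R by rewrite natrX natrM.
rewrite /de; set z : R := 32 * K%:R.
have z0 : z != 0 by rewrite gt_eqF // mulr_gt0.
have -> : 8 * z^-1 + 2 * (4 / (z^-1 ^+ 2 * (z ^+ 3) ^+ 2)) * z ^+ 3 = 16 / z by field.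
by rewrite /z invfM mulrA ler_wpM2r ?invr_ge0 //; lra.
Qed.

(** The approximation is summed with [twisted]. The points close to the integers
    are counted by the peaks of [fejer K 0], hence by [untwisted]. *)
Lemma floor_sum_bound : cnorm (\sum_(n < N) e (fl n * xi)) <=
  N%:R * (9 / K%:R + (8 + L%:R) * eps).
Proof.
have K0' := K0; have L0' := L0; have eps0' := eps0.
have KR : (0 : R) < K%:R by rewrite ltr0n.
have LR : (0 : R) < L%:R by rewrite ltr0n.
have main : cnorm (\sum_(n < N) approx n) <= L%:R * eps * N%:R.
  rewrite /approx exchange_big /=; apply: le_trans (cnorm_sum _ _ _) _.
  apply: (@le_trans _ _ (\sum_(l < L) eps * N%:R)); last first.
    by rewrite sumr_const card_ord -[leLHS]mulr_natl mulrA.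
  apply: ler_sum => l _; rewrite -mulr_sumr cnormM cnorm_e mul1r.
  have -> : \sum_(n < N) e (xi * x n) * (fejer L l (x n))%:C = (L%:R ^- 2)%:C *
     \sum_(a < L) \sum_(b < L) e (- (a%:R - b%:R) * (l%:R / L%:R)) *
       \sum_(n < N) e (((a%:Z - b%:Z)%:~R + xi) * x n).
    under eq_bigr do rewrite fejer_expand mulrCA mulr_sumr.
    rewrite -mulr_sumr exchange_big /=; congr (_ * _); apply: eq_bigr => a _.
    under eq_bigr do rewrite mulr_sumr.
    rewrite exchange_big /=; apply: eq_bigr => b _; rewrite mulr_sumr; apply: eq_bigr => n _.
    by rewrite -!eD; congr e; rewrite rmorphB /= -!pmulrn; ring.
  rewrite cnormM cnorm_real ger0_norm ?invr_ge0 ?exprn_ge0 //.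
  rewrite mulrC ler_pdivrMr ?exprn_gt0 //; apply: le_trans (cnorm_sum _ _ _) _.
  apply: (@le_trans _ _ (\sum_(a < L) \sum_(b < L) eps * N%:R)).
    apply: ler_sum => a _; apply: le_trans (cnorm_sum _ _ _) _; apply: ler_sum => b _.
    rewrite cnormM cnorm_e mul1r; apply: twisted.
    by have := ltn_ord a; have := ltn_ord b; lia.
  by rewrite !sumr_const !card_ord -mulrnA -[leLHS]mulr_natr natrM expr2.
have bad : \sum_(n < N) fejer K 0 (x n) <= N%:R / K%:R + eps * N%:R.
  have -> : \sum_(n < N) fejer K 0 (x n) = cnorm (\sum_(n < N) (fejer K 0 (x n))%:C).
    rewrite -rmorph_sum cnorm_real ger0_norm //; apply: sumr_ge0 => n _; exact: fejer_ge0.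
  have -> : \sum_(n < N) (fejer K 0 (x n))%:C = (K%:R ^- 2)%:C *
     \sum_(a < K) \sum_(b < K) \sum_(n < N) e ((a%:Z - b%:Z)%:~R * x n).
    under eq_bigr do rewrite fejer_expand.
    rewrite -mulr_sumr exchange_big /=; congr (_ * _); apply: eq_bigr => a _.
    rewrite exchange_big /=; apply: eq_bigr => b _; apply: eq_bigr => n _.
    by congr e; rewrite mul0r subr0 rmorphB /= -!pmulrn.
  rewrite cnormM cnorm_real ger0_norm ?invr_ge0 ?exprn_ge0 //.
  rewrite mulrC ler_pdivrMr ?exprn_gt0 //; apply: le_trans (cnorm_sum _ _ _) _.
  apply: (@le_trans _ _ (\sum_(a < K) (N%:R + K%:R * (eps * N%:R)))).
    apply: ler_sum => a _; apply: le_trans (cnorm_sum _ _ _) _.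
    rewrite (bigD1 a) //=; apply: lerD.
      apply: le_trans (cnorm_sum _ _ _) _.
      by under eq_bigr do rewrite cnorm_e; rewrite sumr_const card_ord.
    apply: (@le_trans _ _ (\sum_(b < K) eps * N%:R)); last first.
      by rewrite sumr_const card_ord -[leLHS]mulr_natl.
    rewrite big_mkcond /=; apply: ler_sum => b _; case: ifP => ba; last by rewrite mulr_ge0.
    apply: untwisted; last by have := ltn_ord a; have := ltn_ord b; lia.
    rewrite subr_eq0 eqz_nat; apply: contraTN ba => /eqP h; rewrite negbK; apply/eqP/val_inj.
    by rewrite /= h.
  rewrite sumr_const card_ord -[leLHS]mulr_natr.
  by rewrite le_eqVlt; apply/orP; left; apply/eqP; field; rewrite gt_eqF.
have -> : \sum_(n < N) e (fl n * xi) =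
   \sum_(n < N) approx n + \sum_(n < N) (e (fl n * xi) - approx n).
  by rewrite sumrB addrC subrK.
apply: le_trans (cnormD _ _) _.
have err : cnorm (\sum_(n < N) (e (fl n * xi) - approx n)) <=
    N%:R * (1 / K%:R) + 8 * (N%:R / K%:R + eps * N%:R).
  apply: le_trans (cnorm_sum _ _ _) _.
  apply: (@le_trans _ _ (\sum_(n < N) (1 / K%:R + 8 * fejer K 0 (x n)))).
    by apply: ler_sum => n _; exact: approx_error.
  rewrite big_split /= sumr_const card_ord -[(1 / _) *+ N]mulr_natl lerD2l -mulr_sumr.
  exact: ler_wpM2l.
apply: le_trans (lerD main err) _.
by rewrite le_eqVlt; apply/orP; left; apply/eqP; ring.
Qed.

End Floor.

(** * Exponential sums of Vinogradov type *)

Lemma shift_average (R : realType) (g : nat -> R[i]) a b d :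
  (forall n, cnorm (g n) <= 1) -> (a <= b)%N ->
  cnorm (\sum_(a <= n < b) g n - \sum_(a <= n < b) g (n + d)%N) <= 2 * d%:R.
Proof.
move=> g1 ab.
have -> : \sum_(a <= n < b) g (n + d)%N = \sum_(a + d <= n < b + d) g n.
  by rewrite big_addn addnK.
have E : \sum_(a <= n < b) g n + \sum_(b <= n < b + d) g n =
    \sum_(a <= n < a + d) g n + \sum_(a + d <= n < b + d) g n.
  by rewrite -!big_cat_nat //=; lia.
have -> : \sum_(a <= n < b) g n - \sum_(a + d <= n < b + d) g n =
    \sum_(a <= n < a + d) g n - \sum_(b <= n < b + d) g n.
  by apply/eqP; rewrite subr_eq addrAC eq_sym subr_eq -E.
have short c : cnorm (\sum_(c <= n < c + d) g n) <= d%:R.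
  apply: le_trans (cnorm_sum _ _ _) _.
  apply: (@le_trans _ _ (\sum_(c <= n < c + d) 1)); first by apply: ler_sum.
  by rewrite big_const_nat addKn iter_addr_0.
by apply: le_trans (cnormB _ _) _; have := short a; have := short b; lra.
Qed.

(** The sum is averaged over the shifts n + x y, which move its ends by at most
    Q^2. *)
Lemma weyl_shift (R : realType) (f : nat -> R) a b Q (Bd : R) : (0 < Q)%N -> (a <= b)%N ->
  (forall n, (a <= n < b)%N -> cnorm (\sum_(y < Q) \sum_(x < Q) e (f (n + x * y)%N)) <= Bd) ->
  cnorm (\sum_(a <= n < b) e (f n)) <= 2 * Q%:R ^+ 2 + (b - a)%:R * (Bd / Q%:R ^+ 2).
Proof.
move=> Q0 ab hB; have QR : (0 : R) < Q%:R ^+ 2 by rewrite exprn_gt0 // ltr0n.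
rewrite -(ler_pM2r QR) mulrDl -[_%:R * (_ / _) * _]mulrA divfK ?gt_eqF //.
set S := \sum_(a <= n < b) e (f n).
have -> : cnorm S * Q%:R ^+ 2 = cnorm (\sum_(y < Q) \sum_(x < Q) S).
  rewrite !sumr_const !card_ord -mulrnA -[S *+ _]mulr_natr cnormM cnorm_nat.
  by rewrite natrM expr2.
have -> : \sum_(y < Q) \sum_(x < Q) S =
    \sum_(y < Q) \sum_(x < Q) (S - \sum_(a <= n < b) e (f (n + x * y)%N)) +
    \sum_(a <= n < b) \sum_(y < Q) \sum_(x < Q) e (f (n + x * y)%N).
  rewrite [X in _ = _ + X]exchange_big /= -big_split /=; apply: eq_bigr => y _.
  rewrite [X in _ = _ + X]exchange_big /= -big_split /=; apply: eq_bigr => x _.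
  by rewrite subrK.
apply: le_trans (cnormD _ _) _; apply: lerD.
  apply: le_trans (cnorm_sum _ _ _) _.
  apply: (@le_trans _ _ (\sum_(y < Q) \sum_(x < Q) (2 * Q%:R ^+ 2))); last first.
    by rewrite !sumr_const !card_ord -mulrnA -[leLHS]mulr_natr natrM expr2.
  apply: ler_sum => y _; apply: le_trans (cnorm_sum _ _ _) _; apply: ler_sum => x _.
  apply: le_trans (shift_average (x * y) _ ab) _; first by move=> n; rewrite cnorm_e.
  apply: ler_wpM2l => //; rewrite natrM expr2; apply: ler_pM => //; by rewrite ler_nat ltnW.
apply: le_trans (cnorm_sum _ _ _) _.
apply: (@le_trans _ _ (\sum_(a <= n < b) Bd)).
  by rewrite big_nat [leRHS]big_nat; apply: ler_sum => n hn; exact: hB.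
by rewrite big_const_nat iter_addr_0 -[leLHS]mulr_natl.
Qed.

Lemma poly_phase_approx (R : realType) (f : nat -> R) (a0 rho : R) k (al : 'I_k -> R) n Q :
  (forall z, (z <= Q ^ 2)%N -> `|f (n + z)%N - (a0 + \sum_j al j * z%:R ^+ j.+1)| <= rho) ->
  cnorm (\sum_(y < Q) \sum_(x < Q) e (f (n + x * y)%N)) <=
  cnorm (\sum_(y < Q) \sum_(x < Q) e (\sum_j al j * (x%:R ^+ j.+1 * y%:R ^+ j.+1))) +
  Q%:R ^+ 2 * (16 * rho).
Proof.
move=> hf; set S := \sum_(y < Q) \sum_(x < Q) e (\sum_j _).
have -> : \sum_(y < Q) \sum_(x < Q) e (f (n + x * y)%N) = e a0 * S +
   \sum_(y < Q) \sum_(x < Q) (e (f (n + x * y)%N) -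
      e (a0 + \sum_j al j * (x%:R ^+ j.+1 * y%:R ^+ j.+1))).
  rewrite /S mulr_sumr -big_split /=; apply: eq_bigr => y _.
  rewrite mulr_sumr -big_split /=; apply: eq_bigr => x _.
  by rewrite -eD addrC subrK.
apply: le_trans (cnormD _ _) _; rewrite cnormM cnorm_e mul1r lerD2l.
apply: le_trans (cnorm_sum _ _ _) _.
apply: (@le_trans _ _ (\sum_(y < Q) \sum_(x < Q) (16 * rho))); last first.
  by rewrite !sumr_const !card_ord -mulrnA -[leLHS]mulr_natl natrM expr2.
apply: ler_sum => y _; apply: le_trans (cnorm_sum _ _ _) _; apply: ler_sum => x _.
apply: le_trans (cnorm_eB_le _ _) _; apply: ler_wpM2l => //.
have xy : (x * y <= Q ^ 2)%N by rewrite -mulnn leq_mul // ltnW.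
have := hf _ xy; congr (_ <= _); congr `|_|; congr (_ - (_ + _)).
by apply: eq_bigr => j _; rewrite natrM exprMn.
Qed.

Lemma holder_exponent S K : (0 < S)%N -> (K <= S)%N ->
  (S.-1 * S + S * S.-1 + ((S - K).*2 + K.*2) = 2 * (S * S))%N.
Proof. by case: S => // S _ KS; rewrite -doubleD subnK //=; nia. Qed.

(** All dual sums are bounded trivially, except that of index j0. The mean value
    enters squared, which doubles its defect. *)
Lemma vino_block (R : realType) k s q (al : 'I_k -> R) (j0 : 'I_k) (b : R) :
  (0 < k)%N -> s = (k * (k + k ^ 2))%N -> let Q := (2 ^ q)%N in
  0 < b <= 1 -> b ^+ 2 <= `|al j0| -> `|al j0| * (s * Q ^ j0.+1)%:R <= 2^-1 ->
  cnorm (\sum_(y < Q) \sum_(x < Q) e (\sum_j al j * (x%:R ^+ j.+1 * y%:R ^+ j.+1)))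
    ^+ (s.*2 * s.*2) <=
  (Q%:R ^+ 2) ^+ (s.*2 * s.*2) *
   (2 ^+ (120 * k ^ 5) * (3 * s)%:R ^+ k.*2 *
     2 `^ (2 * (q%:R * ((tri k)%:R * (1 - k%:R^-1) ^+ (k ^ 2)))) * (7 / (b * Q%:R ^+ j0.+1))).
Proof.
move=> k0 sE Q /andP[b0 b1] ba aA.
have s0 : (0 < s)%N by rewrite sE muln_gt0 k0 addn_gt0 k0.
pose A (j : 'I_k) : nat := (s * Q ^ j.+1)%N.
pose Big := (\sum_j (A j).*2)%N.
have ABig j : ((A j).*2 < Big.+1)%N by rewrite ltnS /Big (bigD1 j) //= leq_addr.
have Q0 : (0 < Q)%N by rewrite expn_gt0.
have QR : (0 : R) < Q%:R by rewrite ltr0n.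
have al0 : al j0 != 0 by rewrite -normr_gt0 (lt_le_trans _ ba) // exprn_gt0.
have alp : 0 < `|al j0| by rewrite normr_gt0.
have sR : (1 : R) <= s%:R by rewrite ler1n.
have QjR j : (1 : R) <= Q%:R ^+ j by rewrite exprn_ege1 // ler1n.
apply: le_trans (bilinear_bound ABig al s0) _.
have A3 (j : 'I_k) : (A j).*2.+1%:R <= 3 * s%:R * Q%:R ^+ j.+1 :> R.
  have -> : 3 * s%:R * Q%:R ^+ j.+1 = (3 * A j)%:R :> R by rewrite /A !natrM natrX mulrA.
  have : (0 < A j)%N by rewrite muln_gt0 s0 expn_gt0 Q0.
  by rewrite ler_nat; lia.
have A0 (j : 'I_k) : (0 : R) <= (A j).*2.+1%:R by [].
have gain : dual_sum Big (al j0) (A j0) <=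
    (3 * s%:R * Q%:R ^+ j0.+1) ^+ 2 * (7 / (b * Q%:R ^+ j0.+1)).
  (* m about 1/b balances the two terms, since |al j0| is at least b^2 *)
  pose m := (Num.truncn b^-1).+1.
  have bi : 1 <= b^-1 by rewrite invf_ge1.
  have m1 : b^-1 <= m%:R by apply/ltW; rewrite truncnS_gt.
  have m2 : m%:R <= b^-1 + 1.
    by rewrite /m -natr1 lerD2r truncn_le // ltW // invr_gt0.
  have := @dual_sum_gain R Big (al j0) (A j0) m (ABig j0) al0 aA isT.
  move/le_trans; apply.
  have T : m.*2.+1%:R + 2 / (`|al j0| * m%:R) <= 7 / b.
    have h1 : m.*2.+1%:R = 2 * m%:R + 1 :> R by rewrite -natr1 -mul2n natrM.
    have h2 : 2 / (`|al j0| * m%:R) <= 2 * b^-1.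
      apply: ler_wpM2l => //; have mp : (0 : R) < m%:R by rewrite ltr0n.
      rewrite lef_pV2 ?posrE ?mulr_gt0 //.
      apply: (@le_trans _ _ (b ^+ 2 * b^-1)); first by rewrite expr2 mulfK ?gt_eqF.
      by apply: ler_pM => //; [rewrite exprn_ge0 // ltW | rewrite invr_ge0 ltW].
    by rewrite h1; lra.
  apply: (@le_trans _ _ ((3 * s%:R * Q%:R ^+ j0.+1) * (7 / b))).
    apply: ler_pM => //; rewrite addr_ge0 // divr_ge0 // mulr_ge0 //.
  have -> : (3 * s%:R * Q%:R ^+ j0.+1) ^+ 2 * (7 / (b * Q%:R ^+ j0.+1)) =
     (3 * s%:R) * ((3 * s%:R * Q%:R ^+ j0.+1) * (7 / b)).
    by field; rewrite !gt_eqF // exprn_gt0.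
  rewrite ler_peMl //; last by lra.
  by rewrite mulr_ge0 ?divr_ge0 ?(ltW b0) // mulr_ge0 ?exprn_ge0 ?(ltW QR) //; lra.
have g0 : 0 <= 7 / (b * Q%:R ^+ j0.+1) :> R.
  by rewrite divr_ge0 // mulr_ge0 ?(ltW b0) // exprn_ge0 // ltW.
have ds0 j : 0 <= dual_sum Big (al j) (A j).
  by apply: sumr_ge0 => y _; apply: cnorm_ge0.
have dual : \prod_j dual_sum Big (al j) (A j) <=
    (3 * s)%:R ^+ k.*2 * Q%:R ^+ (tri k).*2 * (7 / (b * Q%:R ^+ j0.+1)).
  have -> : (3 * s)%:R ^+ k.*2 * Q%:R ^+ (tri k).*2 = \prod_(j < k) (3 * s%:R * Q%:R ^+ j.+1) ^+ 2 :> R.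
    rewrite prodrXl big_split /= prodr_const card_ord exprMn -!exprM !muln2 natrM.
    by congr (_ * _); rewrite prodrXr -exprM muln2.
  rewrite (bigD1 j0) //= [in leRHS](bigD1 j0) //= [leLHS]mulrC.
  rewrite [leRHS](_ : _ = \prod_(i < k | i != j0) (3 * s%:R * Q%:R ^+ i.+1) ^+ 2 *
    ((3 * s%:R * Q%:R ^+ j0.+1) ^+ 2 * (7 / (b * Q%:R ^+ j0.+1)))); last by ring.
  apply: ler_pM; [by apply: prodr_ge0 | exact: ds0 | | exact: gain].
  apply: ler_prod => j _; rewrite ds0 /=; apply: le_trans (dual_sum_le _ _ _) _.
  by rewrite lerXn2r ?nnegrE // (le_trans _ (A3 j)).
have K2 : (tri k <= s.*2)%N.
  by apply: leq_trans (tri_le k) _; rewrite sE -addnn mulnDr -mulnn -!addnA leq_addr.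
have mv := @Jmv_vinogradov R k s q k0 sE.
set de := (tri k)%:R * _ in mv *.
have pE : 2 `^ (2 * (q%:R * de)) = (2 `^ (q%:R * de)) ^+ 2.
  by rewrite mulrC powRrM powR_mulrn // powR_ge0.
rewrite pE; have := powR_ge0 2 (q%:R * de); move: mv; set pw := 2 `^ _ => mv pw0.
have mv2 : (Jmv k s Q)%:R ^+ 2 <= 2 ^+ (120 * k ^ 5) * Q%:R ^+ ((s.*2 - tri k).*2) * pw ^+ 2 :> R.
  have -> : 2 ^+ (120 * k ^ 5) * Q%:R ^+ ((s.*2 - tri k).*2) * pw ^+ 2 =
     (2 ^+ (60 * k ^ 5) * 2 ^+ (q * (s.*2 - tri k)) * pw) ^+ 2 :> R.
    rewrite !exprMn -!exprM; congr (_ ^+ _ * _ * _); first by rewrite mulnAC.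
    by rewrite /Q natrX -exprM; congr (_ ^+ _); rewrite -muln2 mulnA.
  by rewrite lerXn2r ?nnegrE // !mulr_ge0 // exprn_ge0.
apply: (@le_trans _ _ (Q%:R ^+ (s.*2.-1 * s.*2) * Q%:R ^+ (s.*2 * s.*2.-1) *
  (2 ^+ (120 * k ^ 5) * Q%:R ^+ ((s.*2 - tri k).*2) * pw ^+ 2) *
  ((3 * s)%:R ^+ k.*2 * Q%:R ^+ (tri k).*2 * (7 / (b * Q%:R ^+ j0.+1))))).
  apply: ler_pM; last exact: dual.
  - by apply: mulr_ge0; [apply: mulr_ge0|]; apply: exprn_ge0.
  - by apply: prodr_ge0.
  - by apply: ler_wpM2l => //; apply: mulr_ge0; apply: exprn_ge0.
rewrite le_eqVlt; apply/orP; left; apply/eqP.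
have -> : (Q%:R ^+ 2) ^+ (s.*2 * s.*2) = Q%:R ^+ (s.*2.-1 * s.*2) * Q%:R ^+ (s.*2 * s.*2.-1) *
  Q%:R ^+ ((s.*2 - tri k).*2) * Q%:R ^+ (tri k).*2 :> R.
  rewrite -!exprD -exprM; congr (_ ^+ _).
  by rewrite -!addnA addnA holder_exponent // double_gt0.
by ring.
Qed.

(** * The exponential sum over h(n) *)

Tactic Notation "lra_of" ne_hyp_list(hs) := clear - hs; lra.

(** (1 - 1/k)^(k^2) is at most exp(-k). *)
Lemma exponent_defect_le (R : realType) k : (48 <= k)%N ->
  (tri k)%:R * (1 - k%:R^-1) ^+ (k ^ 2) <= 100^-1 :> R.
Proof.
move=> k48; have k0 : (0 : R) < k%:R by rewrite ltr0n; lia.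
have k1 : (1 : R) <= k%:R by rewrite ler1n; lia.
have kk : (48 : R) <= k%:R by rewrite ler_nat.
have u1 : 6 / k%:R <= 1 / 8 :> R by rewrite ler_pdivrMr //; lra.
have u0 : 0 < 6 / k%:R :> R by rewrite divr_gt0.
have b0 : 0 <= 1 - k%:R^-1 :> R by rewrite subr_ge0 invf_le1.
have pw : (1 - k%:R^-1) ^+ (k ^ 2) <= (6 / k%:R) ^+ 6 :> R.
  apply: (@le_trans _ _ (expR (- k%:R))).
    have -> : - k%:R = (k ^ 2)%:R * (- k%:R^-1) :> R.
      by rewrite natrX expr2 mulrN mulfK // gt_eqF.
    rewrite expRM_natl; apply: lerXn2r; rewrite ?nnegrE ?expR_ge0 //.
    exact: expR_ge1Dx.
  rewrite expRN -[6 / k%:R]invrK exprVn lef_pV2 ?posrE ?expR_gt0 //; last first.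
    by rewrite exprn_gt0 // invr_gt0.
  have kE : k%:R = 6%:R * (6 / k%:R)^-1 :> R by rewrite invfM invrK mulrA mulfV ?mul1r ?pnatr_eq0.
  rewrite [X in expR X]kE.
  rewrite expRM_natl; apply: lerXn2r; rewrite ?nnegrE ?expR_ge0 ?invr_ge0 ?(ltW u0) //.
  by apply: le_trans (expR_ge1Dx _); rewrite lerDr.
apply: (@le_trans _ _ (k%:R ^+ 2 * (6 / k%:R) ^+ 6)).
  apply: ler_pM => //; first exact: exprn_ge0.
  by rewrite -natrX ler_nat tri_le.
have -> : k%:R ^+ 2 * (6 / k%:R) ^+ 6 = 36 * ((6 / k%:R) ^+ 2) ^+ 2 :> R.
  by field; rewrite gt_eqF.
have h2 : (6 / k%:R) ^+ 2 <= 1 / 64 :> R by move: (6 / k%:R) u0 u1 => u u0 u1; nra.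
have h3 : 0 <= (6 / k%:R) ^+ 2 :> R by rewrite exprn_ge0 // ltW.
by move: ((6 / k%:R) ^+ 2) h2 h3 => y h2 h3; nra.
Qed.

Lemma one_le_nat_mul (R : realType) (x y : R) : 1 <= x -> 0 <= y -> y <= x * y.
Proof. by move=> x1 y0; rewrite ler_peMl. Qed.

(** Here lam stands for ln N, and w, v, g for its powers 1/7, 1/8 and c - 1. The
    condition [g <= w], from c < 8/7, keeps the degrees k below a multiple of w, so
    that k^6 v is small compared to lam. *)
Definition large {R : realType} (c lam w v g : R) : Prop :=
  lam = w ^+ 7 /\ 100 ^+ 8 <= w /\ expR (32 / (c - 1)) <= w /\
  1 <= v /\ 100 ^+ 8 * v <= w /\ g <= w /\ 10 <= (c - 1) * g /\
  (forall t, lam - v <= t <= lam -> g * (1 - v / lam) <= t `^ (c - 1) <= g).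

Lemma large_facts (R : realType) (c lam w v g : R) : large c lam w v g ->
  [/\ 100 <= w, 100 ^+ 4 * w ^+ 2 <= lam, 100 ^+ 9 * w ^+ 5 <= lam & 100 * v <= w].
Proof.
move=> [lamE [W [_ [v1 [vw _]]]]].
have H1 : (1 : R) <= 100 by rewrite ler1n.
have w100 : 100 <= w.
  by apply: le_trans W; rewrite -[leLHS]expr1 ler_weXn2l.
have w1 : 1 <= w by apply: le_trans w100.
have w0 : 0 <= w by apply: le_trans w1.
split=> //.
- rewrite lamE (exprD w 5 2); apply: ler_wpM2r; first exact: exprn_ge0.
  apply: (@le_trans _ _ (100 ^+ 5)); first by rewrite ler_weXn2l.
  by apply: lerXn2r; rewrite ?nnegrE.
- rewrite lamE (exprD w 2 5); apply: ler_wpM2r; first exact: exprn_ge0.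
  apply: (@le_trans _ _ ((100 ^+ 8) ^+ 2)); first by rewrite -exprM ler_weXn2l.
  by apply: lerXn2r; rewrite ?nnegrE ?exprn_ge0.
- apply: le_trans vw; apply: ler_wpM2r; first exact: le_trans v1.
  by rewrite -[leLHS]expr1 ler_weXn2l.
Qed.

Lemma large_sizes (R : realType) (c lam w v g : R) : large c lam w v g ->
  [/\ 0 < w, 100 * w <= w ^+ 2 & 100 * w ^+ 2 <= lam].
Proof.
move=> lg; have [w100 q2 _ _] := large_facts lg.
have w0 : 0 < w by lra_of w100.
split=> //; first by rewrite expr2; apply: ler_wpM2r => //; exact: ltW.
apply: le_trans q2; apply: ler_wpM2r; first by rewrite exprn_ge0 // ltW.
by rewrite -[leLHS]expr1 ler_weXn2l ?ler1n.
Qed.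

Lemma large_pow (R : realType) (c lam w v g t : R) : 1 < c -> c < 2 -> large c lam w v g ->
  lam - v <= t <= lam -> [/\ lam / 2 <= t, g * (lam - 2 * v) <= t `^ c <= lam * g,
    c * g - 1 <= jet_ell c 0 t & jet_ell c 0 t <= c * g].
Proof.
move=> c1 c2 lg tt; have [w100 q2 q5 vw] := large_facts lg.
have [lamE [W [_ [v1 [_ [gw [g10 pw]]]]]]] := lg.
have /andP[p1 p2] := pw t tt; move/andP: tt => [t1 t2].
clear lamE W q5 pw lg.
have w2 : w <= w ^+ 2 by rewrite expr2; apply: one_le_nat_mul; lra_of w100.
have {q2}qq : w ^+ 2 * 100 <= lam.
  apply: le_trans q2; rewrite mulrC; apply: ler_wpM2r; first by lra_of w2 w100.
  by rewrite -[leLHS]expr1 ler_weXn2l ?ler1n.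
have lam0 : 0 < lam by lra_of qq w2 w100.
have vl2 : v * 2 <= lam by lra_of vw qq w2 w100.
have th : lam / 2 <= t by lra_of t1 vl2.
have t0 : 0 <= t by lra_of th lam0.
have cp : 0 < c - 1 by lra_of c1.
have cg0 : 0 < (c - 1) * g by lra_of g10.
have g0 : 0 < g by rewrite -(pmulr_rgt0 _ cp).
have v0 : 0 <= v by lra_of v1.
have r0 : 0 <= v / lam by rewrite divr_ge0 // ltW.
have vl : v / lam * lam = v by rewrite divfK // gt_eqF.
have c0 : 0 < c by lra_of c1.
have tc : t `^ c = t * t `^ (c - 1) by rewrite mulr_powRB1.
have vw' : v <= w by lra_of vw v1.
have gvw : g * v <= w ^+ 2 by rewrite expr2; apply: ler_pM => //; exact: ltW.
split=> //.
- rewrite tc; apply/andP; split; last by apply: ler_pM => //; exact: powR_ge0.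
  have h : (lam - v) * (g * (1 - v / lam)) <= t * t `^ (c - 1).
    apply: ler_pM => //; first by lra_of vl2 lam0 v0.
    apply: mulr_ge0; first exact: ltW.
    by rewrite subr_ge0 ler_pdivrMr //; lra_of vl2 v0.
  apply: le_trans h; have -> : (lam - v) * (g * (1 - v / lam)) =
     g * (lam - v - v / lam * lam + v * (v / lam)) by ring.
  rewrite vl; apply: ler_wpM2l; first exact: ltW.
  have z : 0 <= v * (v / lam) by rewrite mulr_ge0.
  by lra_of z.
- rewrite /jet_ell big_ord0 mulr1 subr0.
  apply: (@le_trans _ _ (c * (g * (1 - v / lam)))); last by apply: ler_wpM2l => //; exact: ltW.
  have -> : c * (g * (1 - v / lam)) = c * g - c * (g * v / lam) by ring.
  rewrite lerD2l lerN2.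
  have gv1 : g * v / lam <= 2^-1 by rewrite ler_pdivrMr //; lra_of gvw qq w2 w100.
  apply: (@le_trans _ _ (2 * 2^-1)); last by rewrite mulfV.
  apply: ler_pM => //; [exact: ltW | | exact: ltW].
  by rewrite divr_ge0 ?(ltW lam0) // mulr_ge0 // ltW.
by rewrite /jet_ell big_ord0 mulr1 subr0; apply: ler_wpM2l => //; exact: ltW.
Qed.

(** The quantity tau of [jet_lower] is about L k / t, hence at most 1 / w since
    lam = w^7; and J <= g + 3 is below L, which is about c g, by the margin
    (c - 1) g / 2. *)
Lemma jet_large (R : realType) (c lam w v g t : R) (J k : nat) :
  1 < c -> c < 8 / 7 -> large c lam w v g -> lam - v <= t <= lam ->
  J%:R <= g + 3 -> k%:R <= 13 * w -> (J <= k)%N ->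
  1 <= jet c J 0 t /\ forall j, (j <= k.+1)%N -> `|jet c j 0 t| <= expR (j%:R * (100 * w)).
Proof.
move=> c1 c2' lg tt Jg kw Jk; have c2 : c < 2 by lra_of c2'.
have [w100 q2 q5 vw] := large_facts lg.
have [th _ L1 L2] := large_pow c1 c2 lg tt.
have [_ [_ [We [v1 [_ [gw [g10 _]]]]]]] := lg.
have [w0 w22 qq] := large_sizes lg.
have H1 : (1 : R) <= 100 by rewrite ler1n.
have {q5}qq5 : 100 ^+ 2 * w ^+ 5 <= lam.
  apply: le_trans q5; apply: ler_wpM2r; first by rewrite exprn_ge0 // ltW.
  by rewrite ler_weXn2l.
have lam0 : 0 < lam by lra_of qq w22 w0.
have t0 : 0 < t by lra_of th lam0.
have cp : 0 < c - 1 by lra_of c1.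
have cg0 : 0 < (c - 1) * g by lra_of g10.
have g0 : 0 < g by rewrite -(pmulr_rgt0 _ cp).
have c0 : 0 < c by lra_of c1.
have cg : c * g <= 2 * w by apply: ler_pM => //; exact: ltW.
have Lw : jet_ell c 0 t <= 2 * w by exact: le_trans L2 cg.
have L0 : 0 <= jet_ell c 0 t by rewrite /jet_ell big_ord0 mulr1 mulr_ge0 ?powR_ge0 // ltW.
have k1 : k.+1%:R <= 14 * w :> R by rewrite -natr1; lra_of kw w100.
have kt : k.+1%:R / t <= 28 * w / lam.
  rewrite ler_pdivrMr // mulrAC ler_pdivlMr //.
  have -> : 28 * w * t = 14 * w * (2 * t) by ring.
  by apply: ler_pM => //; [exact: ltW | lra_of th].
have kt2 : 28 * w / lam <= 2^-1 by rewrite ler_pdivrMr //; lra_of qq w22 w0.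
have kt0 : 0 <= k.+1%:R / t by rewrite divr_ge0 // ltW.
set tau := 2 * jet_ell c 0 t * (k.+1%:R / t).
have tau_le : tau * w <= 1.
  have h1 : tau <= (4 * w) * (28 * w / lam).
    by apply: ler_pM => //; [rewrite mulr_ge0 | lra_of Lw].
  apply: (@le_trans _ _ ((4 * w) * (28 * w / lam) * w)); first by apply: ler_wpM2r => //; exact: ltW.
  have -> : 4 * w * (28 * w / lam) * w = (112 * w ^+ 3) / lam by ring.
  rewrite ler_pdivrMr // mul1r; apply: le_trans qq5.
  have -> : w ^+ 5 = w ^+ 2 * w ^+ 3 by rewrite -exprD.
  rewrite mulrA; apply: ler_wpM2r; first by rewrite exprn_ge0 // ltW.
  by lra_of w22 w100.
have tau0 : 0 <= tau by apply: mulr_ge0 => //; apply: mulr_ge0.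
have tau1 : tau <= 1.
  by apply: le_trans tau_le; rewrite ler_peMr //; lra_of w100.
split.
  have D2 : 2 <= (c - 1) * g / 2 by lra_of g10.
  have DL : (c - 1) * g / 2 <= jet_ell c 0 t - J%:R by lra_of L1 Jg g10.
  apply: (jet_lower c1 c2 t0 (le_trans kt kt2) tau1 _ D2 DL); first exact: leqW.
  rewrite -/tau; set x := 8 / _.
  have x0 : 0 <= x by rewrite divr_ge0 //; lra_of D2.
  have g70 : 70 <= g.
    have h : (c - 1) * g <= 7^-1 * g by apply: ler_wpM2r; [exact: ltW | lra_of c2'].
    by lra_of h g10.
  have h : (1 + x) ^+ J <= expR (32 / (c - 1)).
    apply: (@le_trans _ _ (expR x ^+ J)).
      by apply: lerXn2r; rewrite ?nnegrE ?expR_ge0 ?addr_ge0 // expR_ge1Dx.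
    rewrite -expRM_natl ler_expR.
    have -> : 32 / (c - 1) = (2 * g) * x by rewrite /x; field; rewrite !gt_eqF.
    by apply: ler_wpM2r => //; lra_of Jg g70.
  apply: le_trans tau_le; apply: ler_wpM2l => //.
  exact: le_trans h We.
move=> j jk; apply: le_trans (jet_upper c1 c2 t0 (le_trans kt kt2) tau1 jk) _.
rewrite expRM_natl; apply: lerXn2r; rewrite ?nnegrE ?expR_ge0 //.
  by rewrite !addr_ge0.
by apply: le_trans (expR_ge1Dx _); lra_of Lw k1 w100.
Qed.

Lemma exp_nat_bound (R : realType) (k : nat) : k%:R <= expR k%:R :> R.
Proof. by apply: le_trans (expR_ge1Dx _); rewrite lerDr. Qed.

Lemma fact_le_exp (R : realType) (J : nat) : J`!%:R <= expR (J%:R * J%:R) :> R.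
Proof.
elim: J => [|J IH]; first by rewrite mul0r expR0 fact0.
rewrite factS natrM -{1}natr1.
have -> : J.+1%:R * J.+1%:R = (J%:R + 1) + (J%:R * J%:R + J%:R) :> R by rewrite -natr1; ring.
rewrite expRD; apply: ler_pM => //; first by apply: le_trans (expR_ge1Dx _); lra.
by apply: le_trans IH _; rewrite ler_expR lerDl.
Qed.

Lemma h_deriv_size (R : realType) (c x th : R) j : 0 < x -> th != 0 ->
  `|th * h_deriv c j x| = expR (ln `|th| + ln x `^ c - j%:R * ln x) * `|jet c j 0 (ln x)|.
Proof.
move=> x0 th0; rewrite /h_deriv !normrM expRD expRD expRN expRM_natl !lnK ?posrE ?normr_gt0 //.
rewrite (ger0_norm (expR_ge0 _)) (ger0_norm (_ : 0 <= x ^- j)).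
  by rewrite /h !mulrA.
by rewrite invr_ge0 exprn_ge0 // ltW.
Qed.

Lemma expR_nat_pow (R : realType) (q : nat) : (2 ^ q)%:R = expR (q%:R * ln 2) :> R.
Proof. by rewrite natrX expRM_natl lnK // posrE. Qed.

Lemma two_le_e (R : realType) : 2 <= expR 1 :> R.
Proof. by apply: le_trans (expR_ge1Dx _); lra. Qed.

Lemma vino_size_le (R : realType) (k s : nat) : (0 < k)%N -> s = (k * (k + k ^ 2))%N ->
  s%:R <= expR (1 + 3 * k%:R) :> R.
Proof.
move=> k0 ->; rewrite expRD expRM_natl.
apply: (@le_trans _ _ (2 * k%:R ^+ 3)).
  rewrite -natrX -natrM ler_nat; apply: (@leq_trans (k * (k ^ 2 + k ^ 2)))%N.
    by rewrite leq_mul2l leq_add2r -mulnn leq_pmulr // orbT.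
  by rewrite addnn -muln2 mulnA -expnS mulnC.
apply: ler_pM; rewrite ?exprn_ge0 ?two_le_e //.
by apply: lerXn2r; rewrite ?nnegrE ?expR_ge0 //; exact: exp_nat_bound.
Qed.

(** The hypotheses say that |th| h(N) lies between N^(J - 5/2) and N^(J - 3/2),
    so that the J-th Taylor coefficient lies between N^(-5/2) and N^(-3/2), and
    that Q^J is about N^(11/8): this is the range in which the J-th factor of the
    bilinear bound is small. *)
Definition block_params {R : realType} (lam g v ltau : R) (q J : nat) : Prop :=
  [/\ (3 <= J)%N, (J%:R - 5 / 2) * lam <= ltau, ltau <= (J%:R - 3 / 2) * lam,
      ltau <= lam * g + v &
      q%:R * ln 2 * J%:R <= 11 / 8 * lam /\ 11 / 8 * lam - J%:R <= q%:R * ln 2 * J%:R].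

(** A point n of the main range, about which the sum over n + x y with
    x, y < 2^q will be estimated. *)
Definition block {R : realType} (c lam w v g th : R) (n q J : nat) : Prop :=
  [/\ 1 < c /\ c < 8 / 7, large c lam w v g, th != 0,
      block_params lam g v (ln `|th| + lam * g) q J &
      expR (lam - v) <= n%:R /\ n%:R + (2 ^ q)%:R ^+ 2 <= expR lam].

(** As Q^2 is at most N^(11/12), a Taylor remainder of this order gains N^(-J-1)
    over the size of th h. *)
Definition block_deg (J : nat) := (12 * J.+1)%N.

Definition block_coef {R : realType} (c th : R) (n j : nat) : R :=
  th * h_deriv c j.+1 n%:R / j.+1`!%:R.

Lemma block_facts (R : realType) (c lam w v g th : R) (n q J : nat) : block c lam w v g th n q J ->
  [/\ 100 <= w, 100 ^+ 4 * w ^+ 2 <= lam, 100 * v <= w /\ 1 <= v,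
   3 <= J%:R :> R /\ J%:R <= g + 3 & (block_deg J)%:R <= 13 * w /\ g <= w].
Proof.
move=> [_ lg _ bp _].
have [w100 q2 _ vw] := large_facts lg.
have [_ [_ [_ [v1 [_ [gw [g10 _]]]]]]] := lg.
have [J3 t1 _ t3 _] := bp.
have [w0 w22 qq] := large_sizes lg.
have lam0 : 0 < lam by lra_of qq w22 w0.
have Jg : J%:R <= g + 3.
  rewrite -(ler_pM2r lam0).
  have h : J%:R * lam = (J%:R - 5 / 2) * lam + 5 / 2 * lam by ring.
  have h2 : (g + 3) * lam = lam * g + 3 * lam by ring.
  by rewrite h h2; move: (lam * g) t1 t3 => X t1 t3; lra_of t1 t3 vw w22 qq w100 v1.
split=> //; first by split=> //; rewrite (ler_nat R 3).
split=> //; rewrite /block_deg natrM -natr1; lra_of Jg gw w100.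
Qed.

Lemma log_range (R : realType) (c lam w v g th : R) (n q J : nat) (x : R) : block c lam w v g th n q J ->
  n%:R <= x <= n%:R + (2 ^ q)%:R ^+ 2 -> 1 < x /\ lam - v <= ln x <= lam.
Proof.
move=> bl /andP[x1 x2]; have [w100 q2 [vw v1] _ _] := block_facts bl.
have [_ _ _ _ [n1 n2]] := bl.
have w22 : 100 * w <= w ^+ 2.
  by rewrite expr2; apply: ler_wpM2r => //; lra_of w100.
have qq : w ^+ 2 <= lam.
  apply: le_trans q2; rewrite ler_peMl ?exprn_ge0 ?exprn_ege1 ?ler1n //; lra_of w100.
have p0 : 0 < expR (lam - v) by apply: expR_gt0.
have ge : expR (lam - v) <= x by apply: le_trans x1.
have x0 : 0 < x by apply: lt_le_trans ge.
split.
  apply: lt_le_trans ge; rewrite -[ltLHS]expR0 ltr_expR subr_gt0.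
  by lra_of vw w22 qq w100 v1.
apply/andP; split; first by rewrite -ler_expR lnK.
by rewrite -ler_expR lnK // (le_trans x2).
Qed.

Lemma ln_block (R : realType) (c lam w v g th : R) (n q J : nat) : block c lam w v g th n q J ->
  1 < n%:R :> R /\ lam - v <= ln n%:R <= lam.
Proof. by move=> bl; apply: (log_range bl); rewrite lexx lerDl exprn_ge0. Qed.

(** Up to a factor exp(O(k w)) the remainder is |th| h(N) (Q^2 / N)^(k + 1), where
    |th| h(N) is below N^(J - 3/2); the choice of [block_deg] makes it negligible. *)
Lemma block_taylor (R : realType) (c lam w v g th : R) (n q J : nat) (z : nat) : block c lam w v g th n q J ->
  (z <= (2 ^ q) ^ 2)%N ->
  `|th * h c (n + z)%N%:R - (th * h c n%:R + \sum_(j < block_deg J) block_coef c th n j * z%:R ^+ j.+1)| <= expR (- lam).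
Proof.
move=> bl zQ; have [[c1 c2] lg th0 bp [n1 n2]] := bl; set k := block_deg J.
have c22 : c < 2 by lra_of c2.
have Jk : (J <= k)%N by rewrite /k /block_deg; lia.
set ltau := ln `|th| + lam * g in bp.
have zR : z%:R <= (2 ^ q)%:R ^+ 2 :> R by rewrite -natrX ler_nat.
have [w100 q2 [vw v1] [J3 Jg] [kw gw]] := block_facts bl.
have [_ t1 t2 t3 [l1 _]] := bp.
pose D j x := th * h_deriv c j x.
pose M := expR (ltau - k.+1%:R * (lam - v)) * expR (k.+1%:R * (100 * w)).
have := @taylor_bound R k D n%:R (n%:R + z%:R) M.
have -> : D 0%N (n%:R + z%:R) - \sum_(j < k.+1) D j n%:R / j`!%:R * (n%:R + z%:R - n%:R) ^+ j =
   th * h c (n + z)%N%:R - (th * h c n%:R + \sum_(j < k) block_coef c th n j * z%:R ^+ j.+1).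
  rewrite big_ord_recl /= expr0 mulr1 fact0 divr1 /D !h_deriv0 natrD; congr (_ - (_ + _)).
  apply: eq_bigr => j _; rewrite /bump /= add1n addrC addKr.
  by [].
have range x : n%:R <= x <= n%:R + z%:R -> 1 < x /\ lam - v <= ln x <= lam.
  by move=> /andP[h1 h2]; apply: (log_range bl); rewrite h1 (le_trans h2) // lerD2l.
move=> H; apply: le_trans (H _ _ _) _.
- by rewrite lerDl.
- move=> j x /range[x1 _]; have H0 := @is_derive_h_deriv R c j x x1.
  exact: is_deriveZ.
- move=> x /range[x1 lx]; have x0 : 0 < x by apply: lt_trans x1.
  rewrite /D h_deriv_size // /M; apply: ler_pM => //.
  + have [_ /andP[_ p2] _ _] := large_pow c1 c22 lg lx.
    move/andP: lx => [lx1 lx2]; rewrite ler_expR /ltau.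
    have h1 : k.+1%:R * (lam - v) <= k.+1%:R * ln x by apply: ler_wpM2l.
    by move: (k.+1%:R * (lam - v)) h1 => X h1; move: (lam * g) p2 => Y p2; lra_of h1 p2.
  + have [_ jb] := @jet_large R c lam w v g (ln x) J k c1 c2 lg lx Jg kw Jk.
    exact: jb.
have QE : (2 ^ q)%:R ^+ 2 = expR (2 * (q%:R * ln 2)) :> R by rewrite expR_nat_pow -expRM_natl.
apply: (@le_trans _ _ (M * expR (k.+1%:R * (2 * (q%:R * ln 2))))).
  apply: ler_wpM2l; first by rewrite mulr_ge0 ?expR_ge0.
  rewrite expRM_natl -QE; apply: lerXn2r; rewrite ?nnegrE ?exprn_ge0 //.
    by rewrite addrC addKr.
  by rewrite addrC addKr.
rewrite /M -!expRD ler_expR.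
set ell := q%:R * ln 2 in l1 *.
have ell0 : 0 <= ell by rewrite mulr_ge0 // ln_ge0 // ler1n.
have ell3 : 3 * ell <= 11 / 8 * lam.
  by apply: le_trans l1; rewrite mulrC ler_wpM2l.
have k1 : k.+1%:R = 12 * J%:R + 13 :> R by rewrite /k /block_deg -natr1 natrM -natr1; ring.
have -> : ltau - k.+1%:R * (lam - v) + k.+1%:R * (100 * w) + k.+1%:R * (2 * ell) =
   ltau - k.+1%:R * (lam - 2 * ell - v - 100 * w) by ring.
have w0 : 0 < w by lra_of w100.
have w22 : 100 * w <= w ^+ 2 by rewrite expr2; apply: ler_wpM2r => //; exact: ltW.
have qq : 100 * (100 * w ^+ 2) <= lam.
  apply: le_trans q2; rewrite mulrA -expr2; apply: ler_wpM2r; first by rewrite exprn_ge0 // ltW.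
  by rewrite ler_weXn2l ?ler1n.
have h1 : k.+1%:R * (lam / 12 - 101 * w) <= k.+1%:R * (lam - 2 * ell - v - 100 * w).
  by apply: ler_wpM2l => //; lra_of ell3 vw w0.
have k14 : k.+1%:R <= 14 * w by rewrite -natr1; lra_of kw w100.
have h2 : k.+1%:R * (101 * w) <= 14 * w * (101 * w).
  by apply: ler_wpM2r => //; rewrite mulr_ge0 // ltW.
have h3 : 14 * w * (101 * w) = 1414 * w ^+ 2 by ring.
have h4 : (J%:R + 1) * lam <= k.+1%:R * (lam / 12).
  have -> : k.+1%:R * (lam / 12) = (J%:R + 1) * lam + lam / 12 by rewrite k1; field.
  by rewrite lerDl divr_ge0 //; lra_of qq w22 w0.
have h5 : k.+1%:R * (lam / 12 - 101 * w) = k.+1%:R * (lam / 12) - k.+1%:R * (101 * w) by ring.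
have h6 : (J%:R + 1) * lam = (J%:R - 3 / 2) * lam + 5 / 2 * lam by field.
rewrite h3 in h2; rewrite h5 in h1; rewrite h6 in h4.
move: (k.+1%:R * (lam / 12)) (k.+1%:R * (101 * w)) (k.+1%:R * (lam - 2 * ell - v - 100 * w)) h1 h2 h4.
move: ((J%:R - 3 / 2) * lam) t2 => X t2 Y1 Y2 Y3 h1 h2 h4.
have lam0 : 0 <= lam by lra_of qq w22 w0.
by lra_of t2 h1 h2 h4 qq lam0 w22 w0.
Qed.

Lemma coef_exponent (R : realType) (c lam w v g th : R) (n q J : nat) : block c lam w v g th n q J ->
  forall A0, A0 = ln `|th| + ln n%:R `^ c - J%:R * ln n%:R ->
  - (5 / 2) * lam - 2 * w ^+ 2 <= A0 <= - (3 / 2) * lam + 2 * w ^+ 2.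
Proof.
move=> bl A0 A0E; have [[c1 c2] lg th0 bp [n1 n2]] := bl.
set ltau := ln `|th| + lam * g in bp.
have [w100 q2 [vw v1] [J3 Jg] [kw gw]] := block_facts bl.
have [_ lx] := ln_block bl; have [_ t1 t2 t3 _] := bp.
have c22 : c < 2 by lra_of c2.
have [_ /andP[p1 p2] _ _] := large_pow c1 c22 lg lx.
move/andP: lx => [x1 x2].
have w0 : 0 < w by lra_of w100.
have w22 : 100 * w <= w ^+ 2 by rewrite expr2; apply: ler_wpM2r => //; exact: ltW.
have [_ [_ [_ [_ [_ [_ [g10 _]]]]]]] := lg.
have cp : 0 < c - 1 by lra_of c1.
have cg0 : 0 < (c - 1) * g by lra_of g10.
have g0 : 0 < g by rewrite -(pmulr_rgt0 _ cp).
have v0 : 0 <= v by lra_of v1.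
have vw' : v <= w by lra_of vw v1.
have gv : g * v <= w ^+ 2 by rewrite expr2; apply: ler_pM => //; exact: ltW.
have Jv : J%:R * v <= 2 * w ^+ 2.
  have -> : 2 * w ^+ 2 = (2 * w) * w by ring.
  by apply: ler_pM => //; lra_of Jg gw w100.
have J0 : 0 <= J%:R :> R by [].
have u1 := ler_wpM2l J0 x1; have u2 := ler_wpM2l J0 x2.
have e1 : J%:R * (lam - v) = J%:R * lam - J%:R * v by ring.
have e2 : g * (lam - 2 * v) = lam * g - 2 * (g * v) by ring.
have e3 : (J%:R - 5 / 2) * lam = J%:R * lam - 5 / 2 * lam by ring.
have e4 : (J%:R - 3 / 2) * lam = J%:R * lam - 3 / 2 * lam by ring.
rewrite e1 in u1; rewrite e2 in p1; rewrite e3 /ltau in t1; rewrite e4 /ltau in t2.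
rewrite A0E; move: (J%:R * ln n%:R) (ln n%:R `^ c) (J%:R * lam) (lam * g) (J%:R * v) (g * v) (ln `|th|)
  u1 u2 p1 p2 t1 t2 gv Jv => X1 X2 X3 X4 X5 X6 X7 u1 u2 p1 p2 t1 t2 gv Jv.
by apply/andP; split; [lra_of u2 p1 t1 gv | lra_of u1 p2 t2 Jv].
Qed.

Lemma coef_bounds (R : realType) (c lam w v g th : R) (n q J : nat) : block c lam w v g th n q J ->
  forall A0, A0 = ln `|th| + ln n%:R `^ c - J%:R * ln n%:R ->
  expR (A0 - J%:R * J%:R) <= `|block_coef c th n J.-1| <= expR (A0 + J%:R * (100 * w)).
Proof.
move=> bl A0 A0E; have [[c1 c2] lg th0 bp [n1 n2]] := bl; set k := block_deg J.
have Jk : (J <= k)%N by rewrite /k /block_deg; lia.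
have Jk1 : (J <= k.+1)%N by exact: leqW.
have [_ _ _ [J3 Jg] [kw gw]] := block_facts bl; have [n0 lx] := ln_block bl.
have [jl ju] := @jet_large R c lam w v g (ln n%:R) J k c1 c2 lg lx Jg kw Jk.
have E : `|block_coef c th n J.-1| = expR A0 * (`|jet c J 0 (ln n%:R)| / J`!%:R).
  have J0S : J.-1.+1 = J by have [J3' _ _ _ _] := bp; rewrite prednK //; apply: leq_trans J3'.
  rewrite /block_coef J0S normrM h_deriv_size //; last exact: lt_trans n0.
  by rewrite A0E normfV (ger0_norm (ler0n _ _)) -mulrA.
have f1 : (1 : R) <= J`!%:R by rewrite ler1n fact_gt0.
have f0 : (0 : R) < J`!%:R by apply: lt_le_trans f1.
rewrite E !(expRD A0) expRN; apply/andP; split; apply: ler_wpM2l; rewrite ?expR_ge0 //.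
  rewrite ler_pdivlMr // mulrC.
  apply: (@le_trans _ _ 1).
    by rewrite ler_pdivrMr ?expR_gt0 // mul1r fact_le_exp.
  by apply: le_trans jl _; exact: ler_norm.
rewrite ler_pdivrMr //; apply: le_trans (ju J Jk1) _.
by rewrite ler_peMr ?expR_ge0.
Qed.

(** The root of order (2s)^2, where s is about k^3, may be taken because k^6 v is
    small compared to lam = w^7. *)
Lemma vino_power_le (R : realType) (k s : nat) (w v : R) : (0 < k)%N -> s = (k * (k + k ^ 2))%N ->
  k%:R <= 13 * w -> 0 <= v -> 100 ^+ 8 * v <= w ->
  (s.*2 * s.*2)%:R * v <= w ^+ 7 / 100 ^+ 4.
Proof.
move=> k0 sE kw v0 vw.
have w0 : 0 <= w by apply: le_trans vw; rewrite mulr_ge0 ?exprn_ge0.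
have m16 : (s.*2 * s.*2)%:R <= 16 * k%:R ^+ 6 :> R.
  have sk : (s <= 2 * k ^ 3)%N.
    rewrite sE; apply: (@leq_trans (k * (k ^ 2 + k ^ 2)))%N.
      by rewrite leq_mul2l leq_add2r -mulnn leq_pmulr // orbT.
    by rewrite addnn -muln2 mulnA -expnS mulnC.
  have sR : s%:R <= 2 * k%:R ^+ 3 :> R by rewrite -natrX -natrM ler_nat.
  rewrite natrM -mul2n natrM; have -> : 16 * k%:R ^+ 6 = 2 * (2 * k%:R ^+ 3) * (2 * (2 * k%:R ^+ 3)) :> R by ring.
  by apply: ler_pM; rewrite ?mulr_ge0 // ler_pM2l.
have kw6 : k%:R ^+ 6 <= (13 * w) ^+ 6 by apply: lerXn2r; rewrite ?nnegrE ?mulr_ge0.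
have w6 : 0 <= w ^+ 6 by rewrite exprn_ge0.
have m8 : (s.*2 * s.*2)%:R <= 100 ^+ 4 * w ^+ 6.
  by rewrite exprMn in kw6; move: (w ^+ 6) (k%:R ^+ 6) w6 kw6 m16 => X Y w6 kw6 m16; lra_of m16 kw6 w6.
rewrite ler_pdivlMr ?exprn_gt0 //.
apply: (@le_trans _ _ ((100 ^+ 4 * w ^+ 6) * v * 100 ^+ 4)).
  by apply: ler_wpM2r; rewrite ?exprn_ge0 // ler_wpM2r.
have -> : 100 ^+ 4 * w ^+ 6 * v * 100 ^+ 4 = w ^+ 6 * (100 ^+ 8 * v) by rewrite (exprD 100 4 4); ring.
by rewrite (exprSr w 6); apply: ler_wpM2l.
Qed.

Lemma vino_log_le (R : realType) (k : nat) (w : R) : k%:R <= 13 * w -> 1 <= w ->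
  (120 * k ^ 5)%:R <= 100 ^+ 4 * w ^+ 5 /\ 2 * k%:R * (3 + 3 * k%:R) <= 1100 * w ^+ 2.
Proof.
move=> kw w1; have w0 : 0 <= w by lra_of w1.
have k0 : 0 <= k%:R :> R by [].
split.
  have kw6 : k%:R ^+ 5 <= (13 * w) ^+ 5 by apply: lerXn2r; rewrite ?nnegrE ?mulr_ge0.
  have w6 : 0 <= w ^+ 5 by rewrite exprn_ge0.
  rewrite natrM natrX; rewrite exprMn in kw6.
  by move: (w ^+ 5) (k%:R ^+ 5) w6 kw6 => X Y w6 kw6; lra_of kw6 w6.
apply: (@le_trans _ _ ((26 * w) * (42 * w))).
  by apply: ler_pM; rewrite ?addr_ge0 ?mulr_ge0 //; lra_of kw w1.
have -> : 26 * w * (42 * w) = 1092 * w ^+ 2 by ring.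
by apply: ler_wpM2r; rewrite ?exprn_ge0 //; lra.
Qed.

(** The factor 1 / (b Q^J) is about N^(5/4 - 11/8) = N^(-1/8) at worst; the
    constant, whose logarithm is about k^5, and the defect of the mean value leave
    at least N^(-1/20) of this gain. *)
Lemma vino_factor_le (R : realType) (k s q J : nat) (w lam A : R) :
  (48 <= k)%N -> s = (k * (k + k ^ 2))%N -> lam = w ^+ 7 -> 100 ^+ 8 <= w ->
  k%:R <= 13 * w -> J%:R <= k%:R :> R ->
  q%:R * ln 2 <= lam / 2 -> 11 / 8 * lam - J%:R <= q%:R * ln 2 * J%:R ->
  - (5 / 2) * lam - 2 * w ^+ 2 <= A ->
  2 ^+ (120 * k ^ 5) * (3 * s)%:R ^+ k.*2 *
     2 `^ (2 * (q%:R * ((tri k)%:R * (1 - k%:R^-1) ^+ (k ^ 2)))) *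
     (7 / (expR ((A - J%:R * J%:R) / 2) * (2 ^ q)%:R ^+ J)) <= expR (- (lam / 20)).
Proof.
move=> k48 sE lamE W kw Jk ell2 ellJ Aq.
have k0 : (0 < k)%N by lia.
have w1 : 1 <= w by apply: le_trans W; rewrite exprn_ege1 // ler1n.
have w0 : 0 <= w by lra_of w1.
have [p1 p2] := vino_log_le kw w1.
have ln2le : ln 2 <= 1 :> R by rewrite -ler_expR lnK ?posrE // two_le_e.
have ln20 : 0 <= ln 2 :> R by rewrite ln_ge0 // ler1n.
set del := (tri k)%:R * _; have dle : del <= 100^-1 by exact: exponent_defect_le.
have d0 : 0 <= del.
  by apply: mulr_ge0 => //; apply: exprn_ge0; rewrite subr_ge0 invf_le1 ?ltr0n // ler1n.
have f1 : 2 ^+ (120 * k ^ 5) <= expR (100 ^+ 4 * w ^+ 5) :> R.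
  apply: (@le_trans _ _ (expR (120 * k ^ 5)%:R)); last by rewrite ler_expR.
  rewrite -[(120 * k ^ 5)%:R]mulr1 expRM_natl; apply: lerXn2r; rewrite ?nnegrE ?expR_ge0 //.
  exact: two_le_e.
have f2 : (3 * s)%:R ^+ k.*2 <= expR (1100 * w ^+ 2) :> R.
  apply: le_trans (_ : expR (2 * k%:R * (3 + 3 * k%:R)) <= _); last by rewrite ler_expR.
  have -> : 2 * k%:R = k.*2%:R :> R by rewrite -mul2n natrM.
  rewrite expRM_natl; apply: lerXn2r; rewrite ?nnegrE ?expR_ge0 //.
  have -> : 3 + 3 * k%:R = 2 + (1 + 3 * k%:R) :> R by ring.
  rewrite expRD natrM; apply: ler_pM => //; last exact: vino_size_le.
  by apply: le_trans (expR_ge1Dx _); lra.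
have f3 : 2 `^ (2 * (q%:R * del)) <= expR (lam / 100).
  rewrite /powR gt_eqF // ler_expR.
  have -> : 2 * (q%:R * del) * ln 2 = 2 * (q%:R * ln 2) * del by ring.
  by apply: ler_pM => //; [rewrite mulr_ge0 // mulr_ge0 | lra_of ell2].
have f4 : 7 / (expR ((A - J%:R * J%:R) / 2) * (2 ^ q)%:R ^+ J) <=
    expR (6 - (A - J%:R * J%:R) / 2 - q%:R * ln 2 * J%:R).
  rewrite expR_nat_pow -expRM_natl -expRD -expRN.
  have -> : 6 - (A - J%:R * J%:R) / 2 - q%:R * ln 2 * J%:R =
     6 - ((A - J%:R * J%:R) / 2 + J%:R * (q%:R * ln 2)) by ring.
  rewrite expRD; apply: ler_wpM2r; first exact: expR_ge0.
  by apply: le_trans (expR_ge1Dx _); lra.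
apply: (@le_trans _ _ (expR (100 ^+ 4 * w ^+ 5) * expR (1100 * w ^+ 2) * expR (lam / 100) *
   expR (6 - (A - J%:R * J%:R) / 2 - q%:R * ln 2 * J%:R))).
  have n2 : 0 <= 2 ^+ (120 * k ^ 5) :> R by rewrite exprn_ge0.
  have n3 : 0 <= (3 * s)%:R ^+ k.*2 :> R by rewrite exprn_ge0.
  have n4 : 0 <= 2 `^ (2 * (q%:R * del)) by exact: powR_ge0.
  have n5 : 0 <= 7 / (expR ((A - J%:R * J%:R) / 2) * (2 ^ q)%:R ^+ J).
    by rewrite divr_ge0 // mulr_ge0 ?expR_ge0 ?exprn_ge0.
  have g1 := ler_pM n2 n3 f1 f2.
  have g2 := ler_pM (mulr_ge0 n2 n3) n4 g1 f3.
  exact: ler_pM (mulr_ge0 (mulr_ge0 n2 n3) n4) n5 g2 f4.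
rewrite -!expRD ler_expR.
have J13 : J%:R <= 13 * w by apply: le_trans kw.
have JJ : J%:R * J%:R <= 13 * w * (13 * w) by apply: ler_pM.
have JJ' : 13 * w * (13 * w) = 169 * w ^+ 2 by ring.
rewrite JJ' in JJ.
have w2 : w <= w ^+ 2 by rewrite expr2; apply: one_le_nat_mul.
have w25 : w ^+ 2 <= w ^+ 5 by rewrite ler_weXn2l.
have w57 : 100 ^+ 7 * w ^+ 5 <= lam.
  rewrite lamE (exprD w 2 5); apply: ler_wpM2r; first exact: exprn_ge0.
  apply: le_trans w2; apply: le_trans W.
  by rewrite ler_weXn2l // ler1n.
move: (w ^+ 2) (w ^+ 5) (J%:R * J%:R) (q%:R * ln 2 * J%:R) w57 w25 w2 JJ ellJ Aq
  => X Y Z T w57 w25 w2 JJ ellJ Aq.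
by lra_of w57 w25 w2 JJ ellJ Aq J13 w1.
Qed.

Lemma cnorm_root_le (R : realType) (S : R[i]) (X F v : R) (m : nat) : (0 < m)%N -> 0 <= X ->
  cnorm S ^+ m <= X ^+ m * F -> F <= expR (- (m%:R * v)) -> cnorm S <= X * expR (- v).
Proof.
move=> m0 X0 SF Fv.
rewrite -(@ler_pXn2r _ m) ?nnegrE ?cnorm_ge0 ?mulr_ge0 ?expR_ge0 //.
apply: le_trans SF _; rewrite exprMn; apply: ler_wpM2l; first exact: exprn_ge0.
by apply: le_trans Fv _; rewrite -expRM_natl mulrN.
Qed.

Lemma block_sum (R : realType) (c lam w v g th : R) (n q J : nat) : block c lam w v g th n q J ->
  cnorm (\sum_(y < 2 ^ q) \sum_(x < 2 ^ q) e (th * h c (n + x * y)%N%:R)) <=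
    (2 ^ q)%:R ^+ 2 * (expR (- v) + 16 * expR (- lam)).
Proof.
move=> bl; have [w100 q2 [vw v1] [J3 Jg] [kw gw]] := block_facts bl.
have [[c1 c2] lg th0 [J3n t1 t2 t3 [l1 l2]] _] := bl.
have [lamE [W [_ [_ [vw8 _]]]]] := lg.
have H0 := @poly_phase_approx R (fun m => th * h c m%:R) (th * h c n%:R) (expR (- lam))
  (block_deg J) (fun j => block_coef c th n j) n (2 ^ q) (fun z => block_taylor bl (z := z)).
apply: le_trans H0 _.
rewrite mulrDr; apply: lerD; last by [].
set k := block_deg J in kw *.
have k48 : (48 <= k)%N by rewrite /k /block_deg; clear -J3n; lia.
have k0 : (0 < k)%N by apply: leq_trans k48.
have Jk : (J.-1 < k)%N by rewrite /k /block_deg; clear; lia.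
have JkR : J%:R <= k%:R :> R by rewrite ler_nat /k /block_deg; clear; lia.
have J0S : J.-1.+1 = J by rewrite prednK //; apply: leq_trans J3n.
pose s := (k * (k + k ^ 2))%N.
have s0 : (0 < s)%N by rewrite muln_gt0 k0 addn_gt0 k0.
pose j0 : 'I_k := Ordinal Jk.
pose A0 := ln `|th| + ln n%:R `^ c - J%:R * ln n%:R.
have /andP[A1 A2] := @coef_exponent R c lam w v g th n q J bl A0 erefl.
have /andP[a1 a2] := @coef_bounds R c lam w v g th n q J bl A0 erefl.
have w0 : 0 < w by lra_of w100.
have w22 : 100 * w <= w ^+ 2 by rewrite expr2; apply: ler_wpM2r => //; exact: ltW.
have w2l : 100 ^+ 3 * w ^+ 2 <= lam.
  apply: le_trans q2; apply: ler_wpM2r; first by rewrite exprn_ge0 // ltW.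
  by rewrite ler_weXn2l // ler1n.
have J2w : J%:R <= 2 * w by lra_of Jg gw w100.
have JJ : J%:R * J%:R <= 2 * w * (2 * w) by apply: ler_pM.
have Jw : J%:R * (100 * w) <= 2 * w * (100 * w).
  by apply: ler_wpM2r => //; rewrite mulr_ge0 // ltW.
have e4 : 2 * w * (2 * w) = 4 * w ^+ 2 by ring.
have e5 : 2 * w * (100 * w) = 200 * w ^+ 2 by ring.
rewrite e4 in JJ; rewrite e5 in Jw.
have JJ0 : 0 <= J%:R * J%:R :> R by rewrite mulr_ge0.
pose b := expR ((A0 - J%:R * J%:R) / 2).
have b2 : b ^+ 2 = expR (A0 - J%:R * J%:R).
  by rewrite -expRM_natl; congr expR; field.
have b01 : 0 < b <= 1.
  rewrite expR_gt0 /= -[leRHS]expR0 ler_expR.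
  by move: (w ^+ 2) (J%:R * J%:R) w2l w22 JJ0 A2 => X Y w2l w22 JJ0 A2; lra_of w2l w22 JJ0 A2 w0.
have bal : b ^+ 2 <= `|block_coef c th n j0| by rewrite b2.
have half : `|block_coef c th n j0| * (s * (2 ^ q) ^ j0.+1)%:R <= 2^-1.
  rewrite /= J0S natrM natrX.
  apply: (@le_trans _ _ (expR (A0 + J%:R * (100 * w)) * (expR (1 + 3 * k%:R) * expR (J%:R * (q%:R * ln 2))))).
    apply: ler_pM => //; apply: ler_pM => //.
    - exact: vino_size_le.
    - by rewrite expR_nat_pow -expRM_natl.
  rewrite -!expRD; apply: (@le_trans _ _ (expR (- 1))).
    rewrite ler_expR [J%:R * (q%:R * _)]mulrC.
    move: (w ^+ 2) (J%:R * (100 * w)) (q%:R * ln 2 * J%:R) w2l w22 Jw l1 A2 => X Y Z w2l w22 Jw l1 A2.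
    by lra_of w2l w22 Jw l1 A2 w0 kw w100.
  by rewrite expRN lef_pV2 ?posrE ?expR_gt0 // two_le_e.
have H := @vino_block R k s q (fun j => block_coef c th n j) j0 b k0 erefl b01 bal half.
apply: (@cnorm_root_le R _ _ _ _ (s.*2 * s.*2)); last first.
- apply: le_trans (_ : expR (- (lam / 20)) <= _); last first.
    rewrite ler_expR lerN2.
    have v0 : 0 <= v by lra_of v1.
    apply: le_trans (@vino_power_le R k s w v k0 erefl kw v0 vw8) _.
    rewrite -lamE; apply: ler_wpM2l; first by rewrite lamE exprn_ge0 // ltW.
    by rewrite lef_pV2 ?posrE ?exprn_gt0 //; lra.
  have ell2 : q%:R * ln 2 <= lam / 2.
    have ln20 : 0 <= q%:R * ln 2 :> R by rewrite mulr_ge0 // ln_ge0 // ler1n.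
    have h3 : q%:R * ln 2 * 3 <= q%:R * ln 2 * J%:R :> R by apply: ler_wpM2l.
    move: (w ^+ 2) w2l w22 => X w2l w22.
    by lra_of h3 l1 w2l w22 w0.
  exact: (@vino_factor_le R k s q J w lam A0 k48 erefl lamE W kw JkR ell2 l2 A1).
- by move: H; rewrite /= J0S.
- by rewrite exprn_ge0.
- by rewrite muln_gt0 !double_gt0 s0.
Qed.

Lemma block_params_exist (R : realType) (lam g v ltau : R) : 0 < lam -> lam / 2 <= ltau ->
  ltau <= lam * g + v -> exists q J, block_params lam g v ltau q J.
Proof.
move=> lam0 t1 t2; pose x := ltau / lam + 3 / 2.
have x2 : 2 <= x.
  have h : 2^-1 <= ltau / lam by rewrite ler_pdivlMr // mulrC.
  by rewrite /x; lra_of h.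
have x0 : 0 <= x by lra_of x2.
have /andP[a1 a2] := truncn_itv x0.
have k2 : (2 <= Num.truncn x)%N by rewrite truncn_ge_nat.
pose J := (Num.truncn x).+1.
have JR : J%:R = (Num.truncn x)%:R + 1 :> R by rewrite /J -natr1.
have J0 : 0 < J%:R :> R by [].
have ln20 : 0 < ln 2 :> R by rewrite ln_gt0 // ltr1n.
have ln21 : ln 2 <= 1 :> R by rewrite -ler_expR lnK ?posrE // two_le_e.
pose y := 11 / 8 * lam / (ln 2 * J%:R).
have LJ : 0 < ln 2 * J%:R :> R by rewrite mulr_gt0.
have y0 : 0 <= y by rewrite divr_ge0 ?mulr_ge0 // ltW.
have /andP[b1 b2] := truncn_itv y0.
have tx : ltau = (x - 3 / 2) * lam by rewrite /x addrK divfK // gt_eqF.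
exists (Num.truncn y), J; split=> //.
- by rewrite tx; apply: ler_wpM2r; [exact: ltW | rewrite JR; lra_of a1].
- rewrite tx; apply: ler_wpM2r; [exact: ltW | rewrite JR; move: a2; rewrite -natr1 => a2; lra_of a2].
rewrite -[(Num.truncn y)%:R * ln 2 * J%:R]mulrA; split.
  by rewrite -ler_pdivlMr.
have h : 11 / 8 * lam <= (Num.truncn y).+1%:R * (ln 2 * J%:R).
  by rewrite -ler_pdivrMr // ltW.
rewrite -natr1 mulrDl mul1r in h.
have h2 : ln 2 * J%:R <= J%:R :> R by rewrite ler_piMl.
by lra_of h h2.
Qed.

Lemma norm_sum_le_size (R : realType) (f : nat -> R) a b :
  cnorm (\sum_(a <= n < b) e (f n)) <= (b - a)%:R.
Proof.
apply: le_trans (cnorm_sum _ _ _) _.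
by under eq_bigr do rewrite cnorm_e; rewrite sumr_const_nat.
Qed.

(** The terms n < N exp(-v), about which the Taylor expansion is not accurate on
    intervals of length Q^2, and the last Q^2 terms are estimated trivially. *)
Lemma h_exp_sum (R : realType) (c lam w v g th : R) (N : nat) :
  1 < c -> c < 8 / 7 -> large c lam w v g -> N%:R = expR lam -> th != 0 ->
  lam / 2 <= ln `|th| + lam * g -> ln `|th| <= v ->
  cnorm (\sum_(n < N) e (th * h c n.+1%:R)) <= 6 * (N%:R * expR (- v)).
Proof.
move=> c1 c2 lg NE th0 t1 t2.
have [w100 q2 _ vw] := large_facts lg.
have [_ [_ [_ [v1 _]]]] := lg.
have [w0 w22 qq] := large_sizes lg.
have lam0 : 0 < lam by lra_of qq w22 w0.
have lamv : 12 * v + 200 <= lam by lra_of qq w22 w100 vw.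
have [|q [J bp]] := block_params_exist lam0 t1 (g := g) (v := v).
  by rewrite addrC lerD2l.
pose Q := (2 ^ q)%N.
have Q0 : (0 < Q)%N by rewrite expn_gt0.
pose U := N%:R * expR (- v).
have UE : U = expR (lam - v) by rewrite /U NE expRD.
have QQ4 : 4 * (Q%:R ^+ 2 : R) <= U.
  rewrite UE /Q expR_nat_pow -expRM_natl.
  apply: (@le_trans _ _ (expR 4 * expR (2 * (q%:R * ln 2)))).
    by apply: ler_wpM2r; [exact: expR_ge0 | apply: le_trans (expR_ge1Dx _); lra].
  rewrite -expRD ler_expR.
  have [J3 _ _ _ [l1 _]] := bp.
  have ln20 : 0 <= q%:R * ln 2 :> R by rewrite mulr_ge0 // ln_ge0 // ler1n.
  have h3 : q%:R * ln 2 * 3 <= q%:R * ln 2 * J%:R :> R.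
    by apply: ler_wpM2l => //; rewrite (ler_nat R 3).
  by lra_of h3 l1 lamv v1.
have U17 : 17 <= U.
  by rewrite UE; apply: le_trans (expR_ge1Dx _); lra_of lamv v1.
have U2 : 2 * U <= N%:R.
  rewrite NE -[X in expR X](subrK v) expRD -UE mulrC; apply: ler_wpM2l; first by lra_of U17.
  by apply: le_trans (expR_ge1Dx _); lra_of v1.
have Q20 : 0 <= (Q%:R ^+ 2 : R) by rewrite exprn_ge0.
have QQ : (Q%:R ^+ 2 : R) <= U by lra_of QQ4 Q20.
pose n1 := (Num.truncn U).+1.
have U0 : 0 <= U by lra_of U17.
have /andP[b1 b2] := truncn_itv U0.
have n1R : n1%:R <= U + 1 by rewrite /n1 -natr1 lerD2r.
have QN : (Q ^ 2 <= N)%N by rewrite -(ler_nat R) natrX; lra_of QQ U2 U0.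
pose n2 := (N - Q ^ 2)%N.
have n2R : n2%:R = N%:R - Q%:R ^+ 2 :> R by rewrite natrB // natrX.
have n12 : (n1 <= n2)%N by rewrite -(ler_nat R) n2R; lra_of n1R QQ4 U2 U17.
have n2N : (n2 <= N.+1)%N by rewrite /n2; apply: leq_trans (leq_subr _ _) _.
have -> : \sum_(n < N) e (th * h c n.+1%:R) = \sum_(1 <= n < N.+1) e (th * h c n%:R).
  by rewrite big_add1 big_mkord.
rewrite (big_cat_nat _ (n := n2)) //=; last by apply: leq_trans n12.
rewrite (big_cat_nat _ (n := n1)) //=.
apply: le_trans (cnormD _ _) _.
have p3 := norm_sum_le_size (fun n => th * h c n%:R) n2 N.+1.
have p1 := norm_sum_le_size (fun n => th * h c n%:R) 1 n1.
have p2 : cnorm (\sum_(n1 <= n < n2) e (th * h c n%:R)) <= 2 * Q%:R ^+ 2 +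
   (n2 - n1)%:R * ((Q%:R ^+ 2 * (expR (- v) + 16 * expR (- lam))) / Q%:R ^+ 2).
  apply: (@weyl_shift R (fun n => th * h c n%:R)) => // n /andP[h1 h2].
  apply: (@block_sum R c lam w v g th n q J); split=> //; split.
    rewrite -UE; apply: ltW; apply: lt_le_trans b2 _; by rewrite ler_nat.
  rewrite -NE; have h3 : n%:R <= n2%:R :> R by rewrite ler_nat ltnW.
  by rewrite n2R in h3; lra_of h3.
have p1' : (n1 - 1)%:R <= U by rewrite /n1 subn1.
have p3' : (N.+1 - n2)%:R <= U + 1.
  by rewrite natrB // n2R -natr1; lra_of QQ.
rewrite mulrAC mulfV ?mul1r in p2; last by rewrite expf_eq0 /= pnatr_eq0 -lt0n.
have p2' : (n2 - n1)%:R * (expR (- v) + 16 * expR (- lam)) <= U + 16.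
  apply: (@le_trans _ _ (N%:R * (expR (- v) + 16 * expR (- lam)))).
    apply: ler_wpM2r; first by rewrite addr_ge0 ?mulr_ge0 ?expR_ge0.
    by rewrite ler_nat (leq_trans (leq_subr _ _)) // leq_subr.
  rewrite mulrDr -/U; apply: lerD => //.
  by rewrite mulrCA NE -expRD subrr expR0 mulr1.
apply: le_trans (lerD (cnormD _ _) (lexx _)) _.
rewrite -/U.
by lra_of p1 p2 p3 p1' p2' p3' QQ U17.
Qed.

Lemma le_powR_of_root (R : realType) (A b x : R) : 0 <= A -> 0 < b -> A `^ b^-1 <= x -> A <= x `^ b.
Proof.
move=> A0 b0 h; rewrite -[A]powRr1 // -(mulVf (lt0r_neq0 b0)) powRrM.
by apply: ge0_ler_powR => //; rewrite ?nnegrE ?powR_ge0 ?(le_trans (powR_ge0 _ _) h) // ltW.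
Qed.

Lemma large_eventually (R : realType) (c : R) : 1 < c -> c < 8 / 7 ->
  exists2 L0 : R, 1 <= L0 & forall lam, L0 <= lam ->
    large c lam (lam `^ 7^-1) (lam `^ 8^-1) (lam `^ (c - 1)).
Proof.
move=> c1 c2; have cp : 0 < c - 1 by lra_of c1.
pose a1 : R := (100 ^+ 8) `^ (7^-1)^-1.
pose a2 : R := expR (32 / (c - 1)) `^ (7^-1)^-1.
pose a3 : R := (100 ^+ 8) `^ (7^-1 - 8^-1)^-1.
pose a4 : R := (10 / (c - 1)) `^ (c - 1)^-1.
have [z1 z2 z3 z4] : [/\ 0 <= a1, 0 <= a2, 0 <= a3 & 0 <= a4] by split; exact: powR_ge0.
have d0 : 0 < 7^-1 - 8^-1 :> R by lra.
exists (1 + a1 + a2 + a3 + a4); first by lra_of z1 z2 z3 z4.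
move=> lam L.
have l1 : 1 <= lam by lra_of z1 z2 z3 z4 L.
have [L1 L2 L3 L4] : [/\ a1 <= lam, a2 <= lam, a3 <= lam & a4 <= lam].
  by split; lra_of z1 z2 z3 z4 L.
have lam0 : 0 < lam by lra_of l1.
have e0 : 0 <= (100 : R) ^+ 8 by rewrite exprn_ge0.
have v1 : 1 <= lam `^ 8^-1 by rewrite -[leLHS](powRr0 lam) ler_powR ?invr_ge0.
have vl : lam `^ 8^-1 <= lam.
  by rewrite -[leRHS]powRr1 ?(ltW lam0) // ler_powR //; lra.
split; first by rewrite -powR_mulrn ?powR_ge0 // -powRrM mulVf ?pnatr_eq0 // powRr1 // ltW.
split; first by apply: le_powR_of_root => //; exact: L1.
split; first by apply: le_powR_of_root; rewrite ?expR_ge0 //; exact: L2.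
split=> //; split.
  have h : 100 ^+ 8 <= lam `^ (7^-1 - 8^-1).
    by apply: le_powR_of_root => //; exact: L3.
  have -> : lam `^ 7^-1 = lam `^ (7^-1 - 8^-1) * lam `^ 8^-1.
    by rewrite -powRD ?subrK // (gt_eqF lam0) implybT.
  by apply: ler_wpM2r => //; exact: powR_ge0.
split; first by apply: ler_powR => //; lra_of c2.
split.
  rewrite mulrC -ler_pdivrMr //; apply: le_powR_of_root => //.
  by rewrite divr_ge0 // ltW.
move=> t /andP[t1 t2]; have t0 : 0 <= t by lra_of t1 vl.
apply/andP; split; last by apply: ge0_ler_powR; rewrite ?nnegrE //; exact: ltW.
have tE : t = lam * (t / lam) by rewrite mulrCA mulfV ?mulr1 // gt_eqF.
have y0 : 0 <= t / lam by rewrite divr_ge0 // ltW.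
rewrite [in leRHS]tE powRM // ?(ltW lam0) //; apply: ler_wpM2l; first exact: powR_ge0.
have h1 : 1 - (lam `^ 8^-1) / lam <= t / lam.
  rewrite ler_pdivlMr // mulrBl divfK ?mul1r // gt_eqF //.
apply: le_trans h1 _.
have [->|y1] := eqVneq (t / lam) 0; first exact: powR_ge0.
rewrite -[leLHS]powRr1 //; apply: ger_powR; last by lra_of c2.
by rewrite lt_def y1 y0 /= ler_pdivrMr // mul1r.
Qed.

(** * The exponential sum over the integer parts of h(n) *)

Lemma expR_thirds (R : realType) (v : R) : 
  expR v = expR (v / 6) ^+ 6 /\ expR (v / 2) = expR (v / 6) ^+ 3.
Proof. by split; rewrite -expRM_natl; congr expR; field. Qed.

(** With K of the order of exp(v / 6), the frequencies j + xi needed are at most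
    exp(v / 2), and they are at least 1/2 except for j = 0. *)
Lemma floor_exp_sum (R : realType) (c lam w v g xi : R) (N : nat) :
  1 < c -> c < 8 / 7 -> large c lam w v g -> N%:R = expR lam -> 400 <= v ->
  xi != 0 -> `|xi| <= 2^-1 -> lam / 2 <= ln `|xi| + lam * g ->
  cnorm (\sum_(n < N) e ((Num.floor (h c n.+1%:R))%:~R * xi)) <= 630 * (N%:R * expR (- (v / 6))).
Proof.
move=> c1 c2 lg NE v400 xi0 xi2 t1.
have [w100 q2 _ vw] := large_facts lg.
have [_ [_ [_ [_ [_ [_ [g10 _]]]]]]] := lg.
have cp : 0 < c - 1 by lra_of c1.
have cg0 : 0 < (c - 1) * g by lra_of g10.
have g0 : 0 < g by rewrite -(pmulr_rgt0 _ cp).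
have g70 : 70 <= g.
  have h : (c - 1) * g <= 7^-1 * g by apply: ler_wpM2r; [exact: ltW | lra_of c2].
  by lra_of h g10.
have lam1 : 1 <= lam.
  apply: le_trans q2; rewrite -[leLHS]mulr1; apply: ler_pM => //.
    by rewrite exprn_ege1 // ler1n.
  by rewrite exprn_ege1 //; lra_of w100.
pose u := expR (v / 6).
have [E6 E3] := expR_thirds v; rewrite -/u in E6 E3.
have u64 : 64 <= u by apply: le_trans (expR_ge1Dx _); lra_of v400.
have u0 : 0 < u by lra_of u64.
pose y := u / 32.
have y0 : 0 <= y by rewrite divr_ge0 // ltW.
have /andP[b1 b2] := truncn_itv y0.
pose K := Num.truncn y.
have KR : u / 64 <= K%:R.
  rewrite -natr1 in b2; have h2 : 2 <= y by rewrite ler_pdivlMr //; lra_of u64.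
  have y2 : u / 64 = y / 2 by rewrite /y; field.
  by rewrite /K y2; lra_of b2 h2.
have KR0 : 0 < K%:R :> R by lra_of KR u64.
have K0 : (0 < K)%N by rewrite -(ltr0n R).
have K32 : 32 * K%:R <= u by rewrite mulrC -ler_pdivlMr.
have L3 : ((32 * K) ^ 3)%:R <= u ^+ 3.
  by rewrite natrX natrM; apply: lerXn2r; rewrite ?nnegrE ?mulr_ge0 // ltW.
have u36 : u ^+ 3 <= u ^+ 6 by rewrite ler_weXn2l //; lra_of u64.
pose eps := 6 * expR (- v).
have eps0 : 0 <= eps by rewrite mulr_ge0 ?expR_ge0.
have main th : th != 0 -> lam / 2 <= ln `|th| + lam * g -> `|th| <= u ^+ 3 ->
  cnorm (\sum_(n < N) e (th * h c n.+1%:R)) <= eps * N%:R.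
  move=> th0 h1 h2; rewrite /eps -mulrA [expR _ * _]mulrC; apply: (h_exp_sum c1 c2 lg) => //.
  by rewrite -ler_expR lnK ?posrE ?normr_gt0 // E6 (le_trans h2).
have big th : 2^-1 <= `|th| -> lam / 2 <= ln `|th| + lam * g.
  move=> h2; have h3 : - 1 <= ln `|th|.
    rewrite -ler_expR lnK ?posrE; last by apply: lt_le_trans h2.
    by apply: le_trans h2; rewrite expRN lef_pV2 ?posrE ?expR_gt0 // two_le_e.
  have h4 : lam * 70 <= lam * g by apply: ler_wpM2l => //; lra_of lam1.
  by lra_of h3 h4 lam1.
have int1 (j : int) : j != 0 -> 1 <= `|j%:~R : R|.
  by move=> j0; rewrite -intr_norm ler1z -gtz0_ge1 normr_gt0.
apply: le_trans (@floor_sum_bound R N K (fun n => h c n.+1%:R) xi eps K0 xi2 eps0 _ _) _.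
- move=> j jL; have [->|j0] := eqVneq j 0.
    by rewrite add0r; apply: main => //; apply: le_trans xi2 _; rewrite (@le_trans _ _ 1) // ?exprn_ege1 //; lra_of u64.
  have j1 := int1 j j0.
  have jx : 2^-1 <= `|j%:~R + xi|.
    have h := ler_normB (j%:~R + xi) xi; rewrite addrK in h.
    by lra_of h xi2 j1.
  apply: main; [by rewrite -normr_gt0; lra_of jx | exact: big |].
  apply: le_trans (ler_normD _ _) _; apply: le_trans L3.
  rewrite -intr_norm -abszE -pmulrn.
  have h5 : (absz j).+1%:R <= ((32 * K) ^ 3)%:R :> R by rewrite ler_nat.
  by rewrite -natr1 in h5; lra_of h5 xi2.
- move=> j j0 jK; have j1 := int1 j j0.
  apply: main; [by rewrite -normr_gt0; lra_of j1 | apply: big; lra_of j1 |].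
  rewrite -intr_norm -abszE -pmulrn.
  have h5 : (absz j)%:R <= K%:R :> R by rewrite ler_nat ltnW.
  apply: le_trans h5 _; apply: (@le_trans _ _ u); first by lra_of K32 KR0.
  by rewrite -[leLHS]expr1 ler_weXn2l //; lra_of u64.
rewrite [leRHS]mulrCA; apply: ler_wpM2l => //.
rewrite expRN -/u.
have h9 : 9 / K%:R <= 576 * u^-1.
  rewrite ler_pdivrMr // mulrAC ler_pdivlMr //; lra_of KR.
have h10 : (8 + ((32 * K) ^ 3)%:R) * eps <= 54 * u^-1.
  apply: (@le_trans _ _ ((9 * u ^+ 3) * eps)).
    apply: ler_wpM2r => //; have : 1 <= u ^+ 3 by rewrite exprn_ege1 //; lra_of u64.
    by move=> h; lra_of h L3.
  rewrite /eps expRN E6.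
  have -> : 9 * u ^+ 3 * (6 * u ^- 6) = 54 * u ^- 3 by field; rewrite gt_eqF.
  apply: ler_wpM2l => //; rewrite lef_pV2 ?posrE ?exprn_gt0 //.
  by rewrite -[leLHS]expr1 ler_weXn2l //; lra_of u64.
by lra_of h9 h10.
Qed.

(** * The derivative of phi and its sums *)

Lemma inv_exponent (R : realType) (c : R) : 1 < c -> 0 < c^-1 <= 1.
Proof. by move=> c1; rewrite invr_gt0 (lt_trans ltr01) //= invf_le1 ?(lt_trans ltr01) // ltW. Qed.

Definition phi' {R : realType} (c x : R) : R := derive1 (phi c) x.

Lemma is_derive_phi (R : realType) (c x : R) : 1 < x -> is_derive x 1 (phi c) (phi' c x).
Proof.
(* phi is h for the exponent 1/c *)
move=> x1; have H : is_derive x 1 (phi c) _ := @is_derive_h R c^-1 x x1.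
by rewrite /phi' derive1E derive_val.
Qed.

Lemma phi'E (R : realType) (c x : R) : 1 < x ->
  phi' c x = expR (ln x `^ c^-1 - ln x) * (c^-1 * ln x `^ (c^-1 - 1)).
Proof.
move=> x1; have H : is_derive x 1 (phi c) _ := @is_derive_h R c^-1 x x1.
rewrite /phi' derive1E derive_val /jet_ell big_ord0 mulr1 subr0 /h expRB lnK //.
by rewrite posrE (lt_trans ltr01).
Qed.

Lemma phi'_ge0 (R : realType) (c x : R) : 0 < c -> 1 < x -> 0 <= phi' c x.
Proof.
by move=> c0 x1; rewrite phi'E // mulr_ge0 ?expR_ge0 // mulr_ge0 ?powR_ge0 // invr_ge0 ltW.
Qed.

Lemma ln4_ge1 (R : realType) : 1 <= ln 4 :> R.
Proof.
rewrite -ler_expR lnK ?posrE //.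
have -> : expR 1 = expR 2^-1 ^+ 2 :> R by rewrite -expRM_natl mulfV.
have -> : (4 : R) = 2 ^+ 2 by ring.
apply: lerXn2r; rewrite ?nnegrE ?expR_ge0 //.
rewrite -[expR _]invrK -expRN -[leRHS]invrK lef_pV2 ?posrE ?expR_gt0 ?invr_gt0 //.
by apply: le_trans (expR_ge1Dx _); lra.
Qed.

Lemma ln_ge1 (R : realType) (x : R) : 4 <= x -> 1 <= ln x.
Proof. by move=> x4; apply: le_trans (ln4_ge1 R) _; rewrite ler_ln ?posrE // (lt_le_trans _ x4). Qed.

(** Both factors of phi' decrease beyond the point where ln x = 1. *)
Lemma phi'_decr (R : realType) (c x y : R) : 1 < c -> 4 <= x -> x <= y -> phi' c y <= phi' c x.
Proof.
move=> /inv_exponent/andP[a0 a1].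
move=> x4 xy; have x0 : 0 < x by apply: lt_le_trans x4.
have u1 := ln_ge1 x4.
have uv : ln x <= ln y by rewrite ler_ln ?posrE // (lt_le_trans x0).
rewrite !phi'E //; [|by apply: lt_le_trans x4; rewrite ltr1n|by apply: lt_le_trans xy; apply: lt_le_trans x4; rewrite ltr1n].
move: (c^-1) (ln x) (ln y) a0 a1 u1 uv => a u v a0 a1 u1 uv.
have u0 : 0 < u by apply: lt_le_trans u1.
have v0 : 0 < v by apply: lt_le_trans uv.
apply: ler_pM; rewrite ?expR_ge0 ?mulr_ge0 ?powR_ge0 ?(ltW a0) //; last first.
  apply: ler_wpM2l; first exact: ltW.
  have -> : a - 1 = - (1 - a) by rewrite opprB.
  rewrite !powRN lef_pV2 ?posrE ?powR_gt0 //.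
  by apply: ge0_ler_powR; rewrite ?nnegrE ?subr_ge0 // ltW.
rewrite ler_expR.
have vE : v = u * (v / u) by rewrite mulrCA mulfV ?mulr1 // gt_eqF.
have t1 : 1 <= v / u by rewrite ler_pdivlMr // mul1r.
have t0 : 0 <= v / u by apply: le_trans t1.
have h1 : (v / u) `^ a <= v / u by rewrite -[leRHS]powRr1 // ler_powR.
have h2 : u `^ a <= u by rewrite -[leRHS]powRr1 ?(ltW u0) // ler_powR.
have h3 : 1 <= (v / u) `^ a by rewrite -[leLHS](powRr0 (v / u)) ler_powR // ltW.
have h4 : v `^ a = u `^ a * (v / u) `^ a by rewrite -powRM ?(ltW u0) // -vE.
have h5 : u `^ a * ((v / u) `^ a - 1) <= u * (v / u - 1).
  by apply: ler_pM; rewrite ?powR_ge0 ?subr_ge0 // lerD2r.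
rewrite mulrBr mulr1 -h4 mulrBr mulr1 -vE in h5.
by lra_of h5.
Qed.

Lemma phi_step (R : realType) (c x : R) : 1 < x ->
  exists2 t, x <= t <= x + 1 & phi c (x + 1) - phi c x = phi' c t.
Proof.
move=> x1; have xx : x <= x + 1 by rewrite lerDl.
have D t : x <= t <= x + 1 -> is_derive t 1 (phi c) (phi' c t).
  by move=> /andP[ti _]; apply: is_derive_phi; apply: lt_le_trans x1 _.
have H1 t : t \in `]x, (x + 1)[ -> is_derive t 1 (phi c) (phi' c t).
  by move=> /itvP ti; apply: D; rewrite !ti.
have H2 : {within `[x, (x + 1)], continuous (phi c)}%classic.
  by apply: derivable_within_continuous => t /itvP ti; have [] := D t ltac:(by rewrite !ti).
have [t ti E] := MVT_segment xx H1 H2.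
exists t; first by move/itvP: ti => ti; rewrite !ti.
by rewrite E [x + 1]addrC addrK mulr1.
Qed.

Definition phi'_sum {R : realType} (c : R) (m : nat) : R := \sum_(2 <= i < m.+1) phi' c i%:R.

(** The difference decreases from m = 4 on, and its decrease is bounded by that
    of f, which telescopes. *)
Lemma sum_near_primitive (R : realType) (f F : nat -> R) :
  (forall m, (4 <= m)%N -> 0 <= f m) ->
  (forall m, (4 <= m)%N -> f m.+1 <= F m.+1 - F m <= f m) ->
  exists2 C : R, 0 <= C & forall m, (0 < m)%N -> `|\sum_(2 <= i < m.+1) f i - F m| <= C.
Proof.
move=> f0 fF; pose D m := \sum_(2 <= i < m.+1) f i - F m.
have DS m : (0 < m)%N -> D m.+1 = D m + (f m.+1 - (F m.+1 - F m)).
  by move=> m0; rewrite /D big_nat_recr //=; ring.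
suff : exists2 C : R, 0 <= C & forall m, (0 < m)%N -> `|D m| <= C by [].
move: D DS => D DS.
have step m : D (m + 4)%N <= D 4 /\ D 4 - f 4 + f (m + 4)%N <= D (m + 4)%N.
  elim: m => [|m [I1 I2]]; first by rewrite add0n subrK.
  have /andP[h1 h2] := fF (m + 4)%N (leq_addl _ _).
  rewrite !addSn DS; last by rewrite addnS.
  move: (D _) (D _) (F _) (F _) (f _) (f _) (f _) I1 I2 h1 h2 => X1 X2 X3 X4 X5 X6 X7 I1 I2 h1 h2.
  by split; [lra_of I1 h1 h2 | lra_of I2 h1 h2].
have z i : 0 <= `|D i| by [].
have f4 := f0 4%N isT.
exists (`|D 1%N| + `|D 2| + `|D 3| + `|D 4| + f 4).
  by rewrite !addr_ge0.
have [z1 z2 z3 z4] := And4 (z 1%N) (z 2) (z 3) (z 4).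
move=> m m0; have [m4|m4] := leqP 4 m; last first.
  move: m m0 m4 => [|[|[|[|m]]]] // _ _; lra_of z1 z2 z3 z4 f4.
have [s1 s2] := step (m - 4)%N; rewrite subnK // in s1 s2.
have fm := f0 m m4.
have n1 := ler_norm (D 4); have n2 := ler_norm (- D 4); rewrite normrN in n2.
by rewrite ler_norml; apply/andP; split; lra_of s1 s2 fm n1 n2 z1 z2 z3 f4.
Qed.

Lemma phi'_sum_near (R : realType) (c : R) : 1 < c ->
  exists2 C : R, 0 <= C & forall m, (0 < m)%N -> `|phi'_sum c m - phi c m%:R| <= C.
Proof.
move=> c1; have c0 : 0 < c by apply: lt_trans c1.
have m4 m : (4 <= m)%N -> 4 <= m%:R :> R by move=> h; rewrite ler_nat.
have m1 m : (4 <= m)%N -> 1 < m%:R :> R by move=> h; rewrite ltr1n; apply: leq_trans h.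
apply: (@sum_near_primitive R (fun m => phi' c m%:R) (fun m => phi c m%:R)) => m h.
  by apply: phi'_ge0 => //; exact: m1.
have [t /andP[t1 t2] E] := phi_step c (m1 m h); rewrite natr1 in t2 E; rewrite E.
have h4 := m4 m h; apply/andP; split.
  exact: phi'_decr c1 (le_trans h4 t1) t2.
exact: phi'_decr c1 h4 t1.
Qed.

(** * Small frequencies *)

Lemma floor_truncn (R : realType) (x : R) : 0 <= x -> (Num.floor x)%:~R = (Num.truncn x)%:R :> R.
Proof.
move=> x0; rewrite truncn_floor x0 pmulrn gez0_abs //.
by rewrite floor_ge0.
Qed.

Lemma h_ltr (R : realType) (c x y : R) : 0 < c -> 1 <= x -> x < y -> h c x < h c y.
Proof.
move=> c0 x1 xy; have x0 : 0 < x by apply: lt_le_trans x1.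
have y0 : 0 < y by apply: lt_trans xy.
rewrite /h ltr_expR gt0_ltr_powR ?nnegrE ?ln_ge0 ?ltr_ln ?posrE //.
by apply: le_trans x1 (ltW xy).
Qed.

Lemma h_ge1 (R : realType) (c x : R) : 1 <= h c x.
Proof. by rewrite /h -[leLHS]expR0 ler_expR powR_ge0. Qed.

Lemma h_lt_iff (R : realType) (c x y : R) : 0 < c -> 1 <= x -> 1 <= y ->
  (h c x < y) = (x < phi c y).
Proof.
move=> c0 x1 y1; have p1 : 1 <= phi c y by exact: (@h_ge1 R c^-1).
rewrite -{1}(phiK c0 y1); move: (phi c y) p1 => {y1}y p1; rewrite !ltNge; congr (~~ _).
apply/idP/idP => [H|].
  by rewrite leNgt; apply/negP => xp; move: H; rewrite leNgt h_ltr.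
rewrite le_eqVlt => /orP[/eqP ->|H]; first exact: lexx.
exact: ltW (h_ltr c0 p1 H).
Qed.

(** Summation by parts, each z (key i) being written as z M plus telescoping
    differences. *)
Lemma weighted_sum_by_key (R : realType) (I : Type) (r : seq I) (P : pred I) (wt : I -> R)
    (key : I -> nat) (z : nat -> R[i]) M :
  (forall i, P i -> key i <= M)%N ->
  \sum_(i <- r | P i) (wt i)%:C * z (key i) =
  (\sum_(i <- r | P i) wt i)%:C * z M +
  \sum_(m < M) (\sum_(i <- r | P i && (key i <= m)%N) wt i)%:C * (z m - z m.+1).
Proof.
move=> kM; rewrite rmorph_sum mulr_suml.
under [X in _ + X]eq_bigr do rewrite rmorph_sum mulr_suml.
under [X in _ + X]eq_bigr do rewrite big_mkcondr /=.
rewrite exchange_big /= -big_split /=; apply: eq_bigr => i Pi.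
rewrite -big_mkcond /= -mulr_sumr -mulrDr; congr (_ * _).
have -> : \sum_(m < M | (key i <= m)%N) (z m - z m.+1) = \sum_(key i <= m < M) (z m - z m.+1).
  by rewrite big_geq_mkord.
rewrite -[X in _ + X]opprK -sumrN.
under eq_bigr do rewrite opprB.
by rewrite telescope_sumr ?kM // opprB addrC subrK.
Qed.

Lemma count_below (R : realType) (y : R) (N : nat) : 1 <= y -> y <= N%:R ->
  `|\sum_(1 <= n < N.+1 | n%:R < y) 1 - y| <= 1.
Proof.
move=> y1 yN; have y0 : 0 <= y by apply: le_trans y1.
have /andP[b1 b2] := truncn_itv y0; set t := Num.truncn y in b1 b2.
have t1 : (0 < t)%N by rewrite /t truncn_gt0.
have tN : (t <= N)%N by rewrite -(ler_nat R) (le_trans b1).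
rewrite big_mkcond (big_cat_nat (n := t)) //=; last by apply: leqW.
rewrite [\sum_(t <= n < N.+1) _]big_ltn //.
have -> : \sum_(t.+1 <= n < N.+1) (if n%:R < y then 1 else 0) = 0 :> R.
  rewrite big_nat_cond big1 //.
  move=> n /andP[/andP[tn _] _]; rewrite ltNge (_ : y <= n%:R) //.
  by apply: ltW; apply: lt_le_trans b2 _; rewrite ler_nat.
rewrite addr0.
have -> : \sum_(1 <= n < t) (if n%:R < y then 1 else 0) = t%:R - 1 :> R.
  rewrite big_nat (eq_bigr (fun => 1)); last first.
    by move=> n /andP[_ nt]; rewrite (_ : n%:R < y) //; apply: lt_le_trans b1; rewrite ltr_nat.
  by rewrite -big_nat sumr_const_nat natrB.
rewrite -natr1 in b2.
by rewrite ler_norml; case: ltP => h; apply/andP; split; lra_of b1 b2 h.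
Qed.

Lemma h_ge0 (R : realType) (c x : R) : 0 <= h c x.
Proof. exact: expR_ge0. Qed.

Lemma phi_ge1 (R : realType) (c x : R) : 1 <= phi c x.
Proof. exact: (h_ge1 c^-1 x). Qed.

Lemma phi_le (R : realType) (c x y : R) : 0 < c -> 1 <= x -> x <= y -> phi c x <= phi c y.
Proof.
move=> c0 x1; rewrite le_eqVlt => /orP[/eqP ->|H]; first exact: lexx.
have ci : 0 < c^-1 by rewrite invr_gt0.
exact: ltW (@h_ltr R c^-1 x y ci x1 H).
Qed.

Lemma tail_bounded (R : realType) (f : nat -> R) : (forall m, (2 <= m)%N -> 0 <= f m) ->
  (forall m, (4 <= m)%N -> f m <= f 4%N) ->
  exists2 F : R, 0 <= F & forall m, (2 <= m)%N -> 0 <= f m <= F.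
Proof.
move=> P D; have [p2 p3 p4] := And3 (P 2 isT) (P 3 isT) (P 4%N isT).
exists (f 2 + f 3 + f 4%N); first exact: addr_ge0 (addr_ge0 p2 p3) p4.
move=> m m2; rewrite P //=; have [m4|m4] := leqP 4 m; last first.
  have /orP[/eqP ->|/eqP ->] : (m == 2) || (m == 3) by clear -m2 m4; lia.
    by lra_of p2 p3 p4.
  by lra_of p2 p3 p4.
have h := D m m4.
by lra_of p2 p3 h.
Qed.

Lemma phi'_bounded (R : realType) (c : R) : 1 < c ->
  exists2 F : R, 0 <= F & forall m, (2 <= m)%N -> 0 <= phi' c m%:R <= F.
Proof.
move=> c1; have c0 : 0 < c by apply: lt_trans c1.
have P m : (2 <= m)%N -> 0 <= phi' c m%:R by move=> m2; apply: phi'_ge0; rewrite ?ltr1n.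
have D m : (4 <= m)%N -> phi' c m%:R <= phi' c 4%:R.
  by move=> m4; apply: (phi'_decr c1 (lexx 4%:R)); rewrite ler_nat.
exact: (@tail_bounded R (fun m => phi' c m%:R) P D).
Qed.

Lemma between_near (R : realType) (X Y Z T N C F : R) : 0 <= C -> 0 <= F ->
  Z <= N -> N <= T -> `|X - Z| <= C -> `|Y - T| <= C -> 0 <= Y - X <= F ->
  `|N - X| <= 1 + F + 3 * C.
Proof.
rewrite !ler_norml => C0 F0 p1 p2 /andP[h1 h2] /andP[h3 h4] /andP[h5 h6].
by apply/andP; split; lra_of p1 p2 h1 h2 h3 h4 h5 h6 C0 F0.
Qed.

Lemma shifted_near (R : realType) (X Y Z T C F : R) : 0 <= C -> 0 <= F ->
  `|T - Z| <= 1 -> `|Y - Z| <= C -> 0 <= Y - X <= F -> `|T - X| <= 1 + F + 3 * C.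
Proof.
rewrite !ler_norml => C0 F0 /andP[h1 h2] /andP[h3 h4] /andP[h5 h6].
by apply/andP; split; lra_of h1 h2 h3 h4 h5 h6 C0 F0.
Qed.

(** [floor (h n) <= m] means [n < phi (m + 1)], so that the numbers of solutions
    are counted by phi. *)
Lemma floor_count_near (R : realType) (c : R) : 1 < c ->
  exists2 C : R, 0 <= C & forall (N m M : nat), (0 < N)%N -> M = Num.truncn (h c N%:R) -> (m < M)%N -> `|\sum_(1 <= n < N.+1 | (0 < n <= N)%N && (Num.truncn (h c n%:R) <= m)%N) 1
       - phi'_sum c m| <= C /\ `|N%:R - phi'_sum c M| <= C.
Proof.
move=> c1; have c0 : 0 < c by apply: lt_trans c1.
have [C C0 near] := phi'_sum_near c1.
have [F F0 bd] := phi'_bounded c1.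
have step k : (0 < k)%N -> 0 <= phi'_sum c k.+1 - phi'_sum c k <= F.
  move=> k0; rewrite /phi'_sum big_nat_recr //= [_ + phi' _ _]addrC addrK; exact: bd.
exists (1 + F + 3 * C); first by rewrite !addr_ge0 ?mulr_ge0.
move=> N m M N0 ME mM.
have N1 : 1 <= N%:R :> R by rewrite ler1n.
have MH : M%:R <= h c N%:R by rewrite ME truncn_le; exact: h_ge0.
have HM : h c N%:R < M.+1%:R by rewrite -truncn_le_nat ME.
have M0 : (0 < M)%N by apply: leq_trans mM.
split; last first.
  have p1 : phi c M%:R <= N%:R.
    by rewrite -[leRHS](hK c0 N1); apply: phi_le => //; rewrite ler1n.
  have p2 : N%:R <= phi c M.+1%:R by apply: ltW; rewrite -h_lt_iff // ler1n.
  exact: between_near C0 F0 p1 p2 (near M M0) (near M.+1 isT) (step M M0).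
have [->|m0] := posnP m.
  rewrite big_pred0 => [|n]; last first.
    by rewrite truncn_le_nat ltNge h_ge1 andbF.
  by rewrite /phi'_sum big_geq // subrr normr0 !addr_ge0 ?mulr_ge0.
have pN : phi c m.+1%:R <= N%:R.
  rewrite -[leRHS](hK c0 N1); apply: phi_le => //; first by rewrite ler1n.
  by apply: le_trans MH; rewrite ler_nat.
have := count_below (phi_ge1 c m.+1%:R) pN.
have -> : \sum_(1 <= n < N.+1 | n%:R < phi c m.+1%:R) (1 : R) =
   \sum_(1 <= n < N.+1 | (0 < n <= N)%N && (Num.truncn (h c n%:R) <= m)%N) 1.
  rewrite [LHS]big_nat_cond [RHS]big_nat_cond; apply: eq_bigl => n.
  rewrite ltnS; case: (boolP (0 < n <= N)%N) => //= /andP[n0 nN].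
  by rewrite truncn_le_nat h_lt_iff // ler1n.
move=> cnt; exact: shifted_near C0 F0 cnt (near m.+1 isT) (step m m0).
Qed.

(** Both sums have partial counts phi(m) + O(1), while e(m xi) varies by O(|xi|)
    from one integer to the next. *)
Lemma floor_sum_near_smooth (R : realType) (c : R) : 1 < c ->
  exists2 C : R, 0 <= C & forall (N : nat) (xi : R), (0 < N)%N ->
  cnorm (\sum_(1 <= n < N.+1) e ((Num.floor (h c n%:R))%:~R * xi) -
     \sum_(2 <= m < (Num.truncn (h c N%:R)).+1) (phi' c m%:R)%:C * e (m%:R * xi)) <=
  C * (1 + h c N%:R * `|xi|).
Proof.
move=> c1; have c0 : 0 < c by apply: lt_trans c1.
have [C C0 near] := floor_count_near c1.
exists (16 * C); first by rewrite mulr_ge0.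
move=> N xi N0; set M := Num.truncn (h c N%:R).
pose z m : R[i] := e (m%:R * xi).
have MH : M%:R <= h c N%:R by rewrite truncn_le; exact: h_ge0.
have M0 : (0 < M)%N by rewrite truncn_gt0 h_ge1.
have -> : \sum_(1 <= n < N.+1) e ((Num.floor (h c n%:R))%:~R * xi) =
   \sum_(1 <= n < N.+1 | (0 < n <= N)%N) (1 : R)%:C * z (Num.truncn (h c n%:R)).
  rewrite [LHS]big_nat_cond [RHS]big_nat_cond; apply: eq_big => n; first by rewrite andbT andbb.
  by move=> _; rewrite mul1r floor_truncn ?h_ge0.
have -> : \sum_(2 <= m < M.+1) (phi' c m%:R)%:C * e (m%:R * xi) =
   \sum_(2 <= m < M.+1 | (1 < m <= M)%N) (phi' c m%:R)%:C * z m.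
  by rewrite [LHS]big_nat_cond [RHS]big_nat_cond; apply: eq_bigl => n; rewrite andbT andbb.
have kM n : (0 < n <= N)%N -> (Num.truncn (h c n%:R) <= M)%N.
  move=> /andP[n0 nN]; apply: le_truncn; move: nN; rewrite leq_eqVlt => /orP[/eqP ->|nN].
    exact: lexx.
  by apply: ltW; apply: h_ltr => //; rewrite ?ler1n ?ltr_nat.
rewrite (weighted_sum_by_key _ _ _ kM).
rewrite (@weighted_sum_by_key _ _ _ _ _ id z M); last by move=> i /andP[].
have B m : (m <= M)%N -> \sum_(2 <= i < M.+1 | (1 < i <= M)%N && (i <= m)%N) phi' c i%:R = phi'_sum c m.
  move=> mM; rewrite /phi'_sum (big_nat_widen 2 m.+1 M.+1) //.
  rewrite [LHS]big_nat_cond [RHS]big_nat_cond; apply: eq_bigl => i.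
  by rewrite !ltnS; case: (1 < i)%N => //=; case: (i <= M)%N.
have BM : \sum_(2 <= i < M.+1 | (1 < i <= M)%N) phi' c i%:R = phi'_sum c M.
  rewrite -B //; rewrite [LHS]big_nat_cond [RHS]big_nat_cond; apply: eq_bigl => i.
  by rewrite ltnS; case: (1 < i)%N => //=; case: (i <= M)%N.
have AM : \sum_(1 <= n < N.+1 | (0 < n <= N)%N) (1 : R) = N%:R.
  transitivity (\sum_(1 <= n < N.+1) (1 : R)).
    by rewrite [LHS]big_nat_cond [RHS]big_nat_cond; apply: eq_bigl => n; rewrite andbT andbb.
  by rewrite sumr_const_nat subn1.
rewrite BM AM opprD addrACA -mulrBl -rmorphB -sumrB.
apply: le_trans (cnormD _ _) _.
have h1 : cnorm ((N%:R - phi'_sum c M)%:C * z M) <= C.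
  by rewrite cnormM cnorm_real cnorm_e mulr1; have [] := near N 0%N M N0 erefl M0.
have h2 : cnorm (\sum_(i < M) (((\sum_(1 <= n < N.+1 | (0 < n <= N)%N && (Num.truncn (h c n%:R) <= i)%N) 1)%:C *
    (z i - z i.+1)) - (\sum_(2 <= j < M.+1 | (1 < j <= M)%N && (j <= i)%N) phi' c j%:R)%:C * (z i - z i.+1))) <=
   M%:R * (C * (16 * `|xi|)).
  apply: le_trans (cnorm_sum _ _ _) _.
  rewrite [leRHS]mulr_natl -[X in _ *+ X]card_ord -sumr_const; apply: ler_sum => m _.
  rewrite -mulrBl -rmorphB cnormM cnorm_real; apply: ler_pM; rewrite ?cnorm_ge0 //.
    by rewrite B ?(ltnW (ltn_ord m)) //; have [] := near N m M N0 erefl (ltn_ord m).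
  have E : m%:R * xi - m.+1%:R * xi = - xi by rewrite -(natr1 m); ring.
  by apply: le_trans (cnorm_eB_le _ _) _; rewrite E normrN.
apply: le_trans (lerD h1 h2) _.
have h3 : M%:R * `|xi| <= h c N%:R * `|xi| by apply: ler_wpM2r.
have h4 := ler_wpM2l C0 h3.
rewrite mulrDr mulr1; apply: lerD; first by lra_of C0.
have -> : M%:R * (C * (16 * `|xi|)) = 16 * (C * (M%:R * `|xi|)) by ring.
have -> : 16 * C * (h c N%:R * `|xi|) = 16 * (C * (h c N%:R * `|xi|)) by ring.
by lra_of h4.
Qed.

(** * Large frequencies *)

Lemma smooth_sum_trivial (R : realType) (c C xi y : R) : 1 < c ->
  (forall m, (0 < m)%N -> `|phi'_sum c m - phi c m%:R| <= C) -> 1 <= y ->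
  cnorm (\sum_(2 <= m < (Num.truncn (h c y)).+1) (phi' c m%:R)%:C * e (m%:R * xi)) <= y + C.
Proof.
move=> c1 near y1; have c0 : 0 < c by apply: lt_trans c1.
set M := Num.truncn _.
have M0 : (0 < M)%N by rewrite truncn_gt0 h_ge1.
have MH : M%:R <= h c y by rewrite truncn_le h_ge0.
apply: le_trans (cnorm_sum _ _ _) _.
have -> : \sum_(2 <= m < M.+1) cnorm ((phi' c m%:R)%:C * e (m%:R * xi)) = phi'_sum c M.
  apply: eq_big_nat => m /andP[m2 _].
  rewrite cnormM cnorm_real cnorm_e mulr1 ger0_norm //.
  by apply: phi'_ge0 => //; rewrite ltr1n.
have p1 : phi c M%:R <= y by rewrite -[leRHS](hK c0 y1); apply: phi_le => //; rewrite ler1n.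
have := near M M0; rewrite ler_norml => /andP[_ H].
by rewrite -lerBlDl (le_trans _ H) // lerB.
Qed.

Lemma smooth_sum_tail (R : realType) (c xi : R) (p n : nat) : 1 < c -> xi != 0 -> `|xi| <= 2^-1 ->
  (4 <= p)%N -> cnorm (\sum_(p <= m < n) (phi' c m%:R)%:C * e (m%:R * xi)) <= phi' c p%:R * (2 / `|xi|).
Proof.
move=> c1 x0 x2 p4; have c0 : 0 < c by apply: lt_trans c1.
have f0 i : (p <= i)%N -> 0 <= phi' c i%:R.
  by move=> pi; apply: phi'_ge0 => //; rewrite ltr1n; apply: leq_trans pi; apply: leq_trans p4.
have [np|pn] := leqP n p.
  by rewrite big_geq // cnorm0 mulr_ge0 ?f0 // divr_ge0.
apply: (@abel_bound R (fun m => phi' c m%:R) (fun m => e (m%:R * xi)) _ p n _ _ _ pn).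
- by move=> i /andP[pi _]; exact: f0.
- move=> i pi _; apply: phi'_decr => //; last by rewrite ler_nat.
  by rewrite ler_nat (leq_trans p4).
move=> i /andP[pi _].
rewrite -{1}[p]add0n big_addn big_mkord.
have E j : (j + p)%:R * xi = p%:R * xi + xi *+ j by rewrite natrD mulrDl addrC (mulr_natl xi j).
under eq_bigr do rewrite E.
exact: geom_e_le.
Qed.

(** The terms with m <= h(N exp(-v)) are bounded trivially. On the remaining
    range, sums of e(m xi) are at most 2 / |xi|, which is at most
    2 N^(-3/4) exp(lam g), and h varies by a factor exp(2 g v) at most. *)
Lemma smooth_sum_small (R : realType) (c lam w v g xi C : R) (N : nat) :
  1 < c -> c < 8 / 7 -> large c lam w v g -> N%:R = expR lam ->
  (forall m, (0 < m)%N -> `|phi'_sum c m - phi c m%:R| <= C) ->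
  xi != 0 -> `|xi| <= 2^-1 -> 3 / 4 * lam <= ln `|xi| + lam * g ->
  cnorm (\sum_(2 <= m < (Num.truncn (h c N%:R)).+1) (phi' c m%:R)%:C * e (m%:R * xi)) <=
    3 * (N%:R * expR (- v)) + C.
Proof.
move=> c1 c2 lg NE near x0 x2 t1; have c0 : 0 < c by apply: lt_trans c1.
have [w100 q2 _ vw] := large_facts lg.
have [_ [_ [_ [v1 [_ [gw [g10 _]]]]]]] := lg.
have [w0 w22 qq] := large_sizes lg.
have cp : 0 < c - 1 by lra_of c1.
have cg0 : 0 < (c - 1) * g by lra_of g10.
have g0 : 0 < g by rewrite -(pmulr_rgt0 _ cp).
have g1 : 10 <= g.
  have h : (c - 1) * g <= 1 * g by apply: ler_wpM2r; [exact: ltW | lra_of c2].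
  by lra_of h g10.
have lam0 : 0 < lam by lra_of qq w22 w0.
have gv : g * v <= w ^+ 2 by rewrite expr2; apply: ler_pM => //; [exact: ltW | lra_of v1 | lra_of vw v1].
pose t := lam - v.
have tt : lam - v <= t <= lam by rewrite lexx /= lerBlDr lerDl; lra_of v1.
have c22 : c < 2 by lra_of c2.
have [_ /andP[p1 _] _ _] := large_pow c1 c22 lg tt.
have t0 : 0 <= t by rewrite subr_ge0; lra_of vw qq w22 w0 v1.
have tc4 : 4 <= t `^ c.
  apply: le_trans p1; have h : 10 * (lam - 2 * v) <= g * (lam - 2 * v).
    by apply: ler_wpM2r => //; lra_of vw qq w22 w0 v1.
  by lra_of h vw qq w22 w0 v1 w100.
pose y := expR t.
have y1 : 1 <= y by rewrite -[leLHS]expR0 ler_expR.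
have yN : y <= N%:R by rewrite NE ler_expR; have /andP[] := tt.
have X0 : h c y = expR (t `^ c) by rewrite /h /y expRK.
have X4 : 4 <= h c y by rewrite X0; apply: le_trans (expR_ge1Dx _); lra_of tc4.
have hyN : h c y <= h c N%:R.
  move: yN; rewrite le_eqVlt => /orP[/eqP ->|H]; first exact: lexx.
  exact: ltW (h_ltr c0 y1 H).
pose p := (Num.truncn (h c y)).+1.
have Xp : h c y < p%:R by rewrite -truncn_le_nat.
have p4 : (4 <= p)%N by rewrite -(ler_nat R); apply: le_trans X4 (ltW Xp).
have pN : (p <= (Num.truncn (h c N%:R)).+1)%N by rewrite ltnS le_truncn.
rewrite (@big_cat_nat _ _ _ p); [|by apply: leq_trans p4|exact: pN].
apply: le_trans (cnormD _ _) _.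
have H1 := smooth_sum_trivial xi c1 near y1.
have H2 := smooth_sum_tail (Num.truncn (h c N%:R)).+1 c1 x0 x2 p4.
have H3 : phi' c p%:R * (2 / `|xi|) <= 2 * y.
  have xp : 0 < `|xi| by rewrite normr_gt0.
  have fX : phi' c (h c y) <= expR (t - t `^ c).
    have /andP[a0 a1] := inv_exponent c1.
    rewrite phi'E; last by apply: lt_le_trans X4; rewrite ltr1n.
    have -> : ln (h c y) = t `^ c by rewrite X0 expRK.
    rewrite -powRrM mulfV ?gt_eqF // powRr1 //.
    rewrite -[leRHS]mulr1; apply: ler_wpM2l; first exact: expR_ge0.
    apply: mulr_ile1; rewrite ?powR_ge0 ?(ltW a0) //.
    by rewrite -[leRHS](powRr0 (t `^ c)) ler_powR ?subr_le0 //; lra_of tc4.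
  have xi_inv : `|xi|^-1 <= expR (lam * g - 3 / 4 * lam).
    rewrite -[`|xi|^-1]lnK ?posrE ?invr_gt0 // ler_expR lnV ?posrE //.
    by lra_of t1.
  have fp : phi' c p%:R <= expR (t - t `^ c) by apply: le_trans fX; apply: phi'_decr => //; exact: ltW.
  have -> : phi' c p%:R * (2 / `|xi|) = 2 * (phi' c p%:R * `|xi|^-1) by ring.
  apply: ler_wpM2l => //.
  apply: (@le_trans _ _ (expR (t - t `^ c) * expR (lam * g - 3 / 4 * lam))).
    apply: ler_pM => //.
    by apply: phi'_ge0 => //; rewrite ltr1n; apply: leq_trans p4.
  rewrite -expRD /y ler_expR.
  have e1 : g * (lam - 2 * v) = lam * g - 2 * (g * v) by ring.
  rewrite e1 in p1; move: (lam * g) (g * v) (t `^ c) p1 gv => A B T p1 gv.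
  by lra_of p1 gv qq lam0.
have yE : N%:R * expR (- v) = y by rewrite NE /y /t expRD.
rewrite yE.
apply: le_trans (lerD H1 (le_trans H2 H3)) _.
by have -> : 3 * y + C = y + C + 2 * y by ring.
Qed.

(** * Conclusion *)

Definition disc_sum {R : realType} (c xi : R) (N : nat) : R[i] :=
  \sum_(1 <= n < N.+1) e ((Num.floor (h c n%:R))%:~R * xi)
  - \sum_(2 <= m < (Num.truncn (h c N%:R)).+1) (phi' c m%:R)%:C * e (m%:R * xi).

Lemma disc_sum_periodic (R : realType) (c xi : R) N (r : int) :
  disc_sum c (xi + r%:~R) N = disc_sum c xi N.
Proof.
have E (k : int) : e (k%:~R * (xi + r%:~R)) = e (k%:~R * xi) by rewrite mulrDr -intrM e_periodic.
congr (_ - _); apply: eq_bigr => n _; first exact: E.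
by rewrite [n%:R]pmulrn E.
Qed.

Lemma nearest_shift (R : realType) (xi : R) : exists r : int, `|xi + r%:~R| <= 2^-1.
Proof.
exists (- Num.floor (xi + 2^-1)); have /andP[a b] := floor_itv (xi + 2^-1).
rewrite intrD in b; rewrite mulrNz ler_norml; move: (Num.floor _)%:~R a b => f a b.
by apply/andP; split; lra_of a b.
Qed.

Lemma large_with_slack (R : realType) (c : R) : 1 < c -> c < 8 / 7 ->
  exists2 L0 : R, 1 <= L0 & forall lam, L0 <= lam ->
    [/\ large c lam (lam `^ 7^-1) (lam `^ 8^-1) (lam `^ (c - 1)), 400 <= lam `^ 8^-1 &
        6 * lam `^ 9^-1 <= lam `^ 8^-1].
Proof.
move=> c1 c2; have [L0 l0 lg] := large_eventually c1 c2.
pose a1 : R := 400 `^ (8^-1)^-1.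
pose a2 : R := 6 `^ (8^-1 - 9^-1)^-1.
have [z1 z2] : 0 <= a1 /\ 0 <= a2 by split; exact: powR_ge0.
have d0 : 0 < 8^-1 - 9^-1 :> R by lra.
exists (L0 + a1 + a2); first by lra_of l0 z1 z2.
move=> lam L.
have [L1 L2 L3] : [/\ L0 <= lam, a1 <= lam & a2 <= lam] by split; lra_of z1 z2 l0 L.
have lam0 : 0 < lam by lra_of L1 l0.
split; first exact: lg.
  by apply: le_powR_of_root; [exact: ler0n | rewrite invr_gt0 ltr0n | exact: L2].
have h : 6 <= lam `^ (8^-1 - 9^-1) by apply: le_powR_of_root; [exact: ler0n | exact: d0 | exact: L3].
have -> : lam `^ 8^-1 = lam `^ (8^-1 - 9^-1) * lam `^ 9^-1.
  by rewrite -powRD ?subrK // (gt_eqF lam0) implybT.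
by apply: ler_wpM2r => //; exact: powR_ge0.
Qed.

Lemma disc_sum_trivial (R : realType) (c C xi : R) N : 1 < c -> (0 < N)%N ->
  (forall m, (0 < m)%N -> `|phi'_sum c m - phi c m%:R| <= C) -> 0 <= C ->
  cnorm (disc_sum c xi N) <= (2 + C) * N%:R.
Proof.
move=> c1 N0 near C0; have N1 : 1 <= N%:R :> R by rewrite ler1n.
apply: le_trans (cnormB _ _) _.
have h1 := smooth_sum_trivial xi c1 near N1.
have h2 := norm_sum_le_size (fun n => (Num.floor (h c n%:R))%:~R * xi) 1 N.+1.
rewrite subn1 /= in h2.
apply: le_trans (lerD h2 h1) _.
have h3 : C * 1 <= C * N%:R by apply: ler_wpM2l.
by rewrite mulr1 in h3; move: (C * N%:R) h3 (mulrDl 2 C N%:R) => D h3 ->; lra_of h3.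
Qed.

(** Frequencies are separated according to the size of |xi| exp(lam g) relative
    to N^(3/4), where exp(lam g) stands for h(N). *)
Lemma disc_sum_large (R : realType) (c C1 C2 lam w v g xi : R) N :
  1 < c -> c < 8 / 7 -> large c lam w v g -> 400 <= v -> N%:R = expR lam -> (0 < N)%N ->
  `|xi| <= 2^-1 -> 0 <= C1 -> 0 <= C2 ->
  (forall m, (0 < m)%N -> `|phi'_sum c m - phi c m%:R| <= C1) ->
  cnorm (disc_sum c xi N) <= C2 * (1 + h c N%:R * `|xi|) ->
  cnorm (disc_sum c xi N) <= (633 + C1 + 2 * C2) * (N%:R * expR (- (v / 6))).
Proof.
move=> c1 c2 lg v400 NE N0 x2 C10 C20 near smooth; have c0 : 0 < c by apply: lt_trans c1.
have [w100 q2 _ vw] := large_facts lg.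
have [w0 w22 qq] := large_sizes lg.
have v0 : 0 <= v by lra_of v400.
have vlam : 4 * v <= lam by lra_of vw qq w22 w0.
set U := N%:R * expR (- (v / 6)).
have U1 : 1 <= U.
  by rewrite /U NE -expRD -[leLHS]expR0 ler_expR; lra_of vlam v0.
have U0 : 0 <= U by lra_of U1.
have CU : 0 <= C1 * U by rewrite mulr_ge0.
have CU2 : 0 <= C2 * U by rewrite mulr_ge0.
have C1U : C1 * 1 <= C1 * U by apply: ler_wpM2l.
rewrite mulr1 in C1U.
have expand : (633 + C1 + 2 * C2) * U = 633 * U + C1 * U + 2 * (C2 * U) by ring.
rewrite expand.
have hN : h c N%:R <= expR (lam * g).
  have tt : lam - v <= lam <= lam by rewrite lexx lerBlDr lerDl v0.
  have c22 : c < 2 by lra_of c2.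
  have [_ /andP[_ p2] _ _] := large_pow c1 c22 lg tt.
  by rewrite /h NE expRK ler_expR.
have [small|] := lerP (expR (lam * g) * `|xi|) (expR (3 / 4 * lam)).
  have h1 : 1 + h c N%:R * `|xi| <= 2 * U.
    have h2 : expR (3 / 4 * lam) <= U.
      by rewrite /U NE -expRD ler_expR; lra_of vlam v0.
    have h3 : h c N%:R * `|xi| <= expR (lam * g) * `|xi| by apply: ler_wpM2r.
    by lra_of h2 h3 small U1.
  have h2 := ler_wpM2l C20 h1.
  have e2 : C2 * (2 * U) = 2 * (C2 * U) by ring.
  by rewrite e2 in h2; lra_of smooth h2 CU U0.
move=> big.
have x0 : xi != 0.
  by apply/eqP => x00; move: big; rewrite x00 normr0 mulr0 ltNge expR_ge0.
have t1 : 3 / 4 * lam <= ln `|xi| + lam * g.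
  by rewrite -ler_expR expRD lnK ?posrE ?normr_gt0 // [leRHS]mulrC; exact: ltW.
have t2 : lam / 2 <= ln `|xi| + lam * g by apply: le_trans t1; lra_of vlam v0.
have h1 := floor_exp_sum c1 c2 lg NE v400 x0 x2 t2.
have h2 := smooth_sum_small c1 c2 lg NE near x0 x2 t1.
apply: le_trans (cnormB _ _) _.
have -> : \sum_(1 <= n < N.+1) e ((Num.floor (h c n%:R))%:~R * xi) =
  \sum_(n < N) e ((Num.floor (h c n.+1%:R))%:~R * xi) by rewrite big_add1 big_mkord.
have h3 : N%:R * expR (- v) <= U.
  by apply: ler_wpM2l => //; rewrite ler_expR; lra_of v0.
apply: le_trans (lerD h1 h2) _; rewrite -/U.
by lra_of h3 C1U CU2.
Qed.

(** The exponent 1/9 is chosen below 1/8 so as to absorb the constant 1/6 in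
    exp(-v / 6), where v = (ln N)^(1/8). *)
Lemma disc_sum_le (R : realType) (c : R) : 1 < c -> c < 8 / 7 -> exists2 C : R, 0 < C &
  forall (N : nat) (xi : R), (0 < N)%N ->
    cnorm (disc_sum c xi N) <= C * N%:R * expR (- (ln N%:R `^ 9^-1)).
Proof.
move=> c1 c2; have [L0 L1 lg] := large_with_slack c1 c2.
have [C1 C10 near] := phi'_sum_near c1.
have [C2 C20 smooth] := floor_sum_near_smooth c1.
have E0 : 0 <= expR L0 by exact: expR_ge0.
pose A := 633 + C1 + 2 * C2; pose B := (2 + C1) * expR L0.
have A0 : 0 < A by rewrite /A; lra_of C10 C20.
have B0 : 0 <= B by rewrite mulr_ge0 // addr_ge0.
exists (A + B); first by rewrite ltr_wpDr.
move=> N xi0 N0.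
have [r x2] := nearest_shift xi0; rewrite -(disc_sum_periodic c xi0 N r).
move: (xi0 + _) x2 => xi x2.
have NR : 0 < N%:R :> R by rewrite ltr0n.
pose lam := ln (N%:R : R); have NE : N%:R = expR lam by rewrite lnK.
have lam0 : 0 <= lam by rewrite ln_ge0 // ler1n.
have P0 : 0 <= N%:R * expR (- (lam `^ 9^-1)) by rewrite mulr_ge0 ?expR_ge0.
rewrite -/lam -mulrA mulrDl.
have [Ll|lL] := lerP L0 lam.
  have [lg1 v400 vs] := lg lam Ll.
  have H := disc_sum_large c1 c2 lg1 v400 NE N0 x2 C10 C20 near (smooth N xi N0).
  apply: le_trans H _; rewrite -/A.
  apply: (@le_trans _ _ (A * (N%:R * expR (- (lam `^ 9^-1))))).
    apply: ler_wpM2l; first exact: ltW.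
    by apply: ler_wpM2l => //; rewrite ler_expR lerN2 ler_pdivlMr // mulrC.
  by rewrite lerDl mulr_ge0.
apply: le_trans (disc_sum_trivial xi c1 N0 near C10) _.
apply: (@le_trans _ _ (B * (N%:R * expR (- (lam `^ 9^-1))))); last first.
  by rewrite lerDr mulr_ge0 // ltW.
have -> : B * (N%:R * expR (- (lam `^ 9^-1))) = (2 + C1) * N%:R * (expR L0 * expR (- (lam `^ 9^-1))).
  by rewrite /B; ring.
rewrite ler_peMr //; first by rewrite mulr_ge0 // addr_ge0.
rewrite -expRD -[leLHS]expR0 ler_expR subr_ge0.
apply: (@le_trans _ _ (L0 `^ 9^-1)).
  by apply: ge0_ler_powR; rewrite ?nnegrE ?invr_ge0 // ?(ltW lL) // (le_trans ler01).
by rewrite -[leRHS]powRr1 ?(le_trans ler01) // ler_powR // invf_le1 // ler1n.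
Qed.

Theorem proposition1p13 (R : realType) (c : R) (hc1 : 1 < c) (hc2 : c < 8 / 7) :
  exists chi C : R, 0 < chi /\ 0 < C /\
    forall (N : nat) (xi : R), (0 < N)%N ->
      `| \sum_(1 <= n < N.+1) e ((Num.floor (h c n%:R))%:~R * xi)
         - \sum_(2 <= m < (Num.truncn (h c N%:R)).+1)
             (derive1 (phi c) m%:R : R)%:C * e (m%:R * xi) |
      <= (C * N%:R * expR (- (ln N%:R `^ chi)))%:C.
Proof.
have [C C0 bound] := disc_sum_le hc1 hc2.
exists 9^-1, C; split; first by rewrite invr_gt0.
split=> // N xi N0.
have := bound N xi N0.
by rewrite cnormE lecR.
Qed.
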